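(* Let $S$ be an asymptotically compact quasi-contractive holomorphic $C_0$-semigroup on a complex Hilbert space $H$ with generator $-A$. Then there exist an equivalent scalar product $[\cdot,\cdot]$ on $H$, a Hilbert space $V$ continuously and densely embedded into $H$, and a continuous, essentially positive-coercive sesquilinear form $a:V\times V\to\mathbb{C}$ such that $A$ is the operator associated with $a$ on $(H,[\cdot,\cdot])$.
   Context: For a bounded operator $T$ on $H$, $\|T\|_{ess}$ denotes the distance (in operator norm) of $T$ to the space of compact operators on $H$. A $C_0$-semigroup $S$ is asymptotically compact if there exist $M\ge 0$, $\delta>0$ with $\|S(t)\|_{ess}\le Me^{-\delta t}$ for all $t\ge 0$. It is quasi-contractive if there is $w\in\mathbb{R}$ with $\|S(t)\|\le e^{wt}$ for all $t\ge 0$. An equivalent scalar product on $H$ is a scalar product $[\cdot,\cdot]$ such that $u\mapsto\sqrt{[u,u]}$ is a norm equivalent to the original norm of $H$. That $A$ is associated with $a$ on $(H,[\cdot,\cdot])$ means: $D(A)=\{u\in V:\exists f\in H,\ a(u,v)=[f,v]\text{ for all }v\in V\}$ and $Au=f$. The form $a$ is essentially positive-coercive if, for every sequence $(u_n)$ in $V$, the conditions $u_n\rightharpoonup 0$ weakly in $V$ and $\limsup_{n\to\infty}\operatorname{Re} a(u_n,u_n)\le 0$ imply $\|u_n\|_V\to 0$. *)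

(* Defs.v *)
From HB Require Import structures.
From mathcomp Require Import all_boot all_order all_algebra.
From mathcomp Require Import all_classical all_reals all_analysis.
From mathcomp Require Import complex.

Set Implicit Arguments.
Unset Strict Implicit.
Unset Printing Implicit Defensive.
Import Order.TTheory GRing.Theory Num.Theory.
Import numFieldNormedType.Exports.
Local Open Scope classical_set_scope.
Local Open Scope ring_scope.
Local Open Scope complex_scope.

(* A scalar product is linear in its first and antilinear in its second
   argument, positive definite, and recovers the norm. The norm [`|x|] of a
   normed module over [R[i]] is itself an element of [R[i]]. *)
HB.mixin Record isHilbert (R : realType) H
    of CompleteNormedModule R[i] H := {
  inner : {dot H for (@Num.conj R[i])};
  innerE : forall x : H, inner x x = `|x| ^+ 2
}.

#[short(type="hilbertType")]
HB.structure Definition Hilbert (R : realType) :=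
  {H of isHilbert R H & CompleteNormedModule R[i] H}.

Definition rnorm (R : realType) (H : hilbertType R) (x : H) : R :=
  complex.Re `|x|.

Section operators.
Context (R : realType) (H : hilbertType R).

(* Only meaningful for bounded [T]; [sup] is 0 on sets that are unbounded. *)
Definition opnorm (T : H -> H) : R :=
  sup [set rnorm (T x) | x in [set x | rnorm x <= 1]].

Definition compact_operator (K : {linear H -> H}) : Prop :=
  precompact (K @` [set x | rnorm x <= 1]).

Definition essnorm (T : H -> H) : R :=
  inf [set opnorm (T \- K) | K in compact_operator].

(* Families over the half-line [0, +oo[; the values at negative times are
   irrelevant. *)
Record C0_semigroup (S : R -> {linear H -> H}) : Prop := {
  C0_bounded : forall t, 0 <= t -> continuous (S t);
  C0_0 : forall x, S 0 x = x;
  C0_D : forall s t, 0 <= s -> 0 <= t -> forall x, S (s + t) x = S s (S t x);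
  C0_cvg : forall x, S t x @[t --> 0^'+] --> x
}.

Definition diff_quotient (S : R -> {linear H -> H}) (x : H) (t : R) : H :=
  (t^-1)%:C *: (S t x - x).

(* An unbounded operator is given by its domain [D] and a function whose values
   outside [D] are irrelevant. *)
Definition is_generator (S : R -> {linear H -> H}) (D : set H) (B : H -> H) :=
  D = [set x | cvg (diff_quotient S x t @[t --> 0^'+])] /\
  forall x, D x -> diff_quotient S x t @[t --> 0^'+] --> B x.

Definition asymptotically_compact (S : R -> {linear H -> H}) : Prop :=
  exists M delta : R, [/\ 0 <= M, 0 < delta &
    forall t, 0 <= t -> essnorm (S t) <= M * expR (- delta * t)].

Definition quasi_contractive (S : R -> {linear H -> H}) : Prop :=
  exists w : R, forall t, 0 <= t -> opnorm (S t) <= expR (w * t).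

Definition sector (theta : R) : set R[i] :=
  [set z | exists r phi : R, [/\ 0 < r, `|phi| < theta &
                                z = (r * cos phi) +i* (r * sin phi)]].

(* Complex differentiability in operator norm at every point of [U]. *)
Definition holomorphic_on (U : set R[i]) (T : R[i] -> {linear H -> H}) : Prop :=
  forall z, U z -> exists2 D : {linear H -> H}, continuous D &
    opnorm (fun x => h^-1 *: (T (z + h) x - T z x) - D x)
      @[h --> (0 : R[i]^o)^'] --> (0 : R).

(* The semigroup law and strong continuity extend to the sector by the identity
   theorem and are not required here. *)
Definition holomorphic_semigroup (S : R -> {linear H -> H}) : Prop :=
  exists (theta : R) (T : R[i] -> {linear H -> H}),
    [/\ 0 < theta <= pi / 2,
        (forall z, sector theta z -> continuous (T z)),
        holomorphic_on (sector theta) T,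
        (forall (t : R) x, 0 < t -> T t%:C x = S t x) &
        exists M : R, forall z, sector theta z -> `|z| <= 1 ->
          opnorm (T z) <= M].

Definition equivalent_scalar_product (ip : {dot H for (@Num.conj R[i])}) :=
  exists c1 c2 : R, [/\ 0 < c1, 0 < c2 & forall u : H,
    c1 * rnorm u <= Num.sqrt (complex.Re (ip u u)) <= c2 * rnorm u].

End operators.

Definition weak_cvg0 (R : realType) (V : hilbertType R) (u : nat -> V) : Prop :=
  forall phi : {linear V -> R[i]^o}, continuous phi ->
    phi (u n) @[n --> \oo] --> (0 : R[i]^o).

Notation sesquilinear_form R V :=
  {bilinear V -> V -> R[i] | *%R & (@Num.conj R[i] \; *%R)}.

Section forms.
Context (R : realType) (V H : hilbertType R).

Definition continuous_form (a : sesquilinear_form R V) : Prop :=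
  continuous (fun p : V * V => a p.1 p.2 : R[i]^o).

Definition essentially_positive_coercive (a : sesquilinear_form R V) : Prop :=
  forall u : nat -> V, weak_cvg0 u ->
    (limn_esup (fun n => (complex.Re (a (u n) (u n)))%:E) <= 0)%E ->
    rnorm (u n) @[n --> \oo] --> (0 : R).

Definition dense_embedding (j : {linear V -> H}) : Prop :=
  [/\ injective j, continuous j & dense (range j)].

(* [V] is regarded as a subspace of [H] through the embedding [j]. *)
Definition associated_operator (ip : {dot H for (@Num.conj R[i])})
    (j : {linear V -> H}) (a : sesquilinear_form R V)
    (D : set H) (A : H -> H) : Prop :=
  D = [set j u | u in [set u | exists f, forall v, a u v = ip f (j v)]] /\
  forall u, D (j u) -> forall v, a u v = ip (A (j u)) (j v).

End forms.

(* Main.v *)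
(* Write [G t = A S(t)], which is bounded for [t > 0]. After an exponential
   damping [S] and its adjoint are analytic semigroups of contractions, hence have
   square function estimates; they make
     [x, y] = int_0^tau t <G t x, G t y> dt + <S tau x, S tau y>
   an equivalent scalar product. Let [V] consist of the [u] of finite energy
   [int_0^tau |G t u|^2 dt]. On [V] the quantity [A u, v] is represented by the form
     a(u, v) = int_0^tau t <A G t u, G t v> dt + <G tau u, S tau v>,
   and integrating the derivative of [t |G t u|^2] gives
     Re a(u, u) >= (1/2) int_0^tau |G t u|^2 dt - (tau/2) |G tau u|^2
                   + Re <G tau u, S tau u>.
   The boundary terms are controlled by [|S (tau - 1) u|^2]. Along a weakly null
   sequence this is at most [c e^(-2 delta tau) |u|^2] up to a null sequence,
   because [S (tau - 1)] is a compact perturbation of an operator of exponentially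
   small norm; for the same reason [|u|^2] is eventually bounded by the energy,
   uniformly in [tau]. A large [tau] thus makes [a] essentially positive-coercive.
   Finally [a + lam] is coercive and [A + lam] is onto for large [lam], so [A] is
   the operator associated with [a]. *)
Require Import Defs.
From HB Require Import structures.
From mathcomp Require Import all_boot all_order all_algebra.
From mathcomp Require Import all_classical all_reals all_analysis.
From mathcomp Require Import complex.
From mathcomp Require Import measurable_realfun.
From mathcomp Require Import ring lra.

Set Implicit Arguments.
Unset Strict Implicit.
Unset Printing Implicit Defensive.
Import Order.TTheory GRing.Theory Num.Theory.
Import numFieldNormedType.Exports.
Local Open Scope classical_set_scope.
Local Open Scope ring_scope.
Local Open Scope complex_scope.

(** The contraction bound holds on the half-line only, not on a sector, so the numerical range of
    [A] for the original product need not lie in a sector; this forces a new product. The new norm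
    is the square function of [t A S t], and [V] is the real interpolation space halfway between [H]
    and the domain of [A]. With these norms the continuity of the form is a Cauchy-Schwarz
    inequality in which the weight [t] pays for the extra factor [A], and no square root of [A]
    occurs. The square function estimates of a contraction semigroup [U] come from a telescoping
    sum: at dyadic times the quantities are dominated by increments of the squared norms of
    resolvents of [1 - U h]. The lower bound of the new norm follows by duality from the same
    estimate for the adjoint. Since [G t = S (t - c) (G c)] for [c <= t], integrals over []0, tau]]
    and dyadic sums dominate each other, and the hard estimates concern sums only. The relation
    [A u = f] is used in the form [G t u = S t f] for all [t > 0], which involves bounded operators
    only. Forms are built as real bilinear forms and complexified at the end. *)

Lemma eq_ler (R : realType) (x y : R) : x = y -> x <= y.
Proof. by move=> ->. Qed.

(** * The real scalar product of a complex Hilbert space *)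

Section hilbert.
Context (R : realType) (H : hilbertType R).
Implicit Types (x y z : H) (a b : R).

(** Computations use this real form. The imaginary part of [inner x y] is [rip x ('i *: y)], so
    nothing is lost. *)
Definition rip x y : R := complex.Re (inner x y).

Lemma ReD (u v : R[i]) : complex.Re (u + v) = complex.Re u + complex.Re v.
Proof. by case: u; case: v. Qed.

Lemma normRC x : `|x| = (rnorm x)%:C.
Proof. exact/esym/RRe_real/ger0_real/normr_ge0. Qed.

Lemma rnorm_ge0 x : 0 <= rnorm x.
Proof. by rewrite -ler0c -normRC. Qed.

Lemma rip_xx x : rip x x = rnorm x ^+ 2.
Proof. by rewrite /rip innerE normRC -rmorphXn. Qed.

Lemma innerC x y : inner x y = (inner y x)^*%C.
Proof. by rewrite hermC expr0 mul1r. Qed.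

Lemma innerZr (c : R[i]) x y : inner x (c *: y) = c^*%C * inner x y.
Proof. by rewrite linearZr_LR. Qed.

Lemma innerZl (c : R[i]) x y : inner (c *: x) y = c * inner x y.
Proof. by rewrite linearZl_LR. Qed.

Lemma ripC x y : rip x y = rip y x.
Proof. by rewrite /rip innerC; case: (inner y x). Qed.

Lemma ripDl x y z : rip (x + y) z = rip x z + rip y z.
Proof. by rewrite /rip linearDl ReD. Qed.

Lemma ripZl a x y : rip (a%:C *: x) y = a * rip x y.
Proof. by rewrite /rip innerZl; case: (inner x y) => u v /=; rewrite mul0r subr0. Qed.

Lemma scaleRN1 x : (-1)%:C *: x = - x.
Proof. by rewrite rmorphN1 scaleN1r. Qed.

Lemma ripDr x y z : rip x (y + z) = rip x y + rip x z.
Proof. by rewrite ripC ripDl !(ripC x). Qed.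
Lemma ripZr a x y : rip x (a%:C *: y) = a * rip x y.
Proof. by rewrite ripC ripZl ripC. Qed.
Lemma ripNl x y : rip (- x) y = - rip x y.
Proof. by rewrite -scaleRN1 ripZl mulN1r. Qed.
Lemma ripNr x y : rip x (- y) = - rip x y.
Proof. by rewrite ripC ripNl ripC. Qed.
Lemma ripBl x y z : rip (x - y) z = rip x z - rip y z.
Proof. by rewrite ripDl ripNl. Qed.
Lemma ripBr x y z : rip x (y - z) = rip x y - rip x z.
Proof. by rewrite ripDr ripNr. Qed.
Lemma rip0l x : rip 0 x = 0.
Proof. by rewrite -(subrr x) ripBl subrr. Qed.
Lemma rip0r x : rip x 0 = 0.
Proof. by rewrite ripC rip0l. Qed.

Lemma rip_ii x y : rip ('i *: x) ('i *: y) = rip x y.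
Proof.
rewrite /rip innerZr innerZl.
by case: (inner x y) => u v /=; ring.
Qed.

Lemma rnormZ (c : R[i]) x : rnorm (c *: x) = complex.Re `|c| * rnorm x.
Proof.
by rewrite /rnorm normrZ normc_def normRC -rmorphM.
Qed.

Lemma rnormZr a x : rnorm (a%:C *: x) = `|a| * rnorm x.
Proof. by rewrite rnormZ normc_def /= expr0n addr0 sqrtr_sqr. Qed.

Lemma rnorm0 : rnorm (0 : H) = 0.
Proof. by rewrite /rnorm normr0. Qed.

Lemma rnorm0_eq0 x : rnorm x = 0 -> x = 0.
Proof. by move=> x0; apply/normr0_eq0; rewrite normRC x0. Qed.

Lemma rnormN x : rnorm (- x) = rnorm x.
Proof. by rewrite /rnorm normrN. Qed.

Lemma rnormB x y : rnorm (x - y) = rnorm (y - x).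
Proof. by rewrite -rnormN opprB. Qed.

Lemma rnormD x y : rnorm (x + y) <= rnorm x + rnorm y.
Proof.
by rewrite -lecR rmorphD /= -!normRC ler_normD.
Qed.

Lemma rnormBD x y : rnorm (x - y) <= rnorm x + rnorm y.
Proof. by rewrite -(rnormN y) rnormD. Qed.

Lemma rnorm_dist x y z : rnorm (x - z) <= rnorm (x - y) + rnorm (y - z).
Proof. by apply: le_trans (rnormD _ _); rewrite addrA subrK. Qed.

Lemma rnorm_gt0 x : x != 0 -> 0 < rnorm x.
Proof.
move=> x0; rewrite lt_neqAle rnorm_ge0 andbT eq_sym.
by apply: contra_neq x0; exact: rnorm0_eq0.
Qed.

Lemma rnorm_sqrD x y :
  rnorm (x + y) ^+ 2 = rnorm x ^+ 2 + 2 * rip x y + rnorm y ^+ 2.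
Proof. rewrite -!rip_xx !ripDl !ripDr (ripC y x); ring. Qed.

Lemma rnorm_sqrB x y :
  rnorm (x - y) ^+ 2 = rnorm x ^+ 2 - 2 * rip x y + rnorm y ^+ 2.
Proof. rewrite -!rip_xx !ripBl !ripBr (ripC y x); ring. Qed.

Lemma rip_le x y : rip x y <= rnorm x * rnorm y.
Proof.
have [->|y0] := eqVneq y 0; first by rewrite rip0r rnorm0 mulr0.
have [->|x0] := eqVneq x 0; first by rewrite rip0l rnorm0 mul0r.
have px := rnorm_gt0 x0; have py := rnorm_gt0 y0.
have := sqr_ge0 (rnorm ((rnorm y)%:C *: x - (rnorm x)%:C *: y)).
rewrite rnorm_sqrB !rnormZr !ger0_norm ?rnorm_ge0// ripZl ripZr.
set p := rnorm x in px *; set q := rnorm y in py *.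
move=> h.
have : 0 <= (2 * p * q) * (p * q - rip x y) by apply: le_trans h _; apply: eq_ler; ring.
by rewrite pmulr_rge0 ?subr_ge0// !mulr_gt0.
Qed.

Lemma rip_abs x y : `|rip x y| <= rnorm x * rnorm y.
Proof.
rewrite ler_norml rip_le andbT lerNl -ripNl.
by apply: le_trans (rip_le _ _) _; rewrite rnormN.
Qed.

Lemma inner_abs x y : complex.Re `|inner x y| <= rnorm x * rnorm y.
Proof.
have [->|i0] := eqVneq (inner x y) 0.
  by rewrite normr0 /= mulr_ge0 ?rnorm_ge0.
(* rotate [inner x y] to the positive real axis *)
pose c := `|inner x y| / inner x y.
have nc : `|c| = 1 by rewrite normrM normfV normr_id divff// normr_eq0.
have : rip (c *: x) y = complex.Re `|inner x y|.
  by rewrite /rip innerZl /= /c mulfVK.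
by move=> <-; apply: le_trans (rip_le _ _) _; rewrite rnormZ nc /= mul1r.
Qed.

(** Turns an identity of vectors into identities of reals, within reach of [ring] and [lra]. *)
Lemma rip_inj x y : (forall z, rip x z = rip y z) -> x = y.
Proof.
move=> xy; apply/eqP; rewrite -subr_eq0; apply/eqP/rnorm0_eq0/eqP.
by rewrite -sqrf_eq0 -rip_xx ripBl xy subrr.
Qed.

End hilbert.

(** * Convergence, boundedness and completeness with real-valued norms *)

Section topology.
Context (R : realType).

Lemma cvg_rnormP (H : hilbertType R) (T : Type) (F : set_system T)
    {FF : Filter F} (f : T -> H) (l : H) :
  f @ F --> l <-> forall e : R, 0 < e -> \forall x \near F, rnorm (f x - l) < e.
Proof.
split.
  move=> /cvgrPdist_lt cf e e0.
  have e0' : 0 < e%:C by rewrite ltcR.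
  near=> x.
  have : `|l - f x| < e%:C by near: x; exact: cf.
  by rewrite normRC ltcR rnormB.
move=> cf; apply/cvgrPdist_lt => e e0.
have ere : e = (complex.Re e)%:C by apply/esym/RRe_real/gtr0_real.
have re0 : 0 < complex.Re e by rewrite -ltcR -ere.
near=> x.
rewrite normRC ere ltcR rnormB; near: x; exact: cf.
Unshelve. all: by end_near. Qed.

Lemma continuous_bounded (H1 H2 : hilbertType R) (T : {linear H1 -> H2}) :
  continuous T -> exists2 C : R, 0 <= C &
    forall x, rnorm (T x) <= C * rnorm x.
Proof.
move=> /(_ 0); rewrite /continuous_at linear0 => /cvg_rnormP/(_ 1 ltr01).
move=> /nbhs_ballP[e /= e0 eT].
have ere : e = (complex.Re e)%:C by apply/esym/RRe_real/gtr0_real.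
have re0 : 0 < complex.Re e by rewrite -ltcR -ere.
exists (2 / complex.Re e); first by rewrite divr_ge0// ltW.
move=> x; have [->|x0] := eqVneq x 0; first by rewrite linear0 !rnorm0 mulr0.
have px := rnorm_gt0 x0.
pose c := complex.Re e / 2 / rnorm x.
have c0 : 0 < c by rewrite !divr_gt0.
have eT' y : rnorm y < complex.Re e -> rnorm (T y) < 1.
  move=> ye; have := eT y; rewrite -ball_normE /= sub0r normrN normRC.
  by rewrite ere ltcR subr0; apply.
have h : rnorm (c%:C *: x) < complex.Re e.
  rewrite rnormZr gtr0_norm// /c divfK ?gt_eqF// ltr_pdivrMr//.
  by rewrite ltr_pMr// ltr1n.
have := eT' _ h; rewrite linearZ rnormZr gtr0_norm//.
rewrite -ltr_pdivlMl// mulr1 => /ltW/le_trans; apply.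
by rewrite /c !invf_div mulrC.
Qed.

Lemma bounded_continuous (H1 : hilbertType R) (W : normedModType R[i])
    (T : {linear H1 -> W}) (C : R) :
  (forall x, `|T x| <= (C * rnorm x)%:C) -> continuous T.
Proof.
move=> TC x; apply/cvgrPdist_lt => e e0.
have ere : e = (complex.Re e)%:C by apply/esym/RRe_real/gtr0_real.
have re0 : 0 < complex.Re e by rewrite -ltcR -ere.
have M0 : 0 < `|C| + 1 by rewrite ltr_pwDr.
near=> y.
rewrite -linearB (le_lt_trans (TC _))// {1}ere ltcR.
rewrite (@le_lt_trans _ _ ((`|C| + 1) * rnorm (x - y)))//.
  rewrite ler_wpM2r ?rnorm_ge0// (le_trans (ler_norm _))// lerDl//.
rewrite -ltr_pdivlMl// rnormB.
near: y; move: (@cvg_id _ (nbhs x)) => /cvg_rnormP; apply.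
by rewrite mulr_gt0// invr_gt0.
Unshelve. all: by end_near. Qed.

Lemma bounded_continuousH (H1 H2 : hilbertType R) (T : {linear H1 -> H2})
    (C : R) :
  (forall x, rnorm (T x) <= C * rnorm x) -> continuous T.
Proof.
by move=> TC; apply: (@bounded_continuous _ _ _ C) => x; rewrite normRC lecR.
Qed.

(** Some bound [C] is needed for the [sup] in [opnorm] to be a supremum. [T] is a plain function,
    since differences and difference quotients of operators are to be inserted. *)
Lemma opnorm_ge (H : hilbertType R) (T : H -> H) (C : R) :
  (forall (a : R) x, T (a%:C *: x) = a%:C *: T x) ->
  (forall x, rnorm (T x) <= C * rnorm x) ->
  forall x, rnorm (T x) <= opnorm T * rnorm x.
Proof.
move=> TZ TC x.
have [->|x0] := eqVneq x 0.
  by have := TZ 0 0; rewrite !scale0r => ->; rewrite !rnorm0 mulr0.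
have px := rnorm_gt0 x0.
rewrite -ler_pdivrMr//.
apply: sup_upper_bound; last first.
  exists ((rnorm x)^-1%:C *: x) => /=.
    by rewrite rnormZr gtr0_norm ?invr_gt0// mulVf// gt_eqF.
  by rewrite TZ rnormZr gtr0_norm ?invr_gt0// mulrC.
split.
  exists (rnorm (T 0)), 0 => //=; by rewrite rnorm0.
exists `|C| => _ /= [y y1 <-].
rewrite (le_trans (TC _))// (@le_trans _ _ (`|C| * rnorm y))//.
  by rewrite ler_wpM2r ?rnorm_ge0// ler_norm.
by rewrite -[leRHS]mulr1 ler_wpM2l.
Qed.

Lemma rnorm_complete (H : hilbertType R) (u : nat -> H) :
  (forall e : R, 0 < e -> exists N, forall n m, (N <= n)%N -> (N <= m)%N ->
     rnorm (u n - u m) < e) ->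
  exists l : H, u n @[n --> \oo] --> l.
Proof.
move=> uC; suff : cvg (u n @[n --> \oo]) by move=> /cvg_ex.
apply/cauchy_cvgP/cauchy_ballP => e e0.
have ere : e = (complex.Re e)%:C by apply/esym/RRe_real/gtr0_real.
have re0 : 0 < complex.Re e by rewrite -ltcR -ere.
near_simpl; have [N uN] := uC _ re0.
exists ([set n | N <= n], [set n | N <= n])%N; first by split; exists N.
move=> [n m] /= [Nn Nm]; rewrite -ball_normE/= normRC ere ltcR.
exact: uN.
Qed.

End topology.

(** * Fixed points, Riesz representation and adjoints *)

Section riesz.
Context (R : realType) (H : hilbertType R).
Implicit Types (x y z : H) (u : nat -> H).

Lemma cvg_dist_le u (l a : H) (c : R) N :
  u n @[n --> \oo] --> l -> (forall n, (N <= n)%N -> rnorm (u n - a) <= c) ->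
  rnorm (l - a) <= c.
Proof.
move=> ul ua; apply/ler_addgt0Pr => e e0.
have /cvg_rnormP/(_ e e0)[M _ uM] := ul.
have := uM (maxn N M) (leq_maxr _ _); have := ua _ (leq_maxl N M).
by have := rnorm_dist l (u (maxn N M)) a; rewrite (rnormB l (u _))/=; lra.
Qed.

Lemma geometric_dist u (K q : R) :
  0 <= q < 1 -> (forall n, rnorm (u n.+1 - u n) <= K * q ^+ n) ->
  forall n m, rnorm (u (n + m)%N - u n) <= K * q ^+ n / (1 - q).
Proof.
move=> /andP[q0 q1] uK n m.
have K0 : 0 <= K by have := uK 0; rewrite expr0 mulr1; apply/le_trans/rnorm_ge0.
have d0 : 0 < 1 - q by lra.
suff : rnorm (u (n + m)%N - u n) <= K * q ^+ n * (1 - q ^+ m) / (1 - q).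
  move=> /le_trans; apply; apply: ler_wpM2r; first by rewrite invr_ge0 ltW.
  apply: ler_piMr.
    by rewrite mulr_ge0 ?exprn_ge0.
  by rewrite gerBl exprn_ge0.
elim: m => [|m ih]; first by rewrite addn0 subrr rnorm0 expr0 subrr mulr0 mul0r.
apply: le_trans (rnorm_dist _ (u (n + m)%N) _) _.
have := uK (n + m)%N; rewrite -addnS => h; apply: le_trans (lerD h ih) _.
rewrite exprD exprS; apply: eq_ler.
by field; rewrite gt_eqF.
Qed.

Lemma geometric_cvg u (K q : R) :
  0 <= q < 1 -> (forall n, rnorm (u n.+1 - u n) <= K * q ^+ n) ->
  exists2 l : H, u n @[n --> \oo] --> l &
    forall n, rnorm (l - u n) <= K * q ^+ n / (1 - q).
Proof.
move=> q01 uK.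
have ud := geometric_dist q01 uK.
have [q0 q1] := andP q01.
have K0 : 0 <= K by have := uK 0; rewrite expr0 mulr1; apply/le_trans/rnorm_ge0.
have [l ul] : exists l : H, u n @[n --> \oo] --> l.
  apply: rnorm_complete => e e0.
  pose C := K / (1 - q) + 1.
  have C0 : 0 < C by rewrite ltr_wpDl// divr_ge0// subr_ge0 ltW.
  have : q ^+ n @[n --> \oo] --> (0 : R) by apply: cvg_expr; rewrite ger0_norm.
  move=> /cvgrPdist_lt/(_ (e / 2 / C)); rewrite !divr_gt0// => /(_ isT)[N _ qN].
  exists N => n m Nn Nm.
  have h k : (N <= k)%N -> rnorm (u k - u N) < e / 2.
    move=> Nk; rewrite -(subnKC Nk); apply: le_lt_trans (ud _ _) _.
    have := qN N (leqnn _); rewrite /= sub0r normrN ger0_norm ?exprn_ge0//.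
    rewrite ltr_pdivlMr// => qC; apply: le_lt_trans qC.
    rewrite mulrAC mulrC ler_wpM2l ?exprn_ge0// /C lerDl//.
  have := h _ Nn; have := h _ Nm; have := rnorm_dist (u n) (u N) (u m).
  by rewrite (rnormB (u N)); lra.
exists l => // n; apply: (cvg_dist_le (N := n) ul) => m nm.
by rewrite -(subnKC nm).
Qed.

(** The Neumann series of [1 - C]: [u n] is its n-th partial sum applied to [x]. *)
Lemma contraction_solve (C : H -> H) (q : R) :
  (forall x y, C (x - y) = C x - C y) -> (forall x, rnorm (C x) <= q * rnorm x) ->
  0 <= q < 1 -> forall x, exists w, w - C w = x.
Proof.
move=> CB Cq q01 x.
have [q0 q1] := andP q01.
pose u := fix u n := if n is n.+1 then x + C (u n) else 0.
have uK n : rnorm (u n.+1 - u n) <= rnorm (x + C 0) * q ^+ n.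
  elim: n => [|n ih]; first by rewrite /= subr0 expr0 mulr1.
  rewrite [u n.+2]/= [X in _ - X]/= opprD addrACA subrr add0r -CB.
  apply: le_trans (Cq _) _.
  by rewrite exprS mulrCA ler_wpM2l.
have [l ul _] := geometric_cvg q01 uK.
exists l; apply/eqP; rewrite -subr_eq0; apply/eqP/rnorm0_eq0.
apply/eqP; rewrite eq_le rnorm_ge0 andbT; apply/ler_addgt0Pr => e e0; rewrite add0r.
have e20 : 0 < e / 2 by rewrite divr_gt0.
have /cvg_rnormP/(_ _ e20)[N _ uN] := ul.
have := uN N (leqnn _); have := uN N.+1 (leqnSn _) => /= h1 h2.
have -> : l - C l - x = (l - u N.+1) + C (u N - l)
  by rewrite CB /= opprD !addrA addrNK addrAC.
apply: le_trans (rnormD _ _) _; rewrite (rnormB l).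
have := Cq (u N - l); have := rnorm_ge0 (u N - l) => h3 h4.
have : q * rnorm (u N - l) <= rnorm (u N - l) by rewrite ler_piMl// ltW.
by move: h1 h2 h4; rewrite /=; lra.
Qed.

Lemma riesz (f : H -> R) (M : R) :
  (forall x y, f (x + y) = f x + f y) -> (forall a x, f (a%:C *: x) = a * f x) ->
  (forall x, `|f x| <= M * rnorm x) ->
  exists z, forall x, f x = rip x z.
Proof.
move=> fD fZ fM.
(* minimise J; the parallelogram law makes minimising sequences Cauchy *)
pose J x := rnorm x ^+ 2 / 2 - f x.
have fN x : f (- x) = - f x by rewrite -scaleRN1 fZ mulN1r.
have J_ge x : - (M ^+ 2) / 2 <= J x.
  have := fM x; have := ler_norm (f x); have := sqr_ge0 (rnorm x - M).
  by rewrite /J !expr2; lra.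
have hasJ : has_inf (range J).
  split; first by exists (J 0), 0.
  by exists (- (M ^+ 2) / 2) => _ [x _ <-].
pose m := inf (range J).
have mJ x : m <= J x by apply: (ge_inf hasJ.2); exists x.
have /choice[u uJ] : forall n : nat, exists x, J x < m + n.+1%:R^-1.
  move=> n; have n0 : 0 < n.+1%:R^-1 :> R by rewrite invr_gt0 ltr0Sn.
  by have [_ [x _ <-] xm] := inf_adherent n0 hasJ; exists x.
have par x y : rnorm (x - y) ^+ 2 <= 4 * (J x + J y - 2 * m).
  have := mJ ((2^-1)%:C *: (x + y)).
  rewrite /J fZ fD rnormZr exprMn gtr0_norm ?invr_gt0//.
  rewrite [rnorm (x - y) ^+ 2]rnorm_sqrB [rnorm (x + y) ^+ 2]rnorm_sqrD; lra.
have [z uz] : exists z : H, u n @[n --> \oo] --> z.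
  apply: rnorm_complete => e e0.
  have : 0 < e ^+ 2 / 8 by rewrite divr_gt0// exprn_gt0.
  move=> /(@ltr_add_invr _ 0)[N]; rewrite add0r => Ne.
  exists N => n k Nn Nk.
  rewrite -(ltr_pXn2r (n := 2))// ?nnegrE ?rnorm_ge0 ?ltW//.
  apply: le_lt_trans (par _ _) _.
  have inv j : (N <= j)%N -> j.+1%:R^-1 <= N.+1%:R^-1 :> R.
    by move=> Nj; rewrite lef_pV2 ?posrE// ler_nat ltnS.
  move: (inv _ Nn) (inv _ Nk) (uJ n) (uJ k) Ne.
  move: n.+1%:R^-1 k.+1%:R^-1 N.+1%:R^-1 (J (u n)) (J (u k)) => n' k' N' a b.
  by lra.
have Jz : J z <= m.
  apply/ler_addgt0Pr => e e0.
  (* J z - J x = O(|z - x|) *)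
  pose c := 1 + rnorm z + `|M|.
  have c0 : 0 < c by rewrite /c ltr_wpDr// ltr_wpDr// rnorm_ge0.
  have ec : 0 < Num.min 1 (e / 2 / c) by rewrite lt_min ltr01/= !divr_gt0.
  have /cvg_rnormP/(_ _ ec)[N _ uN] := uz.
  have : 0 < e / 2 by rewrite divr_gt0.
  move=> /(@ltr_add_invr _ 0)[N']; rewrite add0r => Ne.
  pose n := maxn N N'.
  have := uN n (leq_maxl _ _); rewrite /= lt_min => /andP[u1 uc].
  have nN : n.+1%:R^-1 <= N'.+1%:R^-1 :> R.
    by rewrite lef_pV2 ?posrE// ler_nat ltnS leq_maxr.
  have hJ : J z - J (u n) <= rnorm (u n - z) * c.
    have -> : J z - J (u n) = - rip z (u n - z) - rnorm (u n - z) ^+ 2 / 2 + f (u n - z).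
      by rewrite /J fD fN rnorm_sqrB ripBr rip_xx (ripC z); lra.
    have := rip_abs z (u n - z); rewrite ler_norml => /andP[+ _].
    have := fM (u n - z); have := ler_norm (f (u n - z)).
    have : M * rnorm (u n - z) <= `|M| * rnorm (u n - z).
      by rewrite ler_wpM2r ?rnorm_ge0// ler_norm.
    have := sqr_ge0 (rnorm (u n - z)); have := rnorm_ge0 (u n - z).
    by rewrite /c; lra.
  move: hJ (uJ n) nN Ne uc; rewrite (ltr_pdivlMr _ _ c0).
  move: n.+1%:R^-1 N'.+1%:R^-1 (J (u n)) => n' k' a.
  by lra.
exists z => v.
(* Minimality of [J z] along the line [z + t v]. A quadratic in [t] without constant term is
   nonnegative only if its linear coefficient vanishes; its minimiser is inserted below. *)
have quad t : 0 <= t * (rip v z - f v) + t ^+ 2 * rnorm v ^+ 2 / 2.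
  have := mJ (z + t%:C *: v); have := Jz.
  rewrite /J fD fZ rnorm_sqrD ripZr rnormZr exprMn real_normK ?num_real//.
  by rewrite (ripC v); lra.
have [|v0] := eqVneq v 0; first by move=> ->; rewrite rip0l -(scale0r 0) (fZ 0) mul0r.
have pv := rnorm_gt0 v0.
have := quad (- (rip v z - f v) / rnorm v ^+ 2).
set d := rip v z - f v; set n2 := rnorm v ^+ 2.
have n20 : 0 < n2 by rewrite exprn_gt0.
have -> : - d / n2 * d + (- d / n2) ^+ 2 * n2 / 2 = - (d ^+ 2 / (2 * n2)).
  by field; rewrite gt_eqF.
rewrite oppr_ge0 pmulr_lle0 ?invr_gt0 ?mulr_gt0// => d2.
have : d = 0 by apply/eqP; rewrite -sqrf_eq0 eq_le d2 sqr_ge0.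
by rewrite /d; lra.
Qed.

Lemma ripZcr (c : R[i]) x y : rip x (c *: y) = rip (c^*%C *: x) y.
Proof. by rewrite /rip innerZr innerZl. Qed.

(** The real Riesz representative depends complex-linearly on [y] because [rip x (c *: y)] moves [c]
    to the other side as its conjugate. A bound for [T] passes to [T'] through
    [|T' x|^2 = rip (T (T' x)) x]. *)
Lemma adjoint (T : {linear H -> H}) : continuous T ->
  exists T' : {linear H -> H}, [/\ (forall x y, rip (T x) y = rip x (T' y)) &
    forall C, (forall x, rnorm (T x) <= C * rnorm x) ->
      forall x, rnorm (T' x) <= C * rnorm x].
Proof.
move=> /continuous_bounded[C C0 TC].
have /choice[T' TT'] : forall y, exists z, forall x, rip (T x) y = rip x z.
  move=> y; apply: (@riesz _ (C * rnorm y)) => [x x'|a x|x].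
  - by rewrite linearD ripDl.
  - by rewrite linearZ ripZl.
  - by rewrite (le_trans (rip_abs _ _))// mulrAC ler_wpM2r ?rnorm_ge0.
have T'lin : linear T'.
  move=> c y y'; apply: rip_inj => x; rewrite !(ripC _ x) -TT' !ripDr !ripZcr.
  by rewrite !TT' -linearZ TT'.
exists (HB.pack_for {linear H -> H} T' (GRing.isLinear.Build _ _ _ _ T' T'lin)).
split=> [x y|D TD x]; first exact: TT'.
rewrite /=.
have [->|T'x0] := eqVneq (T' x) 0.
  rewrite rnorm0; have := TD x; have := rnorm_ge0 (T x); lra.
rewrite -(ler_pM2l (rnorm_gt0 T'x0)) -expr2 -rip_xx -TT'.
apply: le_trans (rip_le _ _) _.
rewrite mulrA (mulrC (rnorm (T' x))) ler_wpM2r ?rnorm_ge0//.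
Qed.

End riesz.

(** * The uniform boundedness principle *)

Section ubp.
Context (R : realType) (H : hilbertType R).
Implicit Types (x y z : H) (u : nat -> H).

(** A gliding hump instead of the Baire category theorem. The n-th step has length [3^-n] and all
    later steps together at most half of it, so they cannot undo its effect on [u (k n)]. As
    [rnorm (u (k n)) > 6^(n+1)], the values at the limit grow at least like [2^(n+1)]. *)
Lemma uniform_boundedness u :
  (forall y, exists M : R, forall n, `|rip (u n) y| <= M) ->
  exists M : R, forall n, rnorm (u n) <= M.
Proof.
move=> pw; apply: contrapT => nb.
have /choice[k kb] : forall n, exists k, 6 ^+ n.+1 < rnorm (u k).
  move=> n; apply: contrapT => nk; apply: nb; exists (6 ^+ n.+1) => i.
  by rewrite leNgt; apply/negP => ui; apply: nk; exists i.
pose r n : R := 3^-1 ^+ n.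
have r0 n : 0 < r n by rewrite exprn_gt0.
pose e n := (r n / rnorm (u (k n)))%:C *: u (k n).
have uk0 n : 0 < rnorm (u (k n)) by apply: lt_trans (kb n); rewrite exprn_gt0.
have en n : rnorm (e n) = r n.
  by rewrite rnormZr gtr0_norm ?divr_gt0// divfK// gt_eqF.
have fe n : rip (u (k n)) (e n) = r n * rnorm (u (k n)).
  rewrite ripZr rip_xx expr2 mulrA divfK// gt_eqF//.
(* moving by [e n] or [- e n] makes the n-th functional large *)
pose x := fix x n := if n is n.+1 then
  (if 0 <= rip (u (k n)) (x n) then x n + e n else x n - e n) else 0.
have xd n : rnorm (x n.+1 - x n) <= 1 * 3^-1 ^+ n.
  by rewrite mul1r -/(r n) /=; case: ifP => _; rewrite addrAC subrr add0r ?rnormN en.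
have xb n : r n * rnorm (u (k n)) <= `|rip (u (k n)) (x n.+1)|.
  rewrite /=; case: ifP => h.
    by rewrite ripDr fe (le_trans _ (ler_norm _))// lerDr.
  rewrite ripBr fe -normrN opprB (le_trans _ (ler_norm _))// lerDl.
  by move/negbT: h; rewrite -ltNge oppr_ge0 => /ltW.
have q01 : 0 <= (3^-1 : R) < 1 by rewrite invr_ge0 ler0n/= invf_lt1// ltr1n.
have [l xl ld] := geometric_cvg q01 xd.
have lb n : rnorm (l - x n.+1) <= r n / 2.
  by apply: le_trans (ld n.+1) _; rewrite mul1r exprS -/(r n) (_ : 1 - 3^-1 = 2 / 3) ?invf_div; lra.
have [M Mb] := pw l.
have big n : 2 ^+ n.+1 <= M.
  have := Mb (k n).
  have -> : l = x n.+1 + (l - x n.+1) by rewrite addrC subrK.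
  rewrite ripDr => h.
  have h1 := rip_abs (u (k n)) (l - x n.+1).
  have h2 : rnorm (u (k n)) * rnorm (l - x n.+1) <= rnorm (u (k n)) * (r n / 2).
    by rewrite ler_wpM2l ?rnorm_ge0.
  have h3 := xb n.
  have h4 : `|rip (u (k n)) (x n.+1)| <=
      `|rip (u (k n)) (x n.+1) + rip (u (k n)) (l - x n.+1)| +
      `|rip (u (k n)) (l - x n.+1)|.
    rewrite -[in X in _ <= _ + X]normrN; apply: le_trans (ler_normD _ _).
    by rewrite addrK.
  have h5 : r n * 6 ^+ n.+1 <= r n * rnorm (u (k n)).
    by rewrite ler_wpM2l// ltW.
  have h6 : r n * 6 ^+ n.+1 = 3 * 2 ^+ n.+1.
    rewrite /r (_ : 6 = 3 * 2); last by ring.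
    rewrite exprMn mulrA exprS mulrCA -exprMn mulVf// expr1n mulr1//.
  have h7 : 0 < 2 ^+ n.+1 :> R by rewrite exprn_gt0.
  by lra.
have [n nM] : exists n : nat, M < n.+1%:R.
  by exists (Num.truncn `|M|); rewrite (le_lt_trans (ler_norm _))// truncnS_gt.
have := lt_le_trans nM (le_trans _ (big n)).
rewrite -natrX ler_nat ltxx => h.
by move: (h (ltnW (ltn_expl n.+1 (ltnSn 1)))).
Qed.

End ubp.

(** * Discrete square functions of contraction semigroups *)

Section square_function.
Context (R : realType) (H : hilbertType R).
Implicit Types (x y z : H).

Record contraction_semigroup (U : R -> H -> H) : Prop := {
  csB : forall t x y, U t (x - y) = U t x - U t y;
  csZ : forall t (a : R) x, U t (a%:C *: x) = a%:C *: U t x;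
  cs_le : forall t x, 0 <= t -> rnorm (U t x) <= rnorm x;
  csD : forall s t x, 0 <= s -> 0 <= t -> U (s + t) x = U s (U t x)
}.

(** Analyticity, that is boundedness of [s U'(s)], stated through differences: it mentions no
    derivative and passes to the adjoint by duality. *)
Definition analytic_bound (tau c : R) (U : R -> H -> H) : Prop :=
  forall s h x, 0 < s <= tau -> 0 < h ->
    rnorm (U s x - U (s + h) x) <= c * (h / s) * rnorm x.

Section step.
Variables (E P : H -> H) (c : R).
Hypotheses (EB : forall x y, E (x - y) = E x - E y)
  (EZ : forall (a : R) x, E (a%:C *: x) = a%:C *: E x)
  (Eacc : forall x, 0 <= rip x (E x)).
Hypotheses (PB : forall x y, P (x - y) = P x - P y)
  (PZ : forall (a : R) x, P (a%:C *: x) = a%:C *: P x)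
  (P1 : forall x, rnorm (P x) <= rnorm x)
  (PE : forall x, rnorm (P (E x)) <= c * rnorm x)
  (PEE : forall x, rnorm (P (E (E x))) <= 4 * c ^+ 2 * rnorm x).

Let ED x y : E (x + y) = E x + E y.
Proof.
have -> : x + y = x - (-1)%:C *: y by rewrite scaleRN1 opprK.
by rewrite EB EZ scaleRN1 opprK.
Qed.
Let PD x y : P (x + y) = P x + P y.
Proof.
have -> : x + y = x - (-1)%:C *: y by rewrite scaleRN1 opprK.
by rewrite PB PZ scaleRN1 opprK.
Qed.

(* [u = (1 + E)^-1 x] and [v = (1 + 2 E)^-1 x] *)
Lemma resolvent_step x u v :
  u + E u = x -> v + 2%:C *: E v = x ->
  3 * rnorm (u - v) ^+ 2 <= rnorm u ^+ 2 - rnorm v ^+ 2 /\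
  rnorm (P (E x)) <= (1 + 3 * c + 8 * c ^+ 2) * rnorm (u - v).
Proof.
move=> hu hv.
have [z zE] : exists z, z = u - v by eexists.
(* This is [q = (1 + E)^-1 (1 + 2 E)^-1 x]. Then [z = E q], [v = (1 + E) q] and
   [x = (1 + 3 E + 2 E^2) q]. Accretivity gives [rip z v >= |z|^2], hence the factor 3; and
   [E x = (1 + 3 E + 2 E^2) z] gives the constant [1 + 3 c + 8 c^2]. *)
have [q qE] : exists q, q = v - z by eexists.
have zq : E q = z.
  apply: rip_inj => t; rewrite qE zE !EB !ripBl.
  have := congr1 ((@rip _ _)^~ t) hu; have := congr1 ((@rip _ _)^~ t) hv.
  by rewrite /= !ripDl ripZl; lra.
have vq : v = q + E q by rewrite zq qE subrK.
have xq : x = q + 3%:C *: E q + 2%:C *: E (E q).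
  apply: rip_inj => t; rewrite -hv {1 2}vq ED !(ripDl, ripZl); lra.
rewrite -zE; split.
  have -> : u = z + v by rewrite zE subrK.
  rewrite rnorm_sqrD.
  have : rip z v = rip q (E q) + rnorm z ^+ 2.
    by rewrite {1}vq ripDr -rip_xx zq (ripC z q).
  have := Eacc q; lra.
have -> : E x = z + 3%:C *: E z + 2%:C *: E (E z).
  by rewrite xq !ED !EZ zq.
rewrite !PD !PZ.
apply: le_trans (rnormD _ _) _; apply: le_trans (lerD (rnormD _ _) (lexx _)) _.
rewrite !rnormZr !ger0_norm//.
have := P1 z; have := PE z; have := PEE z; lra.
Qed.

End step.

Variables (U : R -> H -> H) (tau c : R).
Hypotheses (US : contraction_semigroup U) (tau0 : 0 < tau)
  (c0 : 0 <= c) (Ua : analytic_bound tau c U).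

Let s k : R := tau / 2 ^+ k.
Let s_gt0 k : 0 < s k. Proof. by rewrite divr_gt0// exprn_gt0. Qed.
Let sS k : s k = 2 * s k.+1.
Proof. by rewrite /s exprS; field; rewrite expf_neq0. Qed.

(* With [w k = (1 + 2 (s k / h) (1 - U h))^-1 x], [resolvent_step] bounds the k-th
   term by a multiple of [|w k.+1|^2 - |w k|^2], so the sum telescopes. *)
Lemma dyadic_square_function h x n : 0 < h ->
  \sum_(k < n) (s k / h) ^+ 2 * rnorm (U (s k) x - U (s k + h) x) ^+ 2
    <= (1 + 3 * c + 8 * c ^+ 2) ^+ 2 * rnorm x ^+ 2.
Proof.
move=> h0.
pose E p y := p%:C *: (y - U h y).
have EB p y z : E p (y - z) = E p y - E p z.
  by apply: rip_inj => t; rewrite /E (csB US) !(ripDl, ripNl, ripZl, ripDl, ripNl); ring.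
have EZ p a y : E p (a%:C *: y) = a%:C *: E p y.
  by rewrite /E (csZ US) -scalerBr !scalerA mulrC.
have Eacc p y : 0 <= p -> 0 <= rip y (E p y).
  move=> p0; rewrite ripZr mulr_ge0// ripBr subr_ge0 rip_xx.
  apply: le_trans (rip_le _ _) _; rewrite expr2 ler_wpM2l ?rnorm_ge0//.
  exact/(cs_le US)/ltW.
have /choice[w wx] : forall k, exists w, w + E (2 * s k / h) w = x.
  move=> k; set p := 2 * s k / h.
  have p0 : 0 < p by rewrite !(divr_gt0, mulr_gt0).
  have p1 : 0 < 1 + p by lra.
  (* Dividing [(1 + p) w - p U h w = x] by [1 + p] leaves a fixed point equation for this strict
     contraction. *)
  pose C y := (p / (1 + p))%:C *: U h y.
  have CB y z : C (y - z) = C y - C z by rewrite /C (csB US) scalerBr.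
  have Cq y : rnorm (C y) <= p / (1 + p) * rnorm y.
    have pp : 0 <= p / (1 + p) by rewrite divr_ge0// ltW.
    rewrite rnormZr ger0_norm//; apply: ler_wpM2l => //.
    exact/(cs_le US)/ltW.
  have q01 : 0 <= p / (1 + p) < 1.
    by rewrite divr_ge0 ?ltW//= ltr_pdivrMr// mul1r; lra.
  have [w wx] := contraction_solve CB Cq q01 ((1 + p)^-1%:C *: x).
  exists w; apply: rip_inj => t.
  have := congr1 ((@rip _ _)^~ t) wx.
  rewrite /= /C !(ripDl, ripNl, ripZl) => /(congr1 (fun a => (1 + p) * a)).
  rewrite mulVKf ?gt_eqF// => <-; field; rewrite gt_eqF//.
pose K := 1 + 3 * c + 8 * c ^+ 2.
have UC a b y : 0 <= a -> 0 <= b -> U a (U b y) = U b (U a y).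
  by move=> a0 b0; rewrite -!csD// addrC.
have step k : 3 * rnorm (w k.+1 - w k) ^+ 2 <= rnorm (w k.+1) ^+ 2 - rnorm (w k) ^+ 2
   /\ rnorm (U (s k) (E (s k / h) x)) <= K * rnorm (w k.+1 - w k).
  have p0 : 0 <= s k / h by rewrite divr_ge0 ?ltW.
  have sk0 := ltW (s_gt0 k); have h0' := ltW h0.
  have ab t y : 0 < t <= tau -> rnorm (U t (y - U h y)) <= c * (h / t) * rnorm y.
    by move=> tt; rewrite csB// -csD//; [exact: Ua | case/andP: tt => /ltW].
  have stau : s k <= tau by rewrite ler_pdivrMr ?exprn_gt0//; apply: ler_peMr; [exact: ltW|apply: exprn_ege1; rewrite ler1n].
  apply: (resolvent_step (E := E (s k / h)) (P := U (s k))) => //.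
  - by move=> y; exact: Eacc.
  - exact: csB.
  - exact: csZ.
  - by move=> y; exact: cs_le.
  - move=> y; rewrite /E csZ// rnormZr ger0_norm//.
    rewrite (le_trans (ler_wpM2l p0 (ab _ _ _)))// ?s_gt0//.
    apply: eq_ler; field.
    by rewrite !gt_eqF.
  (* Each of the two factors [E] receives half of the time [s k] and costs [2 c], whence [4 c^2]. *)
  - move=> y; set p := s k / h; set t := s k / 2.
    have t0 : 0 < t <= tau by rewrite divr_gt0//= /t; move: stau; have := s_gt0 k; lra.
    have t0' : 0 <= t by case/andP: t0 => /ltW.
    have -> : s k = t + t by rewrite /t; lra.
    have UE v : U t (E p v) = E p (U t v).
      by rewrite /E (csZ US) (csB US) (UC t h)// ltW.
    have Eb v : rnorm (U t (E p v)) <= 2 * c * rnorm v.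
      rewrite /E (csZ US) rnormZr ger0_norm//.
      apply: le_trans (ler_wpM2l p0 (ab _ _ t0)) _.
      apply: eq_ler; rewrite /p /t; field.
      by rewrite !gt_eqF.
    rewrite (csD US)// UE; apply: le_trans (Eb _) _.
    apply: (@le_trans _ _ (2 * c * (2 * c * rnorm y))).
      by apply: ler_wpM2l; [rewrite mulr_ge0|exact: Eb].
    by apply: eq_ler; ring.
  (* Because the times are halved, one operator [E] has [w k.+1 = (1 + E)^-1 x] and
     [w k = (1 + 2 E)^-1 x]. *)
  - have -> : s k / h = 2 * s k.+1 / h by rewrite -sS.
    exact: wx.
  - have <- : E (2 * s k / h) (w k) = 2%:C *: E (s k / h) (w k).
      by rewrite /E -(mulrA 2) scalerA -rmorphM.
    exact: wx.
have K0 : 0 <= K by rewrite /K; have := c0; have := sqr_ge0 c; lra.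
have wn k : rnorm (w k) ^+ 2 <= rnorm x ^+ 2.
  rewrite -(wx k) rnorm_sqrD.
  have pk : 0 <= 2 * s k / h by apply: divr_ge0; rewrite ?mulr_ge0 ?ltW.
  have := Eacc _ (w k) pk.
  have := sqr_ge0 (rnorm (E (2 * s k / h) (w k))); lra.
apply: (@le_trans _ _ (\sum_(k < n) K ^+ 2 * rnorm (w k.+1 - w k) ^+ 2)).
  apply: ler_sum => k _.
  have [_ h2] := step k.
  have pk : 0 <= s k / h by apply: divr_ge0; exact: ltW.
  rewrite -{1}(ger0_norm pk) -exprMn -rnormZr.
  have -> : (s k / h)%:C *: (U (s k) x - U (s k + h) x) = U (s k) (E (s k / h) x).
    by rewrite /E (csZ US) (csB US) (csD US)// ltW.
  rewrite -[leRHS]exprMn; apply: lerXn2r; rewrite ?nnegrE ?rnorm_ge0//.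
  by rewrite mulr_ge0// rnorm_ge0.
rewrite -big_distrr/=; apply: ler_wpM2l; first exact: sqr_ge0.
have tele : 3 * \sum_(k < n) rnorm (w k.+1 - w k) ^+ 2
    <= rnorm (w n) ^+ 2 - rnorm (w 0) ^+ 2.
  elim: n => [|n ih]; first by rewrite big_ord0 subrr mulr0.
  by rewrite big_ord_recr/= mulrDr; have [h1 _] := step n; lra.
have := wn n; have := sqr_ge0 (rnorm (w 0)).
have : 0 <= \sum_(k < n) rnorm (w k.+1 - w k) ^+ 2.
  by apply: sumr_ge0 => k _; exact: sqr_ge0.
by move: tele; lra.
Qed.

End square_function.

(** * Cauchy estimate for complex functions *)

Section goursat.
Context (R : realType).

Lemma derivable_approx (K : numFieldType) (V : normedModType K) (f : K^o -> V) x :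
  derivable f x 1 -> forall e : K, 0 < e -> exists2 d : K, 0 < d &
    forall h : K, `|h| < d -> `|f (x + h) - f x - h *: 'D_1 f x| <= e * `|h|.
Proof.
move=> /cvgrPdist_lt fl e e0.
have /nbhs_ballP[d /= d0 fd] := fl e e0.
exists d => // h hd; have [->|h0] := eqVneq h 0.
  by rewrite addr0 subrr scale0r subr0 !normr0 mulr0.
have := fd h; rewrite -ball_normE/= sub0r normrN => /(_ hd h0)/ltW.
rewrite -(ler_pM2r (x := `|h|)) ?normr_gt0// mulrC -normrZ scalerBr scalerA divff// scale1r.
by rewrite distrC -[h%:A]/(h * 1) mulr1 (addrC h).
Qed.

(** The mixed difference over the rectangle [[a, b] x [c, d]]. For a primitive [P] of [U] in the
    second variable it is the integral of [U] over the right side minus that over the left side; for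
    a primitive [Q] of [V] in the first variable, top minus bottom. So [incr P - incr Q] is the
    integral of [V ds + U dt] along the boundary. *)
Definition incr (F : R -> R -> R) (a b c d : R) : R :=
  F b d - F b c - F a d + F a c.

Lemma incr_quarters (F : R -> R -> R) s t x y :
  `|incr F s (s + (x + x)) t (t + (y + y))| <=
  `|incr F s (s + x) t (t + y)| + `|incr F s (s + x) (t + y) (t + y + y)| +
  `|incr F (s + x) (s + x + x) t (t + y)| +
  `|incr F (s + x) (s + x + x) (t + y) (t + y + y)|.
Proof.
have -> : incr F s (s + (x + x)) t (t + (y + y)) =
    incr F s (s + x) t (t + y) + incr F s (s + x) (t + y) (t + y + y) +
    incr F (s + x) (s + x + x) t (t + y) +
    incr F (s + x) (s + x + x) (t + y) (t + y + y).
  by rewrite !addrA /incr; ring.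
apply: le_trans (ler_normD _ _) _; rewrite lerD2r.
apply: le_trans (ler_normD _ _) _; rewrite lerD2r.
exact: ler_normD.
Qed.

Lemma MVT_le (f df : R -> R) (a b : R) : a <= b ->
  (forall x, a <= x <= b -> is_derive x 1 f (df x)) ->
  exists2 c, a <= c <= b & f b - f a = df c * (b - a).
Proof.
move=> ab fdf; have [||c cab ->] := @MVT_segment _ f df a b ab.
- by move=> x xab; apply: fdf; rewrite !ltW// ?(itvP xab).
- by apply: derivable_within_continuous => x xab; have [] := fdf x _.
- by exists c.
Qed.

Definition primitive_diff (P Q : R -> R -> R) s t : R := P s t - Q s t.

(* [P] and [Q] are primitives of [U] along vertical and of [V] along horizontal
   segments, and the 1-form [V ds + U dt] is pointwise closed *)
Record closed_form (U V P Q : R -> R -> R) (a b c d : R) : Prop := {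
  cf_P : forall s t, a <= s <= b -> c <= t <= d -> is_derive t 1 (P s) (U s t);
  cf_Q : forall s t, a <= s <= b -> c <= t <= d -> is_derive s 1 (Q^~ t) (V s t);
  cf_closed : forall s0 t0, a <= s0 <= b -> c <= t0 <= d ->
    exists p q r : R, forall e : R, 0 < e -> exists2 dl : R, 0 < dl & forall s t,
    a <= s <= b -> c <= t <= d -> `|s - s0| < dl -> `|t - t0| < dl ->
    `|U s t - U s0 t0 - (p * (s - s0) + q * (t - t0))| <= e * (`|s - s0| + `|t - t0|) /\
    `|V s t - V s0 t0 - (r * (s - s0) + p * (t - t0))| <= e * (`|s - s0| + `|t - t0|)
}.

(** The mean value theorem writes both increments as a difference of values of [U] or [V] times a
    side. Both affine parts equal [p (s2 - s1) (t2 - t1)] and cancel, as [p] is common to [U] and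
    [V]. Each of the four values is off by at most [e D / 4]. *)
Lemma incr_local (U V P Q : R -> R -> R) (a b c d : R) s0 t0 :
  closed_form U V P Q a b c d -> a <= s0 <= b -> c <= t0 <= d ->
  forall e : R, 0 < e -> exists2 dl : R, 0 < dl & forall s1 s2 t1 t2 D : R,
    a <= s1 -> s1 <= s0 -> s0 <= s2 -> s2 <= b ->
    c <= t1 -> t1 <= t0 -> t0 <= t2 -> t2 <= d ->
    s2 - s1 <= D -> t2 - t1 <= D -> D < dl ->
    `|incr (primitive_diff P Q) s1 s2 t1 t2| <= e * D ^+ 2.
Proof.
move=> [dP dQ curl_free] s0ab t0cd e e0.
have [p [q [r pqr]]] := curl_free _ _ s0ab t0cd.
have e80 : 0 < e / 8 by rewrite divr_gt0.
have [dl dl0 UV] := pqr _ e80; exists dl => // s1 s2 t1 t2 D.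
move=> as1 s10 s02 s2b ct1 t10 t02 t2d sD tD Ddl.
have s1ab : a <= s1 <= b by rewrite as1 (le_trans s10)// (le_trans s02).
have s2ab : a <= s2 <= b by rewrite s2b (le_trans as1)// (le_trans s10).
have t1cd : c <= t1 <= d by rewrite ct1 (le_trans t10)// (le_trans t02).
have t2cd : c <= t2 <= d by rewrite t2d (le_trans ct1)// (le_trans t10).
have ss : s1 <= s2 by apply: le_trans s02.
have tt : t1 <= t2 by apply: le_trans t02.
have sin s : s1 <= s -> s <= s2 -> a <= s <= b.
  by move=> h1 h2; rewrite (le_trans as1 h1) (le_trans h2 s2b).
have tin t : t1 <= t -> t <= t2 -> c <= t <= d.
  by move=> h1 h2; rewrite (le_trans ct1 h1) (le_trans h2 t2d).
have [xi /andP[xi1 xi2] Pxi] : exists2 xi, t1 <= xi <= t2 &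
    (P s2 t2 - P s1 t2) - (P s2 t1 - P s1 t1) = (U s2 xi - U s1 xi) * (t2 - t1).
  apply: (@MVT_le (fun t => P s2 t - P s1 t)) => // x /andP[x1 x2].
  by have := dP _ _ s2ab (tin _ x1 x2); have := dP _ _ s1ab (tin _ x1 x2) => *; exact: is_deriveB.
have [eta /andP[eta1 eta2] Qeta] : exists2 eta, s1 <= eta <= s2 &
    (Q s2 t2 - Q s2 t1) - (Q s1 t2 - Q s1 t1) = (V eta t2 - V eta t1) * (s2 - s1).
  apply: (@MVT_le (fun s => Q s t2 - Q s t1) (fun s => V s t2 - V s t1)) => // x /andP[x1 x2].
  by have := dQ _ _ (sin _ x1 x2) t2cd; have := dQ _ _ (sin _ x1 x2) t1cd => *; exact: is_deriveB.
have bnd x y z w : `|x - y - z| <= e / 8 * w -> w <= D + D ->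
    `|x - y - z| <= e * D / 4.
  move=> h wD; apply: le_trans h _; rewrite (_ : e * D / 4 = e / 8 * (D + D)); last by clear; field.
  by rewrite ler_wpM2l// ltW.
have ds s : s1 <= s -> s <= s2 -> `|s - s0| <= D.
  by clear -s10 s02 sD => *; rewrite ler_norml; apply/andP; split; lra.
have dt t : t1 <= t -> t <= t2 -> `|t - t0| <= D.
  by clear -t10 t02 tD => *; rewrite ler_norml; apply/andP; split; lra.
have UVb s t : s1 <= s -> s <= s2 -> t1 <= t -> t <= t2 ->
   `|U s t - U s0 t0 - (p * (s - s0) + q * (t - t0))| <= e * D / 4 /\
   `|V s t - V s0 t0 - (r * (s - s0) + p * (t - t0))| <= e * D / 4.
  move=> h1 h2 h3 h4; have dss := ds _ h1 h2; have dtt := dt _ h3 h4.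
  have [] := UV s t (sin _ h1 h2) (tin _ h3 h4) (le_lt_trans dss Ddl) (le_lt_trans dtt Ddl).
  by move=> u v; split; [apply: bnd u _|apply: bnd v _]; exact: lerD.
have D0 : 0 <= D by apply: le_trans sD; rewrite subr_ge0.
have [A _] := UVb s2 xi ss (lexx _) xi1 xi2.
have [B _] := UVb s1 xi (lexx _) ss xi1 xi2.
have [_ C] := UVb eta t2 eta1 eta2 tt (lexx _).
have [_ E] := UVb eta t1 eta1 eta2 (lexx _) tt.
have sub_le (x y : R) : `|x| <= e * D / 4 -> `|y| <= e * D / 4 -> `|x - y| <= e * D / 2.
  move=> h1 h2; apply: le_trans (ler_normB _ _) _; apply: le_trans (lerD h1 h2) _.
  by apply: eq_ler; clear; field.
have -> : incr (primitive_diff P Q) s1 s2 t1 t2 =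
    (U s2 xi - U s1 xi - p * (s2 - s1)) * (t2 - t1)
  - (V eta t2 - V eta t1 - p * (t2 - t1)) * (s2 - s1).
  by rewrite /incr /primitive_diff; clear -Pxi Qeta; lra.
have h1 : `|U s2 xi - U s1 xi - p * (s2 - s1)| <= e * D / 2.
  by have := sub_le _ _ A B; congr (`|_| <= _); clear; ring.
have h2 : `|V eta t2 - V eta t1 - p * (t2 - t1)| <= e * D / 2.
  by have := sub_le _ _ C E; congr (`|_| <= _); clear; ring.
apply: le_trans (ler_normB _ _) _; rewrite !normrM.
rewrite (_ : e * D ^+ 2 = e * D / 2 * D + e * D / 2 * D); last by field.
have nt : `|t2 - t1| <= D by rewrite ger0_norm// subr_ge0.
have ns : `|s2 - s1| <= D by rewrite ger0_norm// subr_ge0.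
by apply: lerD; apply: ler_pM.
Qed.

(* Goursat's bisection argument *)
Lemma closed_form_incr (U V P Q : R -> R -> R) (a b c d : R) :
  a <= b -> c <= d -> closed_form U V P Q a b c d ->
  incr P a b c d = incr Q a b c d.
Proof.
move=> ab cd cf; apply/eqP; rewrite -subr_eq0; apply/negPn/negP => J0.
have {}J0 : incr (primitive_diff P Q) a b c d != 0.
  by move: J0; apply: contra_neq; rewrite /incr /primitive_diff; lra.
pose ls n : R := (b - a) / 2 ^+ n; pose lt n : R := (d - c) / 2 ^+ n.
have lsS n : ls n = ls n.+1 + ls n.+1 by rewrite /ls exprS; field; rewrite expf_neq0.
have ltS n : lt n = lt n.+1 + lt n.+1 by rewrite /lt exprS; field; rewrite expf_neq0.
have ls0 n : 0 <= ls n by rewrite divr_ge0 ?subr_ge0// exprn_ge0.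
have lt0 n : 0 <= lt n by rewrite divr_ge0 ?subr_ge0// exprn_ge0.
pose J n (p : R * R) := `|incr (primitive_diff P Q) p.1 (p.1 + ls n) p.2 (p.2 + lt n)|.
have split n p : exists p' : R * R, [/\ J n p <= 4 * J n.+1 p',
    p.1 <= p'.1 <= p.1 + ls n.+1 & p.2 <= p'.2 <= p.2 + lt n.+1].
  have s0 := ls0 n.+1; have t0 := lt0 n.+1.
  apply: contrapT => np.
  have lt4 p' : p.1 <= p'.1 <= p.1 + ls n.+1 -> p.2 <= p'.2 <= p.2 + lt n.+1 ->
      4 * J n.+1 p' < J n p.
    by move=> ? ?; rewrite ltNge; apply/negP => ?; apply: np; exists p'.
  have i1 : p.1 <= p.1 <= p.1 + ls n.+1 by apply/andP; split; lra.
  have i2 : p.1 <= p.1 + ls n.+1 <= p.1 + ls n.+1 by apply/andP; split; lra.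
  have j1 : p.2 <= p.2 <= p.2 + lt n.+1 by apply/andP; split; lra.
  have j2 : p.2 <= p.2 + lt n.+1 <= p.2 + lt n.+1 by apply/andP; split; lra.
  have h1 := lt4 (p.1, p.2) i1 j1; have h2 := lt4 (p.1, p.2 + lt n.+1) i1 j2.
  have h3 := lt4 (p.1 + ls n.+1, p.2) i2 j1.
  have h4 := lt4 (p.1 + ls n.+1, p.2 + lt n.+1) i2 j2.
  have : J n p <= J n.+1 (p.1, p.2) + J n.+1 (p.1, p.2 + lt n.+1)
    + J n.+1 (p.1 + ls n.+1, p.2) + J n.+1 (p.1 + ls n.+1, p.2 + lt n.+1).
    by rewrite /J /= (lsS n) (ltS n); exact: incr_quarters.
  by move: h1 h2 h3 h4; lra.
have /choice[next nextP] : forall np : nat * (R * R), exists p' : R * R,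
   [/\ J np.1 np.2 <= 4 * J np.1.+1 p',
    np.2.1 <= p'.1 <= np.2.1 + ls np.1.+1 & np.2.2 <= p'.2 <= np.2.2 + lt np.1.+1].
  by move=> [n p]; exact: split.
pose p := fix p n := if n is n.+1 then next (n, p n) else (a, c).
have Jp n : J 0 (p 0) <= 4 ^+ n * J n (p n).
  elim: n => [|n ih]; first by rewrite expr0 mul1r.
  apply: le_trans ih _; rewrite exprSr -mulrA ler_wpM2l ?exprn_ge0//.
  by have [] := nextP (n, p n).
have p1 n : (p n).1 <= (p n.+1).1 <= (p n).1 + ls n.+1 by have [] := nextP (n, p n).
have p2 n : (p n).2 <= (p n.+1).2 <= (p n).2 + lt n.+1 by have [] := nextP (n, p n).
have nested (u l : nat -> R) : (forall n, l n = l n.+1 + l n.+1) -> (forall n, 0 <= l n) ->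
    (forall n, u n <= u n.+1 <= u n + l n.+1) ->
    exists z, forall n, u n <= z <= u n + l n.
  move=> lS l0 ul.
  have um n m : u n <= u (n + m)%N /\ u (n + m)%N + l (n + m)%N <= u n + l n.
    elim: m => [|m [ih1 ih2]]; first by rewrite addn0.
    by have /andP[? ?] := ul (n + m)%N; have := lS (n + m)%N; rewrite addnS; split; lra.
  have ub n m : u n <= u m + l m.
    have := um n m; have := um m n; have := l0 (n + m)%N; rewrite (addnC m n) => *; lra.
  exists (sup (range u)) => n; apply/andP; split.
    apply: sup_upper_bound; last by exists n.
    by split; [exists (u 0%N), 0%N|exists (u 0 + l 0) => _ [m _ <-]; exact: ub].
  apply: sup_le_ub; first by exists (u 0), 0%N.
  by move=> _ [m _ <-]; exact: ub.
have [z1 z1P] := nested _ ls lsS ls0 p1.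
have [z2 z2P] := nested _ lt ltS lt0 p2.
have l00 : ls 0 = b - a /\ lt 0 = d - c by rewrite /ls /lt !expr0 !divr1.
have z1ab : a <= z1 <= b by have := z1P 0; rewrite /= l00.1 addrC subrK.
have z2cd : c <= z2 <= d by have := z2P 0; rewrite /= l00.2 addrC subrK.
have pin n : [/\ a <= (p n).1, (p n).1 + ls n <= b, c <= (p n).2 & (p n).2 + lt n <= d].
  elim: n => [|n [i1 i2 i3 i4]]; first by rewrite /= l00.1 l00.2; split; lra.
  have := lsS n; have := ltS n; have /andP[] := p1 n; have /andP[] := p2 n => *.
  by split; lra.
pose L := (b - a) + (d - c) + 1.
have L0 : 0 < L by rewrite /L; lra.
have Jpos : 0 < J 0 (p 0).
  by rewrite normr_gt0 /= l00.1 l00.2 !(addrC a) !(addrC c) !subrK.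
(* After [n] bisections the increment has lost at most a factor [4^n], while the sides are at most
   [L / 2^n]. The local estimate with this [e] then yields [J 0 <= J 0 / 2]. *)
pose e := J 0 (p 0) / L ^+ 2 / 2.
have e0 : 0 < e by rewrite !divr_gt0// exprn_gt0.
have [dl dl0 loc] := incr_local cf z1ab z2cd e0.
have [n nd] : exists n, L / 2 ^+ n < dl.
  have [n nd] : exists n : nat, L / dl < n.+1%:R.
    by exists (Num.truncn (L / dl)); rewrite truncnS_gt.
  exists n.+1; rewrite ltr_pdivrMr ?exprn_gt0// -ltr_pdivrMl//.
  rewrite mulrC; apply: lt_trans nd _; rewrite -natrX ltr_nat.
  exact: ltn_expl.
have [q1 q2 q3 q4] := pin n.
have /andP[y1 y2] := z1P n; have /andP[y3 y4] := z2P n.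
have inv0 : 0 < (2 ^+ n : R)^-1 by rewrite invr_gt0 exprn_gt0.
have lsL : ls n <= L / 2 ^+ n by rewrite ler_pM2r// /L; lra.
have ltL : lt n <= L / 2 ^+ n by rewrite ler_pM2r// /L; lra.
have : J n (p n) <= e * (L / 2 ^+ n) ^+ 2 by apply: loc => //; lra.
have pow4 : 4 ^+ n = (2 ^+ n) ^+ 2 :> R by rewrite exprAC; congr (_ ^+ _); ring.
rewrite -(ler_pM2l (x := 4 ^+ n)) ?exprn_gt0// => /(le_trans (Jp n)).
have -> : 4 ^+ n * (e * (L / 2 ^+ n) ^+ 2) = J 0 (p 0) / 2.
  by rewrite pow4 /e; field; rewrite expf_neq0// gt_eqF.
by move: (J 0 (p 0)) Jpos => j; clear; lra.
Qed.

End goursat.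

(** * Complex exponential and Cauchy's bound on a derivative *)

Section cauchy.
Context (R : realType).
Implicit Types (z w h l : R[i]).

Definition cn z : R := complex.Re `|z|.

Lemma normcn z : `|z| = (cn z)%:C.
Proof. exact/esym/RRe_real/ger0_real/normr_ge0. Qed.

Lemma cnE z : cn z = Num.sqrt (complex.Re z ^+ 2 + complex.Im z ^+ 2).
Proof. by rewrite /cn normc_def. Qed.

Lemma cn_ge0 z : 0 <= cn z.
Proof. by rewrite cnE sqrtr_ge0. Qed.

Lemma cn0 : cn 0 = 0.
Proof. by rewrite /cn normr0. Qed.

Lemma cnN z : cn (- z) = cn z.
Proof. by rewrite /cn normrN. Qed.

Lemma cnM z w : cn (z * w) = cn z * cn w.
Proof. by rewrite {1}/cn normrM !normcn -rmorphM. Qed.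

Lemma cnD z w : cn (z + w) <= cn z + cn w.
Proof. by rewrite -lecR rmorphD /= -!normcn ler_normD. Qed.

Lemma Re_cn z : `|complex.Re z| <= cn z.
Proof. by rewrite cnE -sqrtr_sqr ler_wsqrtr// lerDl sqr_ge0. Qed.

Lemma Im_cn z : `|complex.Im z| <= cn z.
Proof. by rewrite cnE -sqrtr_sqr ler_wsqrtr// lerDr sqr_ge0. Qed.

Lemma ReB z w : complex.Re (z - w) = complex.Re z - complex.Re w.
Proof. by case: z; case: w. Qed.

Lemma ImB z w : complex.Im (z - w) = complex.Im z - complex.Im w.
Proof. by case: z; case: w. Qed.

Lemma cn_le z : cn z <= `|complex.Re z| + `|complex.Im z|.
Proof.
rewrite cnE -[leRHS]ger0_norm ?addr_ge0// -sqrtr_sqr ler_wsqrtr//.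
rewrite sqrrD !real_normK ?num_real// lerD2r lerDl.
by rewrite mulrn_wge0// mulr_ge0.
Qed.

Lemma cn_eq0 z : cn z = 0 -> z = 0.
Proof. by move=> z0; apply/normr0_eq0; rewrite normcn z0. Qed.

Lemma cderivable_approx (f : R[i]^o -> R[i]^o) w : derivable f w 1 ->
  forall e : R, 0 < e -> exists2 d : R, 0 < d &
    forall h, cn h < d -> cn (f (w + h) - f w - h * 'D_1 f w) <= e * cn h.
Proof.
move=> /derivable_approx fl e e0.
have [|d d0 fd] := fl e%:C; first by rewrite ltcR.
have dre : d = (complex.Re d)%:C by apply/esym/RRe_real/gtr0_real.
exists (complex.Re d); first by rewrite -ltcR -dre.
move=> h hd; have := fd h; rewrite !normcn dre ltcR => /(_ hd).
by rewrite -rmorphM lecR.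
Qed.

Definition cexp w : R[i] :=
  (expR (complex.Re w) * cos (complex.Im w)) +i*
  (expR (complex.Re w) * sin (complex.Im w)).

Lemma cexpD w h : cexp (w + h) = cexp w * cexp h.
Proof.
case: w => a b; case: h => c d.
rewrite /cexp /= expRD cosD sinD; apply/eqP; rewrite eq_complex /=.
by apply/andP; split; apply/eqP; ring.
Qed.

Lemma cn_cexp w : cn (cexp w) = expR (complex.Re w).
Proof.
by rewrite cnE /= !exprMn -mulrDr cos2Dsin2 mulr1 sqrtr_sqr ger0_norm.
Qed.

Lemma cexp_approx (e : R) : 0 < e -> exists2 d : R, 0 < d &
  forall h, cn h < d -> cn (cexp h - 1 - h) <= e * cn h.
Proof.
move=> e0.
have [c0 s0 x0] : [/\ is_derive (0 : R) 1 (@cos R) (- sin 0),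
  is_derive (0 : R) 1 (@sin R) (cos 0) & is_derive (0 : R) 1 (@expR R) (expR 0)].
  by split; [exact: is_derive_cos|exact: is_derive_sin|exact: is_derive_expR].
(* With [N = cn h], the four error terms below are at most 1, 3, 1 and 4 times [e' N], which adds up
   to 9. *)
have [e' [e'0 e'1 e'8]] : exists e' : R, [/\ 0 < e', e' <= 1 & e' <= e / 9].
  exists (Num.min 1 (e / 9)).
  by rewrite lt_min ltr01 divr_gt0// !ge_min !lexx orbT.
have appr (f : R -> R) (df : R) : is_derive (0 : R) 1 f df -> exists2 d : R, 0 < d &
    forall h : R, `|h| < d -> `|f h - f 0 - h * df| <= e' * `|h|.
  move=> [fd <-]; have [d d0 fdd] := derivable_approx fd e'0.
  by exists d => // h hd; have := fdd h hd; rewrite add0r.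
have [d1 d10 h1] := appr _ _ c0; have [d2 d20 h2] := appr _ _ s0.
have [d3 d30 h3] := appr _ _ x0.
exists (Num.min (Num.min d1 d2) (Num.min d3 e')); first by rewrite !lt_min d10 d20 d30 e'0.
case=> s t; rewrite !lt_min => /andP[/andP[hd1 hd2] /andP[hd3 hde]].
have := Re_cn (s +i* t); have := Im_cn (s +i* t); set N := cn _ in hd1 hd2 hd3 hde *.
move=> /= tN sN.
have {}h1 := h1 _ (le_lt_trans tN hd1); have {}h2 := h2 _ (le_lt_trans tN hd2).
have {}h3 := h3 _ (le_lt_trans sN hd3).
move: h1 h2 h3; rewrite cos0 sin0 expR0 !oppr0 mulr0 !mulr1 !oppr0 !addr0.
set k := cos t - 1; set m := sin t - t; set x := expR s - 1 - s => h1 h2 h3.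
apply: le_trans (cn_le _) _.
have -> : complex.Re (cexp (s +i* t) - 1 - (s +i* t)) = x + (1 + s + x) * k.
  by rewrite /x /k /=; ring.
have -> : complex.Im (cexp (s +i* t) - 1 - (s +i* t)) = m + (s + x) * (t + m).
  by rewrite /x /m /=; ring.
have N0 : 0 <= N by exact: le_trans (normr_ge0 _) tN.
have kb : `|k| <= e' * N by apply: le_trans h1 _; rewrite ler_pM2l.
have mb : `|m| <= e' * N by apply: le_trans h2 _; rewrite ler_pM2l.
have xb : `|x| <= e' * N by apply: le_trans h3 _; rewrite ler_pM2l.
have e'N : e' * N <= N by rewrite ler_piMl.
have A : `|(1 + s + x) * k| <= 3 * (e' * N).
  rewrite normrM; apply: ler_pM => //.
  apply: le_trans (ler_normD _ _) _; apply: le_trans (lerD (ler_normD _ _) (lexx _)) _.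
  rewrite normr1; clear -sN xb e'N hde e'1; lra.
have B : `|(s + x) * (t + m)| <= 2 * N * (2 * e').
  rewrite normrM; apply: ler_pM => //.
    by apply: le_trans (ler_normD _ _) _; clear -sN xb e'N; lra.
  by apply: le_trans (ler_normD _ _) _; clear -tN mb e'N hde; lra.
have := ler_normD x ((1 + s + x) * k); have := ler_normD m ((s + x) * (t + m)).
have : e' * N <= e / 9 * N by rewrite ler_wpM2r.
have : 0 <= e * N by rewrite mulr_ge0// ltW.
clear -A B kb mb xb; lra.
Qed.

Lemma derivable_cexp w : derivable (cexp : R[i]^o -> R[i]^o) w 1.
Proof.
apply/cvg_ex; exists (cexp w); apply/cvgrPdist_le => /= e e0.
have ere : e = (complex.Re e)%:C by apply/esym/RRe_real/gtr0_real.
have re0 : 0 < complex.Re e by rewrite -ltcR -ere.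
have pw : 0 < cn (cexp w) by rewrite cn_cexp expR_gt0.
have [d d0 hd] := cexp_approx (divr_gt0 re0 pw).
apply/nbhs_ballP; exists d%:C; first by rewrite /= ltcR.
move=> h; rewrite -ball_normE /= sub0r normrN normcn ltcR => /hd hh h0.
rewrite ere normcn lecR.
have ph : 0 < cn h.
  by rewrite lt_neqAle cn_ge0 andbT eq_sym; apply: contra_neq h0 => /cn_eq0.
rewrite -(ler_pM2r ph) -cnM.
have -> : (cexp w - h^-1 *: (cexp (h *: 1 + w) - cexp w)) * h =
   - (cexp w * (cexp h - 1 - h)).
  rewrite -[h *: 1]/(h * 1) -[h^-1 *: _]/(h^-1 * _) mulr1 addrC (cexpD h).
  by field.
rewrite cnN cnM; apply: le_trans (ler_wpM2l (ltW pw) hh) _.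
by rewrite mulrA mulrCA divff ?mulr1// gt_eqF.
Qed.

(** The base point [a] is placed strictly below the range of interest, so that the integral from [a]
    is differentiable throughout that range. *)
Lemma exists_primitive (f : R -> R) (a : R) : continuous f ->
  exists F : R -> R, forall x : R, a < x -> is_derive x 1 F (f x).
Proof.
move=> cf; exists (fun x => \int[@lebesgue_measure R]_(t in `[a, x]) f t) => x ax.
have fi : (@lebesgue_measure R).-integrable `[a, x + 1] (EFin \o f).
  apply: continuous_compact_integrable; first exact: segment_compact.
  exact: continuous_subspaceT.
have xu : x < x + 1 by rewrite ltrDl.
have [d dE] := continuous_FTC1_closed xu fi ax (cf x).
by split; [exact: d|rewrite -derive1E].
Qed.

Lemma cderivable_lipschitz (f : R[i]^o -> R[i]^o) w : derivable f w 1 ->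
  exists K d : R, [/\ 0 < K, 0 < d & forall h, cn h < d -> cn (f (w + h) - f w) <= K * cn h].
Proof.
move=> /cderivable_approx/(_ 1 ltr01)[d d0 fd].
exists (1 + cn ('D_1 f w)), d; split => //; first by rewrite ltr_wpDr// cn_ge0.
move=> h hd; have := fd h hd; rewrite mul1r => h1.
rewrite -(subrK (h * 'D_1 f w) (f (w + h) - f w)).
apply: le_trans (cnD _ _) _; rewrite cnM mulrDl mul1r (mulrC (cn h)).
exact: lerD.
Qed.

Lemma cderivable_comp (f g : R[i]^o -> R[i]^o) w :
  derivable g w 1 -> derivable f (g w) 1 -> derivable (fun v => f (g v)) w 1.
Proof.
move=> /derivable1_diffP dg /derivable1_diffP df; apply/derivable1_diffP.
exact: (differentiable_comp dg df).
Qed.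

Lemma lipschitz_at_continuous (u : R -> R) :
  (forall x0 : R, exists K d : R, [/\ 0 < K, 0 < d & forall x : R, `|x - x0| < d ->
     `|u x - u x0| <= K * `|x - x0|]) -> continuous u.
Proof.
move=> uK x0; have [K [d [K0 d0 uKd]]] := uK x0.
apply/cvgrPdist_lt => e e0; apply/nbhs_ballP.
exists (Num.min d (e / K)); first by rewrite /= lt_min d0 divr_gt0.
move=> x; rewrite /ball/= lt_min distrC => /andP[xd xe].
rewrite distrC; apply: le_lt_trans (uKd _ xd) _.
by rewrite mulrC -ltr_pdivlMr.
Qed.

(* In the coordinate [w] with [z = z0 + cexp w] the function
   [g w = (f z - f z0) / cexp w] is holomorphic and [2 pi i]-periodic, so the
   mean of [Re g] over a circle does not depend on its radius; it tends to
   [Re (f' z0)] as the radius tends to 0. *)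
Lemma cauchy_estimate (f : R[i]^o -> R[i]^o) (z0 : R[i]) (r M : R) : 0 < r ->
  (forall z, cn (z - z0) <= r -> derivable f z 1) ->
  (forall z, cn (z - z0) <= r -> cn (f z - f z0) <= M) ->
  complex.Re ('D_1 f z0) <= M / r.
Proof.
move=> r0 fd fM.
set l := 'D_1 f z0.
pose sm := ln r.
pose g (w : R[i]^o) : R[i]^o := (f (z0 + cexp w) - f z0) * cexp (- w).
have er s : s <= sm -> expR s <= r by move=> ssm; rewrite -(lnK r0) ler_expR.
have inD w : complex.Re w <= sm -> cn (z0 + cexp w - z0) <= r.
  by move=> wsm; rewrite addrAC subrr add0r cn_cexp er.
have gd w : complex.Re w <= sm -> derivable g w 1.
  move=> wsm; apply: derivableM.
    apply: derivableB; last exact: derivable_cst.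
    apply: (@cderivable_comp f (fun w => z0 + cexp w)); last by apply: fd; exact: inD.
    by apply: derivableD; [exact: derivable_cst|exact: derivable_cexp].
  apply: (@cderivable_comp cexp (fun w => - w)); last exact: derivable_cexp.
  by apply: derivableN; exact: derivable_id.
(* Clamping the logarithm of the radius at [ln r] makes [U] and [V] continuous on all of R in each
   variable, as [exists_primitive] asks, although [f] is only known on the disc. *)
pose W s t : R[i] := Num.min s sm +i* t.
pose U s t := complex.Re (g (W s t)); pose V s t := complex.Im (g (W s t)).
have Wsm s t : complex.Re (W s t) <= sm by rewrite /= ge_min lexx orbT.
have WB s t s' t' : cn (W s t - W s' t') <= `|s - s'| + `|t - t'|.
  apply: le_trans (cn_le _) _ => /=; rewrite lerD2r /Num.min.
  rewrite ler_norml; case: (ltP s sm) => h; case: (ltP s' sm) => h'; have := ler_norm (s - s');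
    have := ler_norm (s' - s); rewrite (distrC s'); clear -h h' => *; apply/andP; split; lra.
have gW s t : exists K d : R, [/\ 0 < K, 0 < d & forall s' t',
    `|s' - s| + `|t' - t| < d ->
    cn (g (W s' t') - g (W s t)) <= K * (`|s' - s| + `|t' - t|)].
  have [K [d [K0 d0 gK]]] := cderivable_lipschitz (gd _ (Wsm s t)).
  exists K, d; split => // s' t' st; have h := WB s' t' s t.
  have := gK _ (le_lt_trans h st); rewrite (addrC (W s t)) subrK => h2.
  by apply: le_trans h2 _; rewrite ler_pM2l.
have cU s : continuous (U s).
  apply: lipschitz_at_continuous => t0; have [K [d [K0 d0 gK]]] := gW s t0.
  exists K, d; split => // t td; have := gK s t; rewrite subrr normr0 add0r => /(_ td).
  by apply: le_trans; rewrite /U -ReB; exact: Re_cn.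
have cV t : continuous (V^~ t).
  apply: lipschitz_at_continuous => s0; have [K [d [K0 d0 gK]]] := gW s0 t.
  exists K, d; split => // s sd; have := gK s t; rewrite subrr normr0 addr0 => /(_ sd).
  by apply: le_trans; rewrite /V -ImB; exact: Im_cn.
apply/ler_addgt0Pr => e e0.
have z0D : cn (z0 - z0) <= r by rewrite subrr cn0 ltW.
have [d d0 fapp] := cderivable_approx (fd _ z0D) e0.
have d20 : 0 < d / 2 by rewrite divr_gt0.
(* On the inner circle, of radius [expR s1 < d], the quotient [g] is within [e] of [l]. *)
pose s1 := Num.min sm (ln (d / 2)).
have s1sm : s1 <= sm by rewrite ge_min lexx.
have s1d : expR s1 < d.
  apply: (@le_lt_trans _ _ (d / 2)); last by rewrite ltr_pdivrMr// ltr_pMr// ltr1n.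
  by rewrite -[leRHS]lnK// ler_expR ge_min lexx orbT.
have /choice[P dP] : forall s, exists F : R -> R, forall t : R, -1 < t -> is_derive t 1 F (U s t).
  by move=> s; exact: exists_primitive.
have /choice[Q dQ] : forall t, exists F : R -> R, forall s : R, s1 - 1 < s -> is_derive s 1 F (V s t).
  by move=> t; exact: exists_primitive.
have pi0 : 0 < 2 * pi :> R by rewrite mulr_gt0// pi_gt0.
have Wle s t : s <= sm -> W s t = s +i* t.
  by move=> ssm; rewrite /W; congr (_ +i* _); exact/min_idPl.
(* [V ds + U dt] is the imaginary part of [g dw]; its closedness is the system of Cauchy-Riemann
   equations, with [p], [q], [r] read off from ['D_1 g]. *)
have cf : closed_form U V P (fun s t => Q t s) s1 sm 0 (2 * pi).
  split=> [s t _ /andP[t0 _]|s t /andP[ss _] _|s0 t0 /andP[_ s0sm] _].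
  - by apply: dP; apply: lt_le_trans t0; rewrite ltrN10.
  - by apply: dQ; apply: lt_le_trans ss; rewrite ltrBlDr ltrDl.
  exists (complex.Re ('D_1 g (W s0 t0))), (- complex.Im ('D_1 g (W s0 t0))),
    (complex.Im ('D_1 g (W s0 t0))) => eta eta0.
  have [dl dl0 gapp] := cderivable_approx (gd _ (Wsm s0 t0)) eta0.
  exists (dl / 2); first by rewrite divr_gt0.
  move=> s t /andP[_ ssm] _ sd td.
  have hd : cn (W s t - W s0 t0) < dl.
    by apply: le_lt_trans (WB _ _ _ _) _; move: sd td; clear; lra.
  have := gapp _ hd; rewrite (addrC (W s0 t0)) subrK => ga.
  have gb : eta * cn (W s t - W s0 t0) <= eta * (`|s - s0| + `|t - t0|) by rewrite ler_pM2l.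
  have dW : W s t - W s0 t0 = (s - s0) +i* (t - t0) by rewrite !Wle.
  split; apply: (le_trans _ gb); apply: (le_trans _ ga); rewrite dW.
    apply: (le_trans _ (Re_cn _)); rewrite /U.
    by case: (g (W s t)) (g (W s0 t0)) ('D_1 g (W s0 t0)) => [? ?] [? ?] [? ?] /=;
      apply: eq_ler; congr `|_|; ring.
  apply: (le_trans _ (Im_cn _)); rewrite /V.
  by case: (g (W s t)) (g (W s0 t0)) ('D_1 g (W s0 t0)) => [? ?] [? ?] [? ?] /=;
    apply: eq_ler; congr `|_|; ring.
(* [Q (2 * pi)] and [Q 0] are chosen independently, but by periodicity they are primitives of the
   same function and differ by a constant. Hence the horizontal sides cancel. *)
have Qper : Q (2 * pi) sm - Q 0 sm = Q (2 * pi) s1 - Q 0 s1.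
  have [|c /andP[c1 c2] /eqP] := @MVT_le R (fun s => Q (2 * pi) s - Q 0 s)
    (fun s => V s (2 * pi) - V s 0) s1 sm s1sm.
    move=> s /andP[s1s _]; have ss : s1 - 1 < s by apply: lt_le_trans s1s; rewrite ltrBlDr ltrDl.
    by have := dQ (2 * pi) _ ss; have := dQ 0 _ ss => *; exact: is_deriveB.
  have -> : V c (2 * pi) - V c 0 = 0.
    rewrite /V /g !Wle// /cexp /=.
    by rewrite !cosN !sinN mulr_natl cos2pi sin2pi cos0 sin0 subrr.
  by rewrite mul0r subr_eq0 => /eqP.
(* The mean over a circle is a value of [U] on it, so comparing two means amounts to comparing two
   values. *)
have Pmean s : exists2 x, 0 <= x <= 2 * pi & P s (2 * pi) - P s 0 = U s x * (2 * pi).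
  have [|x xp ->] := @MVT_le R (P s) (U s) 0 (2 * pi) (ltW pi0).
    by move=> t /andP[t0 _]; apply: dP; apply: lt_le_trans t0; rewrite ltrN10.
  by exists x => //; rewrite subr0.
have cinv w : cn (cexp (- w)) = (expR (complex.Re w))^-1.
  by rewrite cn_cexp -expRN; case: w.
have [x _ Px] := Pmean sm; have [y _ Py] := Pmean s1.
have Ux : U sm x <= M / r.
  apply: le_trans (ler_norm _) _; apply: le_trans (Re_cn _) _.
  rewrite /g cnM cinv Wle//= lnK//; apply: ler_wpM2r; first by rewrite invr_ge0 ltW.
  by apply/fM/inD.
have Uy : complex.Re l - e <= U s1 y.
  have w1 : cn (cexp (W s1 y)) = expR s1 by rewrite cn_cexp Wle.
  have := fapp (cexp (W s1 y)); rewrite w1 => /(_ s1d) h.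
  have : cn (g (W s1 y) - l) <= e.
    have -> : g (W s1 y) - l =
        (f (z0 + cexp (W s1 y)) - f z0 - cexp (W s1 y) * l) * cexp (- W s1 y).
      have : cexp (W s1 y) * cexp (- W s1 y) = 1.
        rewrite -cexpD subrr /cexp /= expR0 cos0 sin0 mulr1 mulr0 //.
      by rewrite /g => h1; rewrite [RHS]mulrBl (mulrAC (cexp (W s1 y))) h1 mul1r.
    by rewrite cnM cinv [complex.Re _]/= (min_idPl s1sm) ler_pdivrMr ?expR_gt0.
  have := Re_cn (g (W s1 y) - l); rewrite ReB ler_norml => /andP[+ _].
  by rewrite /U; clear; lra.
have := closed_form_incr s1sm (ltW pi0) cf; rewrite /incr => Jeq.
have : (U sm x - U s1 y) * (2 * pi) = 0.
  by rewrite mulrBl -Px -Py; move: Qper Jeq; clear; lra.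
move/eqP; rewrite mulf_eq0 (gt_eqF pi0) orbF subr_eq0 => /eqP xy.
by move: Ux Uy; rewrite xy; clear; lra.
Qed.

End cauchy.

(** * Analytic semigroups *)

Section analytic_semigroup.
Context (R : realType) (H : hilbertType R).
Implicit Types (x y z : H).

(* [G t] stands for [A \o S t] *)
Record analytic_semigroup (S G : R -> {linear H -> H}) (w : R) : Prop := {
  as_w : 0 <= w;
  as_0 : forall x, S 0 x = x;
  as_D : forall s t x, 0 <= s -> 0 <= t -> S (s + t) x = S s (S t x);
  as_le : forall t x, 0 <= t -> rnorm (S t x) <= expR (w * t) * rnorm x;
  as_cvg0 : forall x, S t x @[t --> 0^'+] --> x;
  as_GDl : forall s t x, 0 <= s -> 0 < t -> G (s + t) x = S s (G t x);
  as_GDr : forall s t x, 0 <= s -> 0 < t -> G (s + t) x = G t (S s x);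
  as_deriv : forall t x, 0 < t -> forall e : R, 0 < e -> exists2 d : R, 0 < d &
    forall h, `|h| < d -> rnorm (S (t + h) x - S t x + h%:C *: G t x) <= e * `|h|;
  as_bound : forall tau : R, exists2 C : R, 0 <= C & forall t x, 0 < t <= tau ->
    rnorm (G t x) <= C / t * rnorm x
}.

End analytic_semigroup.

(** * Cones inside a sector *)

Section sector.
Context (R : realType).

Lemma sector_cone (theta : R) : 0 < theta <= pi / 2 -> exists2 c : R, 0 < c &
  forall a b : R, 0 < a -> `|b| < c * a -> sector theta (a +i* b).
Proof.
move=> /andP[th0 thpi].
have pi0 := pi_gt0 R.
have th2 : 0 < theta / 2 by rewrite divr_gt0.
have th2pi : theta / 2 < pi / 2 by clear -th0 thpi; lra.
have cos0 : 0 < cos (theta / 2) by apply: cos_gt0_pihalf; apply/andP; split; clear -th0 th2pi pi0; lra.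
(* Half the angle, because [theta] may be [pi / 2], where the tangent is infinite. *)
exists (tan (theta / 2)).
  by rewrite /tan divr_gt0// sin_gt0_pi// th2/=; clear -th0 th2pi pi0; lra.
move=> a b a0 ba.
exists (cn (a +i* b)), (atan (b / a)).
have aE : a = cn (a +i* b) * cos (atan (b / a)).
  rewrite cos_atan cnE /=.
  have -> : a ^+ 2 + b ^+ 2 = a ^+ 2 * (1 + (b / a) ^+ 2) by field; rewrite gt_eqF.
  rewrite sqrtrM ?sqr_ge0// sqrtr_sqr gtr0_norm// mulfK//.
  by rewrite gt_eqF// sqrtr_gt0 ltr_pwDl// sqr_ge0.
have cs0 : 0 < cos (atan (b / a)).
  by rewrite cos_gt0_pihalf// atan_gtNpi2 atan_ltpi2.
have bE : b = cn (a +i* b) * sin (atan (b / a)).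
  have -> : sin (atan (b / a)) = b / a * cos (atan (b / a)).
    by rewrite -{2}[b / a]atanK /tan mulfVK// gt_eqF.
  by rewrite mulrCA -aE divfK// gt_eqF.
split; last by rewrite -aE -bE.
  by rewrite lt_neqAle cn_ge0 andbT; apply/eqP => c0; move: aE; rewrite -c0 mul0r => a00; rewrite a00 ltxx in a0.
have ba' : `|b / a| < tan (theta / 2) by rewrite normrM normfV (gtr0_norm a0) ltr_pdivrMr.
apply: (@lt_trans _ _ (theta / 2)); last by clear -th0; lra.
have tK : atan (tan (theta / 2)) = theta / 2 by apply: tanK; rewrite in_itv/=; apply/andP; split; clear -th0 th2pi pi0; lra.
move: ba'; rewrite !ltr_norml => /andP[/lt_atan b1 /lt_atan b2].
by move: b1 b2; rewrite atanN tK => -> ->.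
Qed.

Lemma approx_cderivable (f : R[i]^o -> R[i]^o) (z l : R[i]) :
  (forall e : R, 0 < e -> exists2 d : R, 0 < d &
    forall h, cn h < d -> cn (f (z + h) - f z - h * l) <= e * cn h) ->
  derivable f z 1 /\ 'D_1 f z = l.
Proof.
move=> fl.
suff fcvg : h^-1 *: (f (h *: 1 + z) - f z) @[h --> (0 : R[i]^o)^'] --> (l : R[i]^o).
  by split; [exact: cvgP fcvg|exact: cvg_lim fcvg].
apply/cvgrPdist_le => /= e e0.
have ere : e = (complex.Re e)%:C by apply/esym/RRe_real/gtr0_real.
have re0 : 0 < complex.Re e by rewrite -ltcR -ere.
have [d d0 hd] := fl _ re0.
apply/nbhs_ballP; exists d%:C; first by rewrite /= ltcR.
move=> h; rewrite -ball_normE /= sub0r normrN normcn ltcR => /hd hh h0.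
rewrite ere normcn lecR.
have ph : 0 < cn h.
  by rewrite lt_neqAle cn_ge0 andbT eq_sym; apply: contra_neq h0 => /cn_eq0.
rewrite -(ler_pM2r ph) -cnM.
have -> : (l - h^-1 *: (f (h *: 1 + z) - f z)) * h = - (f (z + h) - f z - h * l).
  rewrite -[h *: 1]/(h * 1) -[h^-1 *: _]/(h^-1 * _) mulr1 (addrC h).
  by field.
by rewrite cnN.
Qed.

End sector.

(** * The derivative of a holomorphic semigroup *)

Section from_hypotheses.
Context (R : realType) (H : hilbertType R).
Implicit Types (S : R -> {linear H -> H}).

Lemma opnorm_continuous_ge (T : {linear H -> H}) : continuous T ->
  forall x, rnorm (T x) <= opnorm T * rnorm x.
Proof.
move=> /continuous_bounded[C _ TC]; apply: (opnorm_ge _ TC) => a x.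
by rewrite linearZ.
Qed.

Lemma growth_bound S : C0_semigroup S -> quasi_contractive S -> exists2 w : R, 0 <= w &
  forall t x, 0 <= t -> rnorm (S t x) <= expR (w * t) * rnorm x.
Proof.
move=> S_C0 [w wS]; exists `|w| => // t x t0.
apply: le_trans (opnorm_continuous_ge (C0_bounded S_C0 t0) x) _.
apply: ler_wpM2r; first exact: rnorm_ge0.
apply: le_trans (wS t t0) _; rewrite ler_expR.
by rewrite ler_wpM2r// ler_norm.
Qed.

Lemma holomorphic_approx (U : set R[i]) (T : R[i] -> {linear H -> H}) (z : R[i]) :
  (exists2 d : R, 0 < d & forall h, cn h < d -> U (z + h)) ->
  (forall v, U v -> continuous (T v)) -> holomorphic_on U T ->
  exists Dz : {linear H -> H}, continuous Dz /\
    forall e : R, 0 < e -> exists2 d : R, 0 < d & forall h x, cn h < d ->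
      rnorm (T (z + h) x - T z x - h *: Dz x) <= e * cn h * rnorm x.
Proof.
move=> [d1 d10 Ud] Tc Th.
have Uz : U z by have := Ud 0; rewrite addr0 cn0; apply.
have [Dz Dc hD] := Th z Uz; exists Dz; split => // e e0.
move/cvgrPdist_lt : hD => /(_ e e0)/nbhs_ballP[d /= d0 hd].
have dre : d = (complex.Re d)%:C by apply/esym/RRe_real/gtr0_real.
exists (Num.min d1 (complex.Re d)); first by rewrite lt_min d10 -ltcR -dre.
move=> h x; rewrite lt_min => /andP[hd1 hd2].
have [->|h0] := eqVneq h 0.
  by rewrite addr0 subrr scale0r subr0 rnorm0 cn0 mulr0 mul0r.
have := hd h; rewrite -ball_normE /= sub0r normrN dre normcn ltcR => /(_ hd2 h0).
set f := (X in opnorm X); rewrite sub0r normrN => /ltW fe.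
have fx : rnorm (f x) <= opnorm f * rnorm x.
  have [C1 C10 h1] := continuous_bounded (Tc _ (Ud _ hd1)).
  have [C2 C20 h2] := continuous_bounded (Tc _ Uz).
  have [C3 C30 h3] := continuous_bounded Dc.
  apply: (@opnorm_ge _ _ _ (cn h^-1 * (C1 + C2) + C3)) => [a v|v]; rewrite /f.
    have hz (L : {linear H -> H}) : L (a%:C *: v) = a%:C *: L v by exact: linearZ_LR.
    by rewrite !hz -scalerBr scalerA mulrC -scalerA -scalerBr.
  apply: le_trans (rnormBD _ _) _; rewrite mulrDl; apply: lerD => //.
  rewrite rnormZ -mulrA; apply: ler_wpM2l; first exact: cn_ge0.
  by apply: le_trans (rnormBD _ _) _; rewrite mulrDl; exact: lerD.
have -> : T (z + h) x - T z x - h *: Dz x = h *: f x.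
  by rewrite /f scalerBr scalerA divff// scale1r.
rewrite rnormZ -/(cn h) mulrAC mulrC; apply: ler_wpM2r; first exact: cn_ge0.
apply: le_trans fx _; apply: ler_wpM2r; first exact: rnorm_ge0.
exact: le_trans (ler_norm _) fe.
Qed.

(** The bound [C / t] is Cauchy's estimate on a disc about [t] of radius proportional to [t]. It is
    restricted to [t <= 1/2] to keep the disc inside the unit disc, where [T] is bounded. *)
Lemma holomorphic_derivative S : holomorphic_semigroup S -> exists (G : R -> {linear H -> H}) (C : R), 0 <= C /\
  forall t, 0 < t -> [/\ continuous (G t),
   (forall e : R, 0 < e -> exists2 d : R, 0 < d & forall h x, `|h| < d ->
      rnorm (S (t + h) x - S t x + h%:C *: G t x) <= e * `|h| * rnorm x) &
   (t <= 2^-1 -> forall x, rnorm (G t x) <= C / t * rnorm x)].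
Proof.
move=> [theta [T [th Tc Th TS [M TM]]]].
have [c c0 cone] := sector_cone th.
have c1 : 0 < 1 + c by clear -c0; lra.
pose Om (z : R[i]) := 0 < complex.Re z /\ `|complex.Im z| < c * complex.Re z.
have Oms z : Om z -> sector theta z by case: z => a b [/= a0 ba]; exact: cone.
have Omo z : Om z -> exists2 d : R, 0 < d & forall h, cn h < d -> sector theta (z + h).
  case: z => a b [/= a0 ba].
  exists ((c * a - `|b|) / (1 + c)); first by rewrite divr_gt0 ?subr_gt0.
  move=> h; rewrite ltr_pdivlMr// => hd; apply: Oms.
  have := Re_cn h; have := Im_cn h; case: h hd => h1 h2 hd /= i2 i1; split => /=.
    have : c * (- h1) < c * a.
      have : c * - h1 <= c * cn (h1 +i* h2).
        by rewrite ler_pM2l//; apply: le_trans (ler_norm _) _; rewrite normrN.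
      have := normr_ge0 b; have := cn_ge0 (h1 +i* h2); clear -hd; lra.
    by rewrite ltr_pM2l//; clear; lra.
  apply: le_lt_trans (ler_normD _ _) _.
  have : c * - h1 <= c * cn (h1 +i* h2).
    by rewrite ler_pM2l//; apply: le_trans (ler_norm _) _; rewrite normrN.
  by clear -hd i2; lra.
(* The disc of radius [k t] about [t] lies in the cone as [k < c (1 - k)], and [k < 1/2] gives
   [(1 + k) t <= 1] for [t <= 1/2]. *)
pose k := c / (1 + c) / 2.
have k0 : 0 < k by rewrite !divr_gt0.
have kc : k < c * (1 - k).
  have -> : c * (1 - k) = 2 * k + k * c - 2 * k * c + c - 2 * k by clear; ring.
  have -> : k = c / (1 + c) / 2 by [].
  rewrite -subr_gt0.
  have -> : 2 * (c / (1 + c) / 2) + c / (1 + c) / 2 * c - 2 * (c / (1 + c) / 2) * c + c -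
    2 * (c / (1 + c) / 2) - c / (1 + c) / 2 = c / 2 by field; rewrite gt_eqF.
  by rewrite divr_gt0.
have k1 : k < 2^-1.
  rewrite /k -[ltRHS]mul1r ltr_pM2r ?invr_gt0// ltr_pdivrMr// mul1r ltrDr//.
clearbody k; have Omt t : 0 < t -> Om t%:C by move=> t0; split => //=; rewrite normr0 mulr_gt0.
have disc t z : 0 < t -> cn (z - t%:C) <= k * t -> Om z /\ cn z <= (1 + k) * t.
  move=> t0 zt; split; last first.
    rewrite -(subrK t%:C z); apply: le_trans (cnD _ _) _.
    have -> : cn t%:C = t by rewrite /cn normc_def /= expr0n addr0 sqrtr_sqr gtr0_norm.
    by move: zt; clear; lra.
  have := Re_cn (z - t%:C); have := Im_cn (z - t%:C).
  rewrite ReB ImB /= subr0 => hI hR; rewrite /Om.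
  have hR2 : (1 - k) * t <= complex.Re z.
    by have := ler_norm (t - complex.Re z); rewrite distrC; move: hR zt; clear; lra.
  split; first by apply: lt_le_trans hR2; rewrite mulr_gt0// subr_gt0; clear -k1; lra.
  apply: le_lt_trans hI _; apply: le_lt_trans zt _.
  by apply: (@lt_le_trans _ _ (c * ((1 - k) * t))); [rewrite mulrA ltr_pM2r|rewrite ler_pM2l].
have /choice[G0 G0P] : forall t : R, exists G : {linear H -> H}, 0 < t -> continuous G /\
    forall e : R, 0 < e -> exists2 d : R, 0 < d & forall h x, cn h < d ->
      rnorm (T (t%:C + h) x - T t%:C x - h *: G x) <= e * cn h * rnorm x.
  move=> t; have [t0|t0] := ltP 0 t; last by exists (S 0).
  by have [Dz DzP] := holomorphic_approx (Omo _ (Omt _ t0)) Tc Th; exists Dz.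
(* The sign is due to the generator being [-A]; the 2 comes from bounding [f z - f t] by two values
   of [f]. *)
exists (fun t => \- G0 t), (2 * `|M| / k); split.
  by apply: divr_ge0; [exact: mulr_ge0|exact: ltW].
move=> t t0; have [Gc Ga] := G0P t t0; split.
- have [C _ GC] := continuous_bounded Gc.
  by apply: (@bounded_continuousH _ _ _ _ C) => x; rewrite /= rnormN.
- move=> e e0; have [d d0 hd] := Ga e e0.
  exists (Num.min d t); first by rewrite lt_min d0 t0.
  move=> h x; rewrite lt_min => /andP[hd1 ht].
  have th0 : 0 < t + h by move: ht; rewrite ltr_norml => /andP[]; clear; lra.
  have hc : cn h%:C = `|h| by rewrite /cn normc_def /= expr0n addr0 sqrtr_sqr.
  have := hd h%:C x; rewrite hc => /(_ hd1).
  by rewrite -rmorphD /= !TS// scalerN.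
- move=> t12 x; rewrite /= rnormN.
  set y := G0 t x.
  (* Tested against [y = G0 t x], the derivative of [f] at [t] is the real number [|y|^2], so an
     estimate of its real part suffices. *)
  pose f (z : R[i]^o) : R[i]^o := inner (T z x) y.
  have fapp (z : R[i]) (Dz : {linear H -> H}) :
      (forall e : R, 0 < e -> exists2 d : R, 0 < d & forall h x, cn h < d ->
        rnorm (T (z + h) x - T z x - h *: Dz x) <= e * cn h * rnorm x) ->
      derivable f z 1 /\ 'D_1 f z = inner (Dz x) y.
    move=> Dza; apply: approx_cderivable => e e0.
    pose q := rnorm x * rnorm y + 1.
    have q0 : 0 < q by rewrite ltr_wpDl// mulr_ge0 ?rnorm_ge0.
    have [d d0 hd] := Dza _ (divr_gt0 e0 q0); exists d => // h hh.
    have -> : f (z + h) - f z - h * inner (Dz x) y =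
        inner (T (z + h) x - T z x - h *: Dz x) y.
      by rewrite linearBl linearBl; congr (_ - _); exact/esym/innerZl.
    apply: le_trans (inner_abs _ _) _.
    apply: le_trans (ler_wpM2r (rnorm_ge0 _) (hd _ x hh)) _.
    have : e / q * cn h * (rnorm x * rnorm y) <= e / q * cn h * q.
      apply: ler_wpM2l; first by rewrite mulr_ge0 ?cn_ge0// divr_ge0// ltW.
      by rewrite lerDl.
    by rewrite mulrA [leRHS]mulrAC divfK// gt_eqF.
  have kt0 : 0 < k * t by rewrite mulr_gt0.
  have fb z : cn (z - t%:C) <= k * t -> cn (f z) <= `|M| * (rnorm x * rnorm y).
    move=> /(disc _ _ t0)[Oz zt]; apply: le_trans (inner_abs _ _) _.
    rewrite mulrA; apply: ler_wpM2r; first exact: rnorm_ge0.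
    apply: le_trans (opnorm_continuous_ge (Tc _ (Oms _ Oz)) x) _.
    apply: ler_wpM2r; first exact: rnorm_ge0.
    apply: le_trans (ler_norm M); apply: TM; first exact: Oms.
    rewrite normcn -(rmorph1 (real_complex R)) lecR; apply: le_trans zt _.
    have : (1 + k) * t <= (1 + k) * 2^-1 by rewrite ler_pM2l// ltr_wpDl// ltW.
    by move: k1; clear; lra.
  have tt : cn (t%:C - t%:C) <= k * t by rewrite subrr cn0 ltW.
  have [_ fD] := fapp _ _ Ga.
  have := @cauchy_estimate _ f t%:C (k * t) (2 * (`|M| * (rnorm x * rnorm y))) kt0.
  rewrite fD -/(rip y y) rip_xx => h.
  have {h} : rnorm y ^+ 2 <= 2 * (`|M| * (rnorm x * rnorm y)) / (k * t).
    apply: h => z zt.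
      have [Dz [_ Dza]] := holomorphic_approx (Omo _ (disc _ _ t0 zt).1) Tc Th.
      exact: (fapp _ _ Dza).1.
    apply: le_trans (cnD _ _) _; rewrite cnN.
    by have := fb _ zt; have := fb _ tt; clear; lra.
  have [-> _|y0] := eqVneq y 0.
    by rewrite rnorm0 mulr_ge0 ?rnorm_ge0// !divr_ge0 ?mulr_ge0// ltW.
  have py := rnorm_gt0 y0; move=> hy.
  rewrite -(ler_pM2r py) -expr2; apply: le_trans hy _.
  apply: eq_ler; field.
  by rewrite !gt_eqF.
Qed.

End from_hypotheses.

(** * The operators [G t] and the generator *)

Section generator.
Context (R : realType) (H : hilbertType R).
Implicit Types (x y z u f : H) (S G : R -> {linear H -> H}).

(** Uniqueness of the first-order coefficient: to be applied to the difference of two expansions of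
    the same orbit in the step [h]. *)
Lemma small_multiples_eq0 (a : H) :
  (forall e : R, 0 < e -> exists2 h : R, 0 < h & rnorm (h%:C *: a) <= e * h) -> a = 0.
Proof.
move=> ah; apply/rnorm0_eq0/eqP; rewrite eq_le rnorm_ge0 andbT.
apply/ler_addgt0Pr => e e0; rewrite add0r.
have [h h0] := ah e e0; rewrite rnormZr gtr0_norm// mulrC.
by rewrite ler_pM2r.
Qed.

Lemma linear_comb3 (T : {linear H -> H}) (a b c : H) (k : R) :
  T (a - b + k%:C *: c) = T a - T b + k%:C *: T c.
Proof. by rewrite linearD linearB linearZ_LR. Qed.

Lemma analytic_semigroup_exists S :
  C0_semigroup S -> quasi_contractive S -> holomorphic_semigroup S ->
  exists (G : R -> {linear H -> H}) (w : R), analytic_semigroup S G w.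
Proof.
move=> S_C0 S_contr S_hol.
have [w w0 Sle] := growth_bound S_C0 S_contr.
have [G [C [C0 GP]]] := holomorphic_derivative S_hol.
have SD := C0_D S_C0.
have Sd t x : 0 < t -> forall e : R, 0 < e -> exists2 d : R, 0 < d &
    forall h, `|h| < d -> rnorm (S (t + h) x - S t x + h%:C *: G t x) <= e * `|h|.
  move=> t0 e e0; have [_ Gd _] := GP t t0.
  pose q := rnorm x + 1; have q0 : 0 < q by rewrite ltr_wpDl// rnorm_ge0.
  have [d d0 hd] := Gd _ (divr_gt0 e0 q0); exists d => // h hh.
  apply: le_trans (hd h x hh) _.
  have : e / q * `|h| * rnorm x <= e / q * `|h| * q.
    apply: ler_wpM2l; last by rewrite lerDl.
    by rewrite mulr_ge0// divr_ge0// ltW.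
  by rewrite [leRHS]mulrAC divfK// gt_eqF.
have expS s : 0 < expR (w * s) + 1 by rewrite ltr_wpDl// expR_ge0.
have GDl s t x : 0 <= s -> 0 < t -> G (s + t) x = S s (G t x).
  move=> s0 t0; apply/eqP; rewrite -subr_eq0; apply/eqP/small_multiples_eq0 => e e0.
  have st0 : 0 < s + t by rewrite ltr_wpDl.
  have e10 : 0 < e / (expR (w * s) + 1) by rewrite divr_gt0.
  have [d1 d10 h1] := Sd _ x st0 _ e10; have [d2 d20 h2] := Sd _ x t0 _ e10.
  pose h := Num.min d1 d2 / 2.
  have h0 : 0 < h by rewrite divr_gt0// lt_min d10.
  have hd : h < d1 /\ h < d2.
    have : h < Num.min d1 d2 by rewrite /h ltr_pdivrMr// ltr_pMr ?ltr1n// lt_min d10.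
    by rewrite lt_min => /andP[].
  exists h => //.
  have -> : h%:C *: (G (s + t) x - S s (G t x)) =
      (S (s + t + h) x - S (s + t) x + h%:C *: G (s + t) x)
      - S s (S (t + h) x - S t x + h%:C *: G t x).
    have e1 : S (s + t + h) x = S s (S (t + h) x).
      by rewrite -addrA; apply: SD => //; apply: addr_ge0; exact: ltW.
    have e2 : S (s + t) x = S s (S t x) by apply: SD => //; exact: ltW.
    rewrite e1 e2 linear_comb3.
    by apply: rip_inj => v; rewrite !(ripDl, ripNl, ripZl); ring.
  apply: le_trans (rnormBD _ _) _.
  have := h1 h; rewrite gtr0_norm// => /(_ hd.1) h1'.
  have := h2 h; rewrite gtr0_norm// => /(_ hd.2) h2'.
  have h3 := le_trans (Sle s _ s0) (ler_wpM2l (expR_ge0 _) h2').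
  apply: le_trans (lerD h1' h3) _.
  apply: eq_ler; field.
  by rewrite gt_eqF.
have GDr s t x : 0 <= s -> 0 < t -> G (s + t) x = G t (S s x).
  move=> s0 t0; apply/eqP; rewrite -subr_eq0; apply/eqP/small_multiples_eq0 => e e0.
  have st0 : 0 < s + t by rewrite ltr_wpDl.
  have e20 : 0 < e / 2 by rewrite divr_gt0.
  have [d1 d10 h1] := Sd _ x st0 _ e20; have [d2 d20 h2] := Sd _ (S s x) t0 _ e20.
  pose h := Num.min d1 d2 / 2.
  have h0 : 0 < h by rewrite divr_gt0// lt_min d10.
  have hd : h < d1 /\ h < d2.
    have : h < Num.min d1 d2 by rewrite /h ltr_pdivrMr// ltr_pMr ?ltr1n// lt_min d10.
    by rewrite lt_min => /andP[].
  exists h => //.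
  have -> : h%:C *: (G (s + t) x - G t (S s x)) =
      (S (s + t + h) x - S (s + t) x + h%:C *: G (s + t) x)
      - (S (t + h) (S s x) - S t (S s x) + h%:C *: G t (S s x)).
    have e1 : S (t + h) (S s x) = S (s + t + h) x.
      rewrite -addrA addrC; apply/esym/SD => //; apply: addr_ge0; exact: ltW.
    have e2 : S t (S s x) = S (s + t) x.
      by rewrite addrC; apply/esym/SD => //; exact: ltW.
    rewrite e1 e2.
    by apply: rip_inj => v; rewrite !(ripDl, ripNl, ripZl); ring.
  apply: le_trans (rnormBD _ _) _.
  have := h1 h; rewrite gtr0_norm// => /(_ hd.1) h1'.
  have := h2 h; rewrite gtr0_norm// => /(_ hd.2) h2'.
  by move: h1' h2'; clear; lra.
exists G, w; split=> //; [exact: (C0_0 S_C0)|by move=> s t x s0 t0; exact: SD|exact: (C0_cvg S_C0)|move=> tau].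
(* For [t > 1/2] one writes [G t = S (t - 1/2) (G (1/2))], where [G (1/2)] is bounded by [2 C]; the
   last factor compensates the division by [t]. *)
pose C' := C + 2 * C * expR (w * `|tau|) * `|tau|.
exists C'; first by rewrite addr_ge0// !mulr_ge0// expR_ge0.
move=> t x /andP[t0 tt].
have [th|th] := leP t 2^-1.
  have [_ _ Gb] := GP t t0; apply: le_trans (Gb th x) _.
  apply: ler_wpM2r; first exact: rnorm_ge0.
  by rewrite ler_pM2r ?invr_gt0// lerDl !mulr_ge0// expR_ge0.
have h20 : 0 < (2^-1 : R) by rewrite invr_gt0.
have th0 : 0 <= t - 2^-1 by rewrite subr_ge0 ltW.
have -> : t = t - 2^-1 + 2^-1 by rewrite subrK.
rewrite GDl// subrK; apply: le_trans (Sle _ _ th0) _.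
have [_ _ Gb] := GP _ h20; have {Gb} := Gb (lexx _) x.
rewrite invrK => Gb; apply: le_trans (ler_wpM2l (expR_ge0 _) Gb) _.
rewrite mulrA; apply: ler_wpM2r; first exact: rnorm_ge0.
rewrite ler_pdivlMr//.
have tta : t <= `|tau| by exact: le_trans tt (ler_norm _).
have : expR (w * (t - 2^-1)) * t <= expR (w * `|tau|) * `|tau|.
  apply: ler_pM; [exact: expR_ge0|exact: ltW| |exact: tta].
  by rewrite ler_expR; apply: ler_wpM2l => //; move: tta h20; clear; lra.
move=> h; have : C * 2 * (expR (w * (t - 2^-1)) * t) <= C * 2 * (expR (w * `|tau|) * `|tau|).
  by apply: ler_wpM2l => //; rewrite mulr_ge0.
by rewrite /C'; move: C0; clear; lra.
Qed.

Lemma approx_is_derive (f : R -> R) (x l : R) :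
  (forall e : R, 0 < e -> exists2 d : R, 0 < d &
    forall h : R, `|h| < d -> `|f (x + h) - f x - h * l| <= e * `|h|) ->
  is_derive x 1 f l.
Proof.
move=> fl.
have fcvg : h^-1 *: (f (h *: 1 + x) - f x) @[h --> (0 : R)^'] --> l.
  apply/cvgrPdist_le => /= e e0.
  have [d d0 hd] := fl _ e0.
  apply/nbhs_ballP; exists d => // h; rewrite /ball/= sub0r normrN => /hd hh h0.
  rewrite -(ler_pM2r (x := `|h|)) ?normr_gt0// -normrM.
  have -> : (l - h^-1 *: (f (h *: 1 + x) - f x)) * h = - (f (x + h) - f x - h * l).
    rewrite -[h *: 1]/(h * 1) -[h^-1 *: _]/(h^-1 * _) mulr1 (addrC h).
    by field.
  by rewrite normrN.
by split; [exact: cvgP fcvg|exact: cvg_lim fcvg].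
Qed.

(** Derivative of a curve in a real parameter, spelled out because the scalars of [H] are
    complex. *)
Definition vderive (F : R -> H) (t : R) (F' : H) : Prop :=
  forall e : R, 0 < e -> exists2 d : R, 0 < d &
    forall h : R, `|h| < d -> rnorm (F (t + h) - F t - h%:C *: F') <= e * `|h|.

Lemma vderive_rip F t F' y : vderive F t F' ->
  is_derive t 1 (fun s => rip (F s) y) (rip F' y).
Proof.
move=> FF; apply: approx_is_derive => e e0.
pose q := rnorm y + 1; have q0 : 0 < q by rewrite ltr_wpDl// rnorm_ge0.
have [d d0 hd] := FF _ (divr_gt0 e0 q0); exists d => // h hh.
rewrite -ripZl -!ripBl; apply: le_trans (rip_abs _ _) _.
apply: le_trans (ler_wpM2r (rnorm_ge0 _) (hd h hh)) _.
have : e / q * `|h| * rnorm y <= e / q * `|h| * q.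
  apply: ler_wpM2l; last by rewrite lerDl.
  by rewrite mulr_ge0// divr_ge0// ltW.
by rewrite [leRHS]mulrAC divfK// gt_eqF.
Qed.

(** The scalar mean value theorem applied to the component along [v = F b - F a]. *)
Lemma vderive_MVT F F' (a b K : R) : a <= b ->
  (forall t, a <= t <= b -> vderive F t (F' t)) ->
  (forall t, a <= t <= b -> rnorm (F' t) <= K) ->
  rnorm (F b - F a) <= K * (b - a).
Proof.
move=> ab FF FK; set v := F b - F a.
have [|c cab E] := @MVT_le R (fun s => rip (F s) v) (fun s => rip (F' s) v) a b ab.
  by move=> t tab; apply: vderive_rip; exact: FF.
have [->|v0] := eqVneq v 0.
  rewrite rnorm0 mulr_ge0 ?subr_ge0//.
  by apply: le_trans (FK _ cab); exact: rnorm_ge0.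
have pv := rnorm_gt0 v0; rewrite -(ler_pM2r pv) -expr2 -rip_xx {1}/v ripBl E.
rewrite mulrAC; apply: ler_wpM2r; first by rewrite subr_ge0.
apply: le_trans (rip_le _ _) _; apply: ler_wpM2r; first exact: rnorm_ge0.
exact: FK.
Qed.

Lemma as_vderive S G w t x : analytic_semigroup S G w -> 0 < t ->
  vderive (fun s => S s x) t (- G t x).
Proof.
move=> SG t0 e e0; have [d d0 hd] := as_deriv SG x t0 e0.
by exists d => // h hh; rewrite scalerN opprK; exact: hd.
Qed.

(** The derivative is [- A^2 S t], split into two factors [G (t / 2)]: one differentiates
    [S (t / 2 + h)] at the vector [G (t / 2) x]. *)
Lemma as_Gderive S G w t x : analytic_semigroup S G w -> 0 < t ->
  vderive (fun s => G s x) t (- G (t / 2) (G (t / 2) x)).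
Proof.
move=> SG t0 e e0; have t20 : 0 < t / 2 by rewrite divr_gt0.
have [d d0 hd] := as_vderive (G (t / 2) x) SG t20 e0.
exists (Num.min d (t / 2)); first by rewrite lt_min d0.
move=> h; rewrite lt_min => /andP[h1 h2]; have := hd _ h1.
have th : 0 <= t / 2 + h by move: h2; rewrite ltr_norml => /andP[]; clear; lra.
have e1 : G (t + h) x = S (t / 2 + h) (G (t / 2) x).
  by rewrite -(as_GDl SG)// addrAC -splitr.
have e2 : G t x = S (t / 2) (G (t / 2) x).
  by rewrite -(as_GDl SG) -?splitr// ltW.
by rewrite e1 {1}e2.
Qed.

(** Eliminates the unbounded operator: from here on [A u = f] means that [G t u = S t f] for all
    [t > 0]. One direction applies [S t] to the difference quotient at 0; the other integrates the
    derivative [- S t f] of the orbit of [u] down to 0. *)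
Lemma generator_iff S G w (D : set H) (A : H -> H) u f :
  analytic_semigroup S G w -> is_generator S D (fun x => - A x) ->
  (D u /\ A u = f) <-> (forall t, 0 < t -> G t u = S t f).
Proof.
move=> SG [DE DA]; split.
  move=> [Du <-] t t0; apply/eqP; rewrite -subr_eq0; apply/eqP/small_multiples_eq0 => e e0.
  have [q q0 qE] : exists2 q : R, 0 < q & q = expR (w * t) + 1.
    by eexists; [|reflexivity]; rewrite ltr_wpDl// expR_ge0.
  have e10 : 0 < e / q by rewrite divr_gt0.
  have [d1 d10 h1] := as_deriv SG u t0 e10.
  have /cvg_rnormP/(_ _ e10) := DA u Du.
  rewrite near_withinE => /nbhs_ballP[d2 /= d20 h2].
  pose h := Num.min d1 d2 / 2.
  have h0 : 0 < h by rewrite divr_gt0// lt_min d10.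
  have hd : h < d1 /\ h < d2.
    have : h < Num.min d1 d2 by rewrite /h ltr_pdivrMr// ltr_pMr ?ltr1n// lt_min d10.
    by rewrite lt_min => /andP[].
  exists h => //.
  have := h2 h; rewrite /ball/= sub0r normrN gtr0_norm// => /(_ hd.2 h0).
  rewrite opprK => /ltW h2'.
  have -> : h%:C *: (G t u - S t (A u)) = (S (t + h) u - S t u + h%:C *: G t u)
     - S t (h%:C *: (diff_quotient S u h + A u)).
    have -> : h%:C *: (diff_quotient S u h + A u) = S h u - u + h%:C *: A u.
      by rewrite /diff_quotient scalerDr scalerA -rmorphM divff ?gt_eqF// scale1r.
    have -> : S (t + h) u = S t (S h u) by apply: (as_D SG); exact: ltW.
    have -> : S t (S h u - u + h%:C *: A u) = S t (S h u) - S t u + h%:C *: S t (A u).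
      exact: linear_comb3.
    by apply: rip_inj => v; rewrite !(ripDl, ripNl, ripZl); ring.
  apply: le_trans (rnormBD _ _) _.
  have := h1 h; rewrite gtr0_norm// => /(_ hd.1) h1'.
  have := as_le SG (h%:C *: (diff_quotient S u h + A u)) (ltW t0).
  rewrite rnormZr gtr0_norm// => h3.
  have h4 := le_trans h3 (ler_wpM2l (expR_ge0 _) (ler_wpM2l (ltW h0) h2')).
  apply: le_trans (lerD h1' h4) _.
  apply: eq_ler.
  have -> : expR (w * t) = q - 1 by rewrite qE addrK.
  by field; rewrite gt_eqF.
move=> Gu.
have dq : diff_quotient S u t @[t --> 0^'+] --> - f.
  apply/cvg_rnormP => e e0; have e20 : 0 < e / 2 by rewrite divr_gt0.
  have /cvg_rnormP/(_ _ e20) := @as_cvg0 _ _ _ _ _ SG f.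
  rewrite near_withinE => /nbhs_ballP[d /= d0 hf].
  rewrite near_withinE; apply/nbhs_ballP; exists d => //= h.
  rewrite /ball/= sub0r normrN => hd h0; rewrite gtr0_norm// in hd.
  have key : rnorm (S h u - u + h%:C *: f) <= e / 2 * h.
    apply/ler_addgt0Pr => eta eta0; have eta20 : 0 < eta / 2 by rewrite divr_gt0.
    have /cvg_rnormP/(_ _ eta20) := @as_cvg0 _ _ _ _ _ SG u.
    rewrite near_withinE => /nbhs_ballP[d' /= d'0 hu].
    pose q := 2 * (rnorm f + 1).
    have q0 : 0 < q by rewrite mulr_gt0// ltr_wpDl// rnorm_ge0.
    pose m := Num.min d' (Num.min h (eta / q)).
    have m0 : 0 < m by rewrite !lt_min d'0 h0 divr_gt0.
    pose ep := m / 2.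
    have ep0 : 0 < ep by rewrite divr_gt0.
    have : ep < m by rewrite /ep ltr_pdivrMr// ltr_pMr ?ltr1n.
    rewrite !lt_min => /andP[epd /andP[eph epq]].
    have h1 : rnorm (S ep u - u) < eta / 2.
      by apply: (hu ep) => //; rewrite /ball/= sub0r normrN gtr0_norm.
    have h2 : ep * rnorm f <= eta / 2.
      move: epq; rewrite ltr_pdivlMr// /q; have := rnorm_ge0 f.
      by move: ep0; clear; nra.
    (* The derivative [f - S s f] is small near 0 but known only for [s > 0]. So the mean value
       inequality is used on [[ep, h]], and strong continuity closes the gap between 0 and [ep]. *)
    pose F s := S s u + s%:C *: f.
    have h3 : rnorm (F h - F ep) <= e / 2 * (h - ep).
      apply: (@vderive_MVT F (fun s => f - S s f)); first exact: ltW.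
        move=> t /andP[t1 t2]; have t0 : 0 < t by apply: lt_le_trans t1.
        move=> e' e'0; have [dd dd0 hdd] := as_deriv SG u t0 e'0.
        exists dd => // k /hdd; rewrite Gu//; congr (rnorm _ <= _).
        rewrite /F rmorphD; apply: rip_inj => v.
        by rewrite scalerBr scalerDl !(ripDl, ripNl, ripZl); ring.
      move=> t /andP[t1 t2]; rewrite rnormB; apply/ltW/hf; last exact: lt_le_trans t1.
      rewrite /ball/= sub0r normrN gtr0_norm; first exact: le_lt_trans hd.
      exact: lt_le_trans t1.
    have -> : S h u - u + h%:C *: f = (F h - F ep) + (S ep u - u) + ep%:C *: f.
      by apply: rip_inj => v; rewrite /F !(ripDl, ripNl, ripZl); ring.
    apply: le_trans (rnormD _ _) _; apply: le_trans (lerD (rnormD _ _) (lexx _)) _.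
    rewrite rnormZr gtr0_norm//.
    have : e / 2 * (h - ep) <= e / 2 * h by rewrite ler_pM2l// gerBl ltW.
    by move: h1 h2 h3; clear; lra.
  rewrite opprK.
  have -> : diff_quotient S u h + f = (h^-1)%:C *: (S h u - u + h%:C *: f).
    by rewrite /diff_quotient [RHS]scalerDr scalerA -rmorphM mulVf ?gt_eqF// scale1r.
  rewrite rnormZr gtr0_norm ?invr_gt0// mulrC ltr_pdivrMr//.
  by apply: le_lt_trans key _; rewrite ltr_pM2r// ltr_pdivrMr// ltr_pMr// ltr1n.
have Du : D u by rewrite DE; exact: cvgP dq.
split => //; have := DA u Du => /(cvg_lim (@norm_hausdorff _ _)).
by rewrite (cvg_lim (@norm_hausdorff _ _) dq) => /oppr_inj.
Qed.

End generator.

(** * Exponential damping, adjoints and difference quotients *)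

Section damping.
Context (R : realType) (H : hilbertType R).
Implicit Types (x y z : H) (S G : R -> {linear H -> H}) (s t w tau : R).

Definition damped (w : R) S (t : R) x : H := (expR (- (w * t)))%:C *: S t x.

Lemma damped_contraction_semigroup w S :
  (forall s t x, 0 <= s -> 0 <= t -> S (s + t) x = S s (S t x)) ->
  (forall t x, 0 <= t -> rnorm (S t x) <= expR (w * t) * rnorm x) ->
  contraction_semigroup (damped w S).
Proof.
move=> SD Sle; split=> [t x y|t a x|t x t0|s t x s0 t0]; rewrite /damped.
- by rewrite linearB scalerBr.
- by rewrite (linearZ_LR (S t)) !scalerA (mulrC _ a%:C).
- rewrite rnormZr gtr0_norm ?expR_gt0// expRN -ler_pdivlMl ?invr_gt0 ?expR_gt0//.
  by rewrite invrK; exact: Sle.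
- have e : expR (- (w * (s + t))) = expR (- (w * s)) * expR (- (w * t)).
    by rewrite -expRD; congr expR; ring.
  by rewrite SD// (linearZ_LR (S s)) scalerA e rmorphM.
Qed.

Lemma damped_adjoint w S : (forall t, 0 <= t -> continuous (S t)) ->
  (forall s t x, 0 <= s -> 0 <= t -> S (s + t) x = S s (S t x)) ->
  (forall t x, 0 <= t -> rnorm (S t x) <= expR (w * t) * rnorm x) ->
  exists S', contraction_semigroup (damped w S') /\
    (forall t x y, 0 <= t -> rip (damped w S t x) y = rip x (damped w S' t y)).
Proof.
move=> Sc SD Sle.
have /choice[S' S'P] : forall t, exists T' : {linear H -> H}, 0 <= t ->
    (forall x y, rip (S t x) y = rip x (T' y)) /\
    forall C, (forall x, rnorm (S t x) <= C * rnorm x) ->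
      forall x, rnorm (T' x) <= C * rnorm x.
  move=> t; have [t0|t0] := leP 0 t; last by exists (S t).
  by have [T' [h1 h2]] := adjoint (Sc t t0); exists T'.
exists S'; split.
  apply: damped_contraction_semigroup => [s t x s0 t0|t x t0].
    apply: rip_inj => y; rewrite !(ripC _ y).
    rewrite -(S'P _ (addr_ge0 s0 t0)).1 -(S'P _ s0).1 -(S'P _ t0).1.
    by rewrite addrC SD.
  by apply: (S'P _ t0).2 => z; exact: Sle.
move=> t x y t0; rewrite /damped ripZl ripZr; congr (_ * _).
exact: (S'P _ t0).1.
Qed.

Lemma as_S_continuous S G w t : analytic_semigroup S G w -> 0 <= t -> continuous (S t).
Proof. by move=> SG t0; apply: bounded_continuousH => x; exact: (as_le SG). Qed.

(** Minus the time derivative of [damped w S t x], that is [A + w] applied to it. *)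
Definition damped_gen (w : R) S G t x : H :=
  (expR (- (w * t)))%:C *: (G t x + w%:C *: S t x).

Lemma damped_derive S G w t x y : analytic_semigroup S G w -> 0 < t ->
  is_derive t 1 (fun s => rip (damped w S s x) y) (- rip (damped_gen w S G t x) y).
Proof.
move=> SG t0.
have -> : (fun s => rip (damped w S s x) y) =
    (fun s => expR (- (w * s))) * (fun s => rip (S s x) y).
  by apply/funext => s; rewrite /damped ripZl.
have d1 : is_derive t 1 (fun s => expR (- (w * s))) (- w * expR (- (w * t))).
  have -> : (fun s => expR (- (w * s))) = expR \o (fun s => (- w) * s).
    by apply/funext => s /=; rewrite mulNr.
  have d : is_derive t 1 (fun s : R => (- w) * s) (- w).
    have -> : (fun s : R => (- w) * s) = (- w) \*: id by apply/funext.
    by apply: is_derive_eq; rewrite -[_ *: _]/(_ * _) mulr1.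
  by apply: is_derive_eq; rewrite [LHS]mulrC (mulNr w t).
have d2 := vderive_rip y (as_vderive x SG t0).
apply: is_derive_eq.
rewrite /damped_gen ripZl ripDl ripZl ripNl -[_ *: _]/(_ * _) -[X in _ + X]/(_ * _).
by ring.
Qed.

Lemma damped_analytic_bound S G w tau : analytic_semigroup S G w -> 0 < tau ->
  exists2 c : R, 0 <= c & analytic_bound tau c (damped w S).
Proof.
move=> SG tau0; have [C C0 GC] := as_bound SG tau; have w0 := as_w SG.
exists (C + w * tau); first by rewrite addr_ge0// mulr_ge0// ltW.
move=> s h x /andP[s0 st] h0; set v := damped w S s x - _.
have sh : s <= s + h by rewrite lerDl ltW.
have [|c /andP[c1 _] E] := @MVT_le R (fun t => rip (damped w S t x) v)
  (fun t => - rip (damped_gen w S G t x) v) s (s + h) sh.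
  by move=> t /andP[t1 _]; apply: damped_derive => //; exact: lt_le_trans t1.
have c0 : 0 < c by exact: lt_le_trans c1.
have b : rnorm (damped_gen w S G c x) <= (C / s + w) * rnorm x.
  rewrite rnormZr gtr0_norm ?expR_gt0//.
  (* The intermediate time [c] may exceed [tau], where [as_bound] gives no constant. So [G] is
     estimated at [s], and the damping absorbs the growth of [S (c - s)]. *)
  have -> : G c x = S (c - s) (G s x) by rewrite -(as_GDl SG) ?subrK// subr_ge0.
  have h1 : rnorm (S (c - s) (G s x)) <= expR (w * (c - s)) * (C / s * rnorm x).
    apply: le_trans (as_le SG _ _) _; first by rewrite subr_ge0.
    by apply: ler_wpM2l; [exact: expR_ge0|apply: GC; rewrite s0].
  have h2 := as_le SG x (ltW c0).
  apply: le_trans (ler_wpM2l (expR_ge0 _) (rnormD _ _)) _.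
  rewrite rnormZr (ger0_norm w0) [leLHS]mulrDr [leRHS]mulrDl; apply: lerD.
    apply: le_trans (ler_wpM2l (expR_ge0 _) h1) _.
    rewrite [leLHS]mulrA -expRD; apply: ler_piMl.
      by rewrite mulr_ge0 ?rnorm_ge0// divr_ge0// ltW.
    rewrite -[leRHS]expR0 ler_expR.
    have : 0 <= w * s by rewrite mulr_ge0// ltW.
    by clear; lra.
  rewrite [leLHS]mulrCA; apply: ler_wpM2l => //.
  apply: le_trans (ler_wpM2l (expR_ge0 _) h2) _.
  by rewrite [leLHS]mulrA -expRD addNr expR0 mul1r.
have [->|v0] := eqVneq v 0.
  rewrite rnorm0; apply: mulr_ge0; last exact: rnorm_ge0.
  apply: mulr_ge0; last by apply: divr_ge0; exact: ltW.
  by apply: addr_ge0 => //; apply: mulr_ge0 => //; exact: ltW.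
have pv := rnorm_gt0 v0; rewrite -(ler_pM2r pv) -expr2 -rip_xx {1}/v ripBl.
have -> : rip (damped w S s x) v - rip (damped w S (s + h) x) v =
    rip (damped_gen w S G c x) v * h.
  by move: E; rewrite addrAC subrr add0r mulNr => E; clear -E; lra.
have b2 : rip (damped_gen w S G c x) v <= (C / s + w) * rnorm x * rnorm v.
  by apply: le_trans (rip_le _ _) _; apply: ler_wpM2r => //; exact: rnorm_ge0.
apply: le_trans (ler_wpM2r (ltW h0) b2) _.
have h3 : C / s + w <= (C + w * tau) / s.
  by rewrite mulrDl lerD2l ler_pdivlMr// ler_wpM2l.
have -> : (C + w * tau) * (h / s) * rnorm x * rnorm v =
   (C + w * tau) / s * (rnorm x * rnorm v * h) by ring.
have -> : (C / s + w) * rnorm x * rnorm v * h =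
   (C / s + w) * (rnorm x * rnorm v * h) by ring.
apply: ler_wpM2r; last exact: h3.
by rewrite !mulr_ge0 ?rnorm_ge0// ltW.
Qed.

Lemma analytic_bound_adjoint (U U' : R -> H -> H) tau c : 0 <= c ->
  (forall t x y, 0 <= t -> rip (U t x) y = rip x (U' t y)) ->
  analytic_bound tau c U -> analytic_bound tau c U'.
Proof.
move=> c0 UU' Ub s h y st h0; set v := _ - _.
have s0 : 0 < s by case/andP: st.
have ch : 0 <= c * (h / s) by rewrite mulr_ge0// divr_ge0// ltW.
have [->|v0] := eqVneq v 0; first by rewrite rnorm0 mulr_ge0// rnorm_ge0.
have pv := rnorm_gt0 v0; rewrite -(ler_pM2r pv) -expr2 -rip_xx {2}/v ripBr.
have sle := ltW s0; have she : 0 <= s + h by rewrite addr_ge0// ltW.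
rewrite -(UU' s)// -(UU' (s + h))// -ripBl; apply: le_trans (rip_le _ _) _.
by rewrite mulrAC; apply: ler_wpM2r; [exact: rnorm_ge0|exact: Ub].
Qed.

(** Lets the step [h] of the difference quotients tend to 0 inside a finite dyadic sum. *)
Lemma sum_limit_le n (q : nat -> R -> R) (l : nat -> R) (b : R) :
  (forall k (e : R), 0 < e -> exists2 d : R, 0 < d &
    forall h : R, 0 < h < d -> l k <= q k h + e) ->
  (forall h : R, 0 < h -> \sum_(k < n) q k h <= b) -> \sum_(k < n) l k <= b.
Proof.
move=> ql qb; apply/ler_addgt0Pr => e e0.
suff [d d0 hd] : exists2 d : R, 0 < d &
    forall h : R, 0 < h < d -> \sum_(k < n) l k <= \sum_(k < n) q k h + e.
  have h0 : 0 < d / 2 by rewrite divr_gt0.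
  have := hd (d / 2); rewrite h0 ltr_pdivrMr// ltr_pMr ?ltr1n// => /(_ isT).
  by have := qb _ h0; clear; lra.
elim: n e e0 {qb} => [|n ih] e e0.
  by exists 1 => // h _; rewrite !big_ord0 add0r ltW.
have e20 : 0 < e / 2 by rewrite divr_gt0.
have [d1 d10 h1] := ih _ e20; have [d2 d20 h2] := ql n _ e20.
exists (Num.min d1 d2); first by rewrite lt_min d10.
move=> h; rewrite lt_min => /andP[h0 /andP[hd1 hd2]]; rewrite !big_ord_recr /=.
have := h1 h; rewrite h0 hd1 => /(_ isT); have := h2 h; rewrite h0 hd2 => /(_ isT).
by clear; lra.
Qed.

Lemma damped_quotient_limit S G w s x y : analytic_semigroup S G w -> 0 < s ->
  forall e : R, 0 < e -> exists2 d : R, 0 < d & forall h : R, 0 < h < d ->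
  s * rip (damped_gen w S G s x) y <=
    (s / h) * rip (damped w S s x - damped w S (s + h) x) y + e.
Proof.
move=> SG s0 e e0; have es : 0 < e / s by rewrite divr_gt0.
have [dd dE] := damped_derive x y SG s0.
have [d d0 hd] := derivable_approx dd es; exists d => // h /andP[h0 hh].
have := hd h; rewrite gtr0_norm// => /(_ hh); rewrite dE -[_ *: _]/(_ * _) ler_norml.
move=> /andP[_]; rewrite mulrN opprK ripBl => h1.
have : s / h * (rip (damped w S (s + h) x) y - rip (damped w S s x) y +
   h * rip (damped_gen w S G s x) y) <= s / h * (e / s * h).
  by apply: ler_wpM2l => //; rewrite divr_ge0// ltW.
have -> : s / h * (e / s * h) = e by field; rewrite !gt_eqF.
rewrite mulrDr mulrA divfK ?gt_eqF//.
by rewrite mulrBr mulrBr; clear; lra.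
Qed.

End damping.

(** * Dyadic square function estimates *)

Section dyadic.
Context (R : realType) (H : hilbertType R).
Implicit Types (x y z : H) (S G : R -> {linear H -> H}) (s t w tau : R).

(** The sum of [(dy tau k)^2 |G (dy tau k) x|^2] stands for the integral of [t |G t x|^2], and the
    sum with weights [dy tau k] for the integral of [|G t x|^2]. *)
Definition dy tau (k : nat) : R := tau / 2 ^+ k.

Lemma dy0 tau : dy tau 0 = tau.
Proof. by rewrite /dy expr0 divr1. Qed.

Lemma dyS tau k : dy tau k = 2 * dy tau k.+1.
Proof. by rewrite /dy exprS; field; rewrite expf_neq0. Qed.

Lemma dy_gt0 tau k : 0 < tau -> 0 < dy tau k.
Proof. by move=> t0; rewrite divr_gt0// exprn_gt0. Qed.

Lemma dy_le tau k : 0 < tau -> dy tau k <= tau.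
Proof.
move=> t0; rewrite ler_pdivrMr ?exprn_gt0//; apply: ler_peMr; first exact: ltW.
by apply: exprn_ege1; rewrite ler1n.
Qed.

Lemma sum_dy_sqr tau n : \sum_(k < n) dy tau k ^+ 2 <= 2 * tau ^+ 2.
Proof.
suff : \sum_(k < n) dy tau k ^+ 2 <= 2 * tau ^+ 2 - 2 * dy tau n ^+ 2.
  by have := sqr_ge0 (dy tau n); clear; lra.
elim: n => [|n ih]; first by rewrite big_ord0 dy0 subrr.
rewrite big_ord_recr/= -(@ler_pM2l _ 4)//.
have := sqr_ge0 (dy tau n.+1); rewrite (dyS tau n) in ih *.
by move: ih; rewrite !exprMn; clear; lra.
Qed.

Lemma rnormZr_sqr (a : R) x : rnorm (a%:C *: x) ^+ 2 = a ^+ 2 * rnorm x ^+ 2.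
Proof. by rewrite rnormZr exprMn real_normK// num_real. Qed.

Lemma rip_AMGM x y (a : R) : a * rip x y <= 2^-1 * (a ^+ 2 * rnorm x ^+ 2 + rnorm y ^+ 2).
Proof.
have := sqr_ge0 (rnorm (a%:C *: x - y)); rewrite rnorm_sqrB ripZl rnormZr_sqr.
by clear; lra.
Qed.

Lemma sumD_half n (a b : 'I_n -> R) (A B : R) : \sum_(k < n) a k <= A -> \sum_(k < n) b k <= B ->
  \sum_(k < n) 2^-1 * (a k + b k) <= 2^-1 * (A + B).
Proof. by move=> h1 h2; rewrite -big_distrr/= ler_pM2l ?invr_gt0// big_split/= lerD. Qed.

Section fixed.
Variables (S G : R -> {linear H -> H}) (w tau : R).
Hypotheses (SG : analytic_semigroup S G w) (tau0 : 0 < tau).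

Let U := damped w S.
Let B := damped_gen w S G.

Let Scont t : 0 <= t -> continuous (S t).
Proof. exact: as_S_continuous SG. Qed.

Let dgt k : 0 < dy tau k. Proof. exact: dy_gt0. Qed.

(** The first estimate is the square function of the damped semigroup in the limit of small [h]; the
    second is that of its adjoint, dualised. *)
Lemma damped_dyadic : exists2 K : R, 0 <= K &
  (forall n x, \sum_(k < n) dy tau k ^+ 2 * rnorm (B (dy tau k) x) ^+ 2 <= K * rnorm x ^+ 2) /\
  (forall n (g : nat -> H) y, \sum_(k < n) dy tau k * rip (B (dy tau k) (g k)) y
     <= 2^-1 * (K * rnorm y ^+ 2 + \sum_(k < n) rnorm (g k) ^+ 2)).
Proof.
have [c c0 Ua] := damped_analytic_bound SG tau0.
have [S' [US' SS']] := damped_adjoint Scont (as_D SG) (as_le SG).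
have US := damped_contraction_semigroup (as_D SG) (as_le SG).
have Ua' := analytic_bound_adjoint c0 SS' Ua.
pose K := (1 + 3 * c + 8 * c ^+ 2) ^+ 2.
exists K; first exact: sqr_ge0.
split=> [n x|n g y].
  (* The limit is available for scalar products only, so the squares are linearised by pairing with
     [y k]. This bounds the sum by half of [K |x|^2] plus half of itself. *)
  pose y k := (dy tau k)%:C *: B (dy tau k) x.
  have E k : dy tau k ^+ 2 * rnorm (B (dy tau k) x) ^+ 2 = rnorm (y k) ^+ 2.
    by rewrite /y rnormZr_sqr.
  have E2 k : dy tau k * rip (B (dy tau k) x) (y k) = rnorm (y k) ^+ 2.
    by rewrite -ripZl -/(y k) rip_xx.
  have : \sum_(k < n) dy tau k * rip (B (dy tau k) x) (y k) <=
      2^-1 * (K * rnorm x ^+ 2 + \sum_(k < n) rnorm (y k) ^+ 2).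
    apply: (sum_limit_le (q := fun k h => dy tau k / h * rip (U (dy tau k) x - U (dy tau k + h) x) (y k))
        (l := fun k => dy tau k * rip (B (dy tau k) x) (y k))).
      by move=> k e e0; exact: damped_quotient_limit.
    move=> h h0.
    apply: le_trans (sumD_half (dyadic_square_function US tau0 c0 Ua x n h0) (lexx (\sum_(k < n) rnorm (y k) ^+ 2))).
    by apply: ler_sum => k _; exact: rip_AMGM.
  under eq_bigr do rewrite E2.
  under [in X in _ -> X <= _]eq_bigr do rewrite E.
  by lra.
apply: (sum_limit_le (q := fun k h => dy tau k / h * rip (U (dy tau k) (g k) - U (dy tau k + h) (g k)) y)
    (l := fun k => dy tau k * rip (B (dy tau k) (g k)) y)).
  by move=> k e e0; exact: damped_quotient_limit.
move=> h h0.
apply: le_trans (sumD_half (dyadic_square_function US' tau0 c0 Ua' y n h0) (lexx (\sum_(k < n) rnorm (g k) ^+ 2))).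
apply: ler_sum => k _.
have d0 := ltW (dgt k); have dh : 0 <= dy tau k + h by rewrite addr_ge0// ltW.
by rewrite ripBl /U !SS'// -ripBr ripC; exact: rip_AMGM.
Qed.

Let GB s x : G s x = (expR (w * s))%:C *: B s x - w%:C *: S s x.
Proof.
by rewrite /B /damped_gen scalerA -rmorphM -expRD addrN expR0 scale1r addrK.
Qed.

Let e1 := expR (w * tau).

Let e1k k : expR (w * dy tau k) <= e1.
Proof. by rewrite ler_expR; apply: ler_wpM2l; [exact: as_w SG|exact: dy_le]. Qed.

(** Removing the damping costs a bounded factor and a term [w S t x], which is harmless because the
    squares of the dyadic times are summable. *)
Lemma dyadic_upper : exists2 K : R, 0 <= K & forall n x,
  \sum_(k < n) dy tau k ^+ 2 * rnorm (G (dy tau k) x) ^+ 2 <= K * rnorm x ^+ 2.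
Proof.
have [K K0 [KB _]] := damped_dyadic.
exists (2 * e1 ^+ 2 * K + 2 * (w * e1) ^+ 2 * (2 * tau ^+ 2)).
  apply: addr_ge0; first by apply: mulr_ge0 => //; rewrite mulr_ge0// sqr_ge0.
  by apply: mulr_ge0; rewrite mulr_ge0// sqr_ge0.
move=> n x.
pose a k := 2 * e1 ^+ 2 * (dy tau k ^+ 2 * rnorm (B (dy tau k) x) ^+ 2).
pose b k := 2 * (w * e1) ^+ 2 * rnorm x ^+ 2 * dy tau k ^+ 2.
have ab k : dy tau k ^+ 2 * rnorm (G (dy tau k) x) ^+ 2 <= a k + b k.
  have h : rnorm (G (dy tau k) x) <= e1 * rnorm (B (dy tau k) x) + w * e1 * rnorm x.
    rewrite GB; apply: le_trans (rnormBD _ _) _.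
    rewrite [rnorm (_ *: B _ _)]rnormZr [rnorm (_ *: S _ _)]rnormZr.
    rewrite gtr0_norm ?expR_gt0// ger0_norm ?(as_w SG)//; apply: lerD.
      by apply: ler_wpM2r; [exact: rnorm_ge0|exact: e1k].
    rewrite -mulrA; apply: ler_wpM2l; first exact: as_w SG.
    apply: le_trans (as_le SG _ (ltW (dgt k))) _.
    by apply: ler_wpM2r; [exact: rnorm_ge0|exact: e1k].
  have h2 : rnorm (G (dy tau k) x) ^+ 2 <=
      2 * (e1 * rnorm (B (dy tau k) x)) ^+ 2 + 2 * (w * e1 * rnorm x) ^+ 2.
    apply: (@le_trans _ _ ((e1 * rnorm (B (dy tau k) x) + w * e1 * rnorm x) ^+ 2)).
      by apply: lerXn2r => //; rewrite nnegrE ?rnorm_ge0//; apply: le_trans (rnorm_ge0 _) h.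
    by have := sqr_ge0 (e1 * rnorm (B (dy tau k) x) - w * e1 * rnorm x); lra.
  have := ler_wpM2l (sqr_ge0 (dy tau k)) h2.
  by rewrite /a /b; lra.
apply: (@le_trans _ _ (\sum_(k < n) (a k + b k))); first by apply: ler_sum => k _; exact: ab.
rewrite big_split/= /a /b -!big_distrr/= [leRHS]mulrDl; apply: lerD.
  by rewrite -[leRHS]mulrA; apply: ler_wpM2l; [rewrite mulr_ge0// sqr_ge0|exact: KB].
rewrite [leRHS]mulrAC; apply: ler_wpM2l; last exact: sum_dy_sqr.
by rewrite mulr_ge0 ?sqr_ge0// mulr_ge0// sqr_ge0.
Qed.

(** The parameter [eta] comes from replacing [g] by [eta^-1 g]; a small one will allow [|y|^2] to be
    absorbed in the lower estimate. *)
Lemma dyadic_dual : exists2 K : R, 0 <= K & forall (eta : R) n (g : nat -> H) y, 0 < eta ->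
  \sum_(k < n) dy tau k * rip (G (dy tau k) (g k)) y
    <= K * (eta * rnorm y ^+ 2 + eta^-1 * \sum_(k < n) rnorm (g k) ^+ 2).
Proof.
have [K K0 [_ KB]] := damped_dyadic.
have w0 := as_w SG.
pose L := K + (w * e1) ^+ 2 * (2 * tau ^+ 2) + e1 ^+ 2 + 1.
have sq (r : R) := sqr_ge0 r.
have L0 : 0 <= L by rewrite /L !addr_ge0// mulr_ge0// mulr_ge0.
have main n (g : nat -> H) y : \sum_(k < n) dy tau k * rip (G (dy tau k) (g k)) y
    <= L * (rnorm y ^+ 2 + \sum_(k < n) rnorm (g k) ^+ 2).
  pose g' k := (expR (w * dy tau k))%:C *: g k.
  have Bl k : (expR (w * dy tau k))%:C *: B (dy tau k) (g k) = B (dy tau k) (g' k).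
    rewrite /B /damped_gen /g' (linearZ_LR (G _)) (linearZ_LR (S _)).
    by apply: rip_inj => v; rewrite !(ripDl, ripZl); ring.
  have E k : dy tau k * rip (G (dy tau k) (g k)) y =
     dy tau k * rip (B (dy tau k) (g' k)) y +
     (- w * dy tau k) * rip (S (dy tau k) (g k)) y.
    by rewrite GB ripBl Bl ripZl; ring.
  under eq_bigr do rewrite E.
  rewrite big_split/=.
  have h1 := KB n g' y.
  have h2 : \sum_(k < n) rnorm (g' k) ^+ 2 <= e1 ^+ 2 * \sum_(k < n) rnorm (g k) ^+ 2.
    rewrite big_distrr/=; apply: ler_sum => k _.
    rewrite rnormZr gtr0_norm ?expR_gt0// exprMn; apply: ler_wpM2r => //.
    by apply: lerXn2r; rewrite ?nnegrE ?expR_ge0.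
  have h3 : \sum_(k < n) (- w * dy tau k) * rip (S (dy tau k) (g k)) y <=
     2^-1 * ((w * e1) ^+ 2 * (2 * tau ^+ 2) * rnorm y ^+ 2 + \sum_(k < n) rnorm (g k) ^+ 2).
    have h4 : \sum_(k < n) (w * e1) ^+ 2 * rnorm y ^+ 2 * dy tau k ^+ 2 <=
        (w * e1) ^+ 2 * (2 * tau ^+ 2) * rnorm y ^+ 2.
      rewrite -big_distrr/= [leRHS]mulrAC; apply: ler_wpM2l; first by rewrite mulr_ge0.
      exact: sum_dy_sqr.
    apply: le_trans (sumD_half h4 (lexx (\sum_(k < n) rnorm (g k) ^+ 2))).
    apply: ler_sum => k _.
    have Sg : rnorm (S (dy tau k) (g k)) <= e1 * rnorm (g k).
      apply: le_trans (as_le SG _ (ltW (dgt k))) _.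
      by apply: ler_wpM2r; [exact: rnorm_ge0|exact: e1k].
    have := rip_abs (S (dy tau k) (g k)) y; rewrite ler_norml => /andP[h5 _].
    have h6 : rnorm (S (dy tau k) (g k)) * rnorm y <= e1 * rnorm (g k) * rnorm y.
      by apply: ler_wpM2r => //; exact: rnorm_ge0.
    have h7 : (w * dy tau k) * - rip (S (dy tau k) (g k)) y <=
       (w * dy tau k) * (e1 * rnorm (g k) * rnorm y).
      apply: ler_wpM2l; first by rewrite mulr_ge0// ltW.
      by move: h5 h6; lra.
    have := sq (w * e1 * rnorm y * dy tau k - rnorm (g k)).
    by move: h7; lra.
  have g0 : 0 <= \sum_(k < n) rnorm (g k) ^+ 2 by apply: sumr_ge0 => k _.
  have y0 := sq (rnorm y).
  have e0 := sq e1; have we0 : 0 <= (w * e1) ^+ 2 * tau ^+ 2 by exact: mulr_ge0.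
  have p1 := mulr_ge0 K0 y0; have p2 := mulr_ge0 K0 g0.
  have p3 := mulr_ge0 we0 y0; have p4 := mulr_ge0 we0 g0.
  have p5 := mulr_ge0 e0 y0; have p6 := mulr_ge0 e0 g0.
  rewrite /L; move: ((w * e1) ^+ 2) (e1 ^+ 2) (tau ^+ 2) (rnorm y ^+ 2) h1 h2 h3 g0 p1 p2 p3 p4 p5 p6 y0.
  move: (\sum_(k < n) rnorm (g k) ^+ 2) (\sum_(k < n) rnorm (g' k) ^+ 2).
  move=> Sg Sg' we2 e2 t2 y2 h1 h2 h3 g0 p1 p2 p3 p4 p5 p6 y0.
  apply: le_trans (lerD h1 h3) _; lra.
exists L => // eta n g y eta0.
have := main n (fun k => (eta^-1)%:C *: g k) y.
have -> : \sum_(k < n) dy tau k * rip (G (dy tau k) ((eta^-1)%:C *: g k)) y =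
    eta^-1 * \sum_(k < n) dy tau k * rip (G (dy tau k) (g k)) y.
  by rewrite big_distrr/=; apply: eq_bigr => k _; rewrite linearZ_LR ripZl mulrCA.
have -> : \sum_(k < n) rnorm ((eta^-1)%:C *: g k) ^+ 2 =
    eta^-1 ^+ 2 * \sum_(k < n) rnorm (g k) ^+ 2.
  by rewrite big_distrr/=; apply: eq_bigr => k _; rewrite rnormZr_sqr.
rewrite ler_pdivrMl// => /le_trans; apply; rewrite mulrCA; apply: ler_wpM2l => //.
by rewrite mulrDr expr2 !mulrA divff ?gt_eqF// mul1r.
Qed.

End fixed.
End dyadic.

(** * The lower square function estimate *)

Section lower.
Context (R : realType) (H : hilbertType R).
Implicit Types (x y z : H) (S G : R -> {linear H -> H}) (s t w tau : R).

Lemma as_S_small S G w x : analytic_semigroup S G w -> forall e : R, 0 < e ->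
  exists2 d : R, 0 < d & forall t, 0 < t -> t < d -> rnorm (S t x - x) <= e.
Proof.
move=> SG e e0; have /cvg_rnormP/(_ _ e0) := @as_cvg0 _ _ _ _ _ SG x.
rewrite near_withinE => /nbhs_ballP[d /= d0 hd]; exists d => // t t0 td.
by apply/ltW/hd => //; rewrite /ball/= sub0r normrN gtr0_norm.
Qed.

(** The operators [t G t] are uniformly bounded for small [t] and tend to 0 on the vectors [S ep x],
    which approximate [x]. *)
Lemma as_tG_small S G w x : analytic_semigroup S G w -> forall e : R, 0 < e ->
  exists2 d : R, 0 < d & forall t, 0 < t -> t < d -> t * rnorm (G t x) <= e.
Proof.
move=> SG e e0; have [C C0 GC] := as_bound SG 1; have w0 := as_w SG.
have q0 : 0 < 2 * (C + 1) by rewrite mulr_gt0// ltr_wpDl.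
have [d1 d10 h1] := as_S_small x SG (divr_gt0 e0 q0).
pose ep := d1 / 2; have ep0 : 0 < ep by rewrite divr_gt0.
have epd : ep < d1 by rewrite ltr_pdivrMr// ltr_pMr// ltr1n.
pose p := 2 * (expR w * rnorm (G ep x) + 1).
have p0 : 0 < p by rewrite mulr_gt0// ltr_wpDl// mulr_ge0 ?expR_ge0 ?rnorm_ge0.
exists (Num.min 1 (e / p)); first by rewrite lt_min ltr01 divr_gt0.
move=> t t0; rewrite lt_min => /andP[t1 te].
have t1' : 0 < t <= 1 by rewrite t0 ltW.
have h2 := GC t (x - S ep x) t1'.
have h3 : t * rnorm (G t (x - S ep x)) <= C * rnorm (x - S ep x).
  apply: le_trans (ler_wpM2l (ltW t0) h2) _.
  by rewrite mulrA mulrCA divff ?mulr1// gt_eqF.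
have h4 : C * rnorm (x - S ep x) <= e / 2.
  have := h1 _ ep0 epd; rewrite rnormB => h5.
  apply: le_trans (ler_wpM2l C0 h5) _.
  have -> : C * (e / (2 * (C + 1))) = e / 2 * (C / (C + 1)).
    by field; rewrite gt_eqF// ltr_wpDl.
  by apply: ler_piMr; rewrite ?divr_ge0// ?ler_pdivrMr ?mul1r ?lerDl// ?ltr_wpDl// ltW.
have h6 : t * rnorm (S t (G ep x)) <= e / 2.
  have : rnorm (S t (G ep x)) <= expR w * rnorm (G ep x).
    apply: le_trans (as_le SG _ (ltW t0)) _; apply: ler_wpM2r; first exact: rnorm_ge0.
    by rewrite ler_expR; apply: ler_piMr => //; exact: ltW.
  move=> /(ler_wpM2l (ltW t0))/le_trans; apply.
  apply: (@le_trans _ _ (t * (p / 2))).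
    by rewrite /p mulrAC divff ?mul1r ?ler_pM2l ?lerDl// pnatr_eq0.
  by rewrite mulrA ler_pM2r// -ler_pdivlMr// ltW.
have -> : G t x = G t (x - S ep x) + S t (G ep x).
  have -> : S t (G ep x) = G t (S ep x).
    rewrite -(as_GDl SG) ?(ltW t0)// addrC (as_GDr SG)//; exact: ltW.
  by rewrite linearB subrK.
apply: le_trans (ler_wpM2l (ltW t0) (rnormD _ _)) _.
by rewrite mulrDr; move: h3 h4 h6; clear; lra.
Qed.

(* [phi t = rip (S t x) x + t rip (G t x) x] tends to [|x|^2] at 0 and has the
   derivative [- t rip (A^2 S t x) x]; its dyadic increments are bounded by
   duality, using the square function of the adjoint semigroup. *)
Lemma dyadic_lower S G w tau : analytic_semigroup S G w -> 0 < tau ->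
  exists2 K : R, 0 <= K & forall x Q,
    (forall n, \sum_(k < n) dy tau k ^+ 2 * rnorm (G (dy tau k) x) ^+ 2 <= Q) ->
    rnorm x ^+ 2 <= K * (Q + rnorm (S tau x) ^+ 2).
Proof.
move=> SG tau0; have w0 := as_w SG.
have [C C0 GC] := as_bound SG tau.
have [L L0 GL] := dyadic_dual SG tau0.
pose M := expR (w * tau).
have M1 : 1 <= M by rewrite -[leLHS]expR0 ler_expR mulr_ge0// ltW.
have M0 : 0 <= M by exact: expR_ge0.
have SM t x : 0 <= t -> t <= tau -> rnorm (S t x) <= M * rnorm x.
  move=> t0 tt; apply: le_trans (as_le SG _ t0) _; apply: ler_wpM2r; first exact: rnorm_ge0.
  by rewrite ler_expR; apply: ler_wpM2l.
pose M2 := M + 2 * C.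
pose q := L + M2 + 1.
have M20 : 0 <= M2 by rewrite addr_ge0// mulr_ge0.
have q0 : 0 < q by rewrite ltr_wpDl// addr_ge0.
(* Chosen so that all terms in [|x|^2] on the right add up to at most half of [|x|^2]. *)
pose eta := (2 * q)^-1; have eta0 : 0 < eta by rewrite invr_gt0 mulr_gt0.
pose K := 2 * (L * (eta^-1 * (64 * M ^+ 4)) + M2 * eta^-1).
have ei0 : 0 <= eta^-1 by rewrite invr_ge0 ltW.
have K10 : 0 <= L * (eta^-1 * (64 * M ^+ 4)) by rewrite !mulr_ge0// exprn_ge0.
have K20 : 0 <= M2 * eta^-1 by rewrite mulr_ge0.
have K0 : 0 <= K by rewrite mulr_ge0// addr_ge0.
exists K => // x Q hQ.
pose s k := dy tau k; have sgt k : 0 < s k by exact: dy_gt0.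
have st k : s k <= tau by exact: dy_le.
pose phi t := rip (S t x) x + t * rip (G t x) x.
have dphi t : 0 < t -> is_derive t 1 phi (- (t * rip (G (t / 2) (G (t / 2) x)) x)).
  move=> t0; have d1 := vderive_rip x (as_vderive x SG t0).
  have d2 := vderive_rip x (as_Gderive x SG t0).
  apply: (is_derive_eq (is_deriveD d1 (is_deriveM (is_derive_id t 1) d2))).
  by rewrite /GRing.scale /= !ripNl; ring.
(* Sampling [phi] at twice the dyadic times gives [c / 2 >= s k.+1] for the intermediate time [c],
   so a factor [G (s k.+1)] splits off. As [c <= 4 s k.+1], the factor [2 c] in [g] yields 64 after
   squaring; two semigroup bounds [M] yield [M^4]. *)
have step k : exists g, phi (2 * s k.+1) - phi (2 * s k) = s k.+1 * rip (G (s k.+1) g) x /\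
    rnorm g ^+ 2 <= 64 * M ^+ 4 * (s k.+1 ^+ 2 * rnorm (G (s k.+1) x) ^+ 2).
  have ss : 2 * s k.+1 <= 2 * s k by rewrite -(dyS tau k) [leRHS]mulr_natl mulr2n lerDl ltW.
  have sE : s k = 2 * s k.+1 by exact: dyS.
  have s20 : 0 < 2 * s k.+1 by rewrite mulr_gt0.
  have [|c /andP[c1 c2] E] := @MVT_le R phi (fun t => - (t * rip (G (t / 2) (G (t / 2) x)) x)) _ _ ss.
    by move=> t /andP[t1 _]; apply: dphi; exact: lt_le_trans t1.
  have c0 : 0 < c by exact: lt_le_trans c1.
  have c21 : s k.+1 <= c / 2 by rewrite ler_pdivlMr// mulrC.
  have c22 : c / 2 <= s k by rewrite ler_pdivrMr// mulrC.
  have d0 : 0 <= c / 2 - s k.+1 by rewrite subr_ge0.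
  have dt : c / 2 - s k.+1 <= tau.
    by apply: le_trans (st k); have := sgt k.+1; move: c22; clear; lra.
  pose g0 := S (c / 2 - s k.+1) (G (c / 2) x).
  have Gg : G (c / 2) (G (c / 2) x) = G (s k.+1) g0.
    by rewrite -(as_GDr SG)// subrK.
  have g0b : rnorm g0 <= M * (M * rnorm (G (s k.+1) x)).
    apply: le_trans (SM _ _ d0 dt) _; apply: ler_wpM2l => //.
    have -> : G (c / 2) x = S (c / 2 - s k.+1) (G (s k.+1) x).
      by rewrite -(as_GDl SG)// subrK.
    exact: SM.
  exists ((2 * c)%:C *: g0); split.
    rewrite linearZ_LR ripZl -Gg.
    have := E; rewrite sE; clear; lra.
  rewrite rnormZr_sqr.
  have h1 : (2 * c) ^+ 2 <= 64 * s k.+1 ^+ 2.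
    have -> : 64 * s k.+1 ^+ 2 = (8 * s k.+1) ^+ 2 by ring.
    apply: lerXn2r; [by rewrite nnegrE mulr_ge0// ltW|by rewrite nnegrE mulr_ge0// ltW|].
    by move: c2; rewrite sE; clear; lra.
  have h2 : rnorm g0 ^+ 2 <= M ^+ 4 * rnorm (G (s k.+1) x) ^+ 2.
    have -> : M ^+ 4 * rnorm (G (s k.+1) x) ^+ 2 = (M * (M * rnorm (G (s k.+1) x))) ^+ 2 by ring.
    by apply: lerXn2r; rewrite ?nnegrE ?mulr_ge0 ?rnorm_ge0.
  have -> : 64 * M ^+ 4 * (s k.+1 ^+ 2 * rnorm (G (s k.+1) x) ^+ 2) =
     64 * s k.+1 ^+ 2 * (M ^+ 4 * rnorm (G (s k.+1) x) ^+ 2) by ring.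
  by apply: ler_pM => //; exact: sqr_ge0.
have /choice[g gP] := step.
(* Shifted so that [g' k] is paired with [G (s k)]; the term of index 0 is empty. *)
pose g' k := if k is k.+1 then g k else 0.
have tele n : phi (2 * s n) - phi (2 * s 0) = \sum_(k < n.+1) s k * rip (G (s k) (g' k)) x.
  elim: n => [|n ih].
    by rewrite subrr big_ord_recr big_ord0 /= linear0 rip0l mulr0 addr0.
  rewrite big_ord_recr/= -ih; have [<- _] := gP n.
  by clear; lra.
have gQ n : \sum_(k < n.+1) rnorm (g' k) ^+ 2 <= 64 * M ^+ 4 * Q.
  have MM0 : 0 <= 64 * M ^+ 4 by rewrite mulr_ge0// exprn_ge0.
  apply: le_trans (ler_wpM2l MM0 (hQ n.+1)).
  rewrite big_distrr/=; apply: ler_sum => -[[|k] kn] _ /=.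
    by rewrite rnorm0 expr0n; apply: mulr_ge0 => //; apply: mulr_ge0; exact: sqr_ge0.
  by have [_] := gP k.
have nx0 := sqr_ge0 (rnorm x).
have up n : phi (2 * s n) - phi (2 * tau) <=
    L * (eta * rnorm x ^+ 2 + eta^-1 * (64 * M ^+ 4 * Q)).
  rewrite -[X in _ - phi (2 * X)](dy0 tau) tele; apply: le_trans (GL eta _ g' x eta0) _.
  by apply: ler_wpM2l => //; rewrite lerD2l; exact: ler_wpM2l.
(* At time [2 tau] a factor [S tau] splits off from both terms of [phi], so the endpoint is
   controlled by [S tau x]. *)
have top : phi (2 * tau) <= M2 * (eta * rnorm x ^+ 2 + eta^-1 * rnorm (S tau x) ^+ 2).
  have tau0' := ltW tau0.
  have e1 : S (2 * tau) x = S tau (S tau x) by rewrite -(as_D SG)// mulr_natl mulr2n.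
  have e2 : G (2 * tau) x = G tau (S tau x) by rewrite -(as_GDr SG)// mulr_natl mulr2n.
  have h1 : rip (S (2 * tau) x) x <= M * rnorm (S tau x) * rnorm x.
    rewrite e1; apply: le_trans (rip_le _ _) _.
    by apply: ler_wpM2r; [exact: rnorm_ge0|exact: SM].
  have h2 : 2 * tau * rip (G (2 * tau) x) x <= 2 * C * (rnorm (S tau x) * rnorm x).
    have : rip (G (2 * tau) x) x <= C / tau * rnorm (S tau x) * rnorm x.
      rewrite e2; apply: le_trans (rip_le _ _) _.
      by apply: ler_wpM2r; [exact: rnorm_ge0|apply: GC; rewrite tau0/=].
    have t20 : 0 <= 2 * tau by rewrite mulr_ge0.
    move=> /(ler_wpM2l t20)/le_trans; apply.
    by apply: eq_ler; field; rewrite gt_eqF.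
  have h3 : rnorm (S tau x) * rnorm x <= eta * rnorm x ^+ 2 + eta^-1 * rnorm (S tau x) ^+ 2.
    have := mulr_ge0 ei0 (sqr_ge0 (eta * rnorm x - rnorm (S tau x))).
    have -> : eta^-1 * (eta * rnorm x - rnorm (S tau x)) ^+ 2 = eta * rnorm x ^+ 2
       - 2 * (rnorm (S tau x) * rnorm x) + eta^-1 * rnorm (S tau x) ^+ 2.
      by field; rewrite gt_eqF.
    by have := mulr_ge0 (rnorm_ge0 (S tau x)) (rnorm_ge0 x); clear; lra.
  rewrite /phi; have := ler_wpM2l M20 h3; rewrite {1}/M2; move: h1 h2; clear; lra.
have lim : rnorm x ^+ 2 <= phi (2 * tau) + L * (eta * rnorm x ^+ 2 + eta^-1 * (64 * M ^+ 4 * Q)).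
  apply/ler_addgt0Pr => e e0.
  pose r := 2 * (rnorm x + 1); have r0 : 0 < r by rewrite mulr_gt0// ltr_wpDl// rnorm_ge0.
  have er : 0 < e / r by rewrite divr_gt0.
  have [d1 d10 h1] := as_S_small x SG er; have [d2 d20 h2] := as_tG_small x SG er.
  have [n nd] : exists n, 2 * s n < Num.min d1 d2.
    have m0 : 0 < Num.min d1 d2 by rewrite lt_min d10.
    have [n nd] : exists n : nat, 2 * tau / Num.min d1 d2 < n.+1%:R.
      by exists (Num.truncn (2 * tau / Num.min d1 d2)); rewrite truncnS_gt.
    exists n.+1; rewrite mulrA ltr_pdivrMr ?exprn_gt0// -ltr_pdivrMl//.
    rewrite mulrC; apply: lt_trans nd _; rewrite -natrX ltr_nat.
    exact: ltn_expl.
  move: nd; rewrite lt_min => /andP[nd1 nd2].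
  have t0 : 0 < 2 * s n by rewrite mulr_gt0.
  have {}h1 := h1 _ t0 nd1; have {}h2 := h2 _ t0 nd2.
  have x0 := rnorm_ge0 x.
  have a1 : - rip (S (2 * s n) x - x) x <= e / r * rnorm x.
    rewrite -ripNl; apply: le_trans (rip_le _ _) _; rewrite rnormN.
    exact: ler_wpM2r.
  have a2 : - (2 * s n * rip (G (2 * s n) x) x) <= e / r * rnorm x.
    rewrite -mulrN -ripNl; apply: le_trans (ler_wpM2l (ltW t0) (rip_le _ _)) _.
    by rewrite rnormN mulrA; exact: ler_wpM2r.
  have a3 : e / r * rnorm x <= e / 2.
    rewrite mulrAC ler_pdivrMr// /r -mulrA ler_pM2l//.
    by clear; lra.
  have := up n; rewrite {1}/phi; move: a1; rewrite ripBl rip_xx.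
  move: a2 a3; clear; lra.
have qe : eta * q = 2^-1 by rewrite /eta invfM -mulrA mulVf ?mulr1// gt_eqF.
have e1 : eta * (L + M2) * rnorm x ^+ 2 <= 2^-1 * rnorm x ^+ 2.
  by rewrite ler_wpM2r// -qe ler_pM2l// /q lerDl.
have S0 := sqr_ge0 (rnorm (S tau x)).
have Q0 : 0 <= Q by have := hQ 0; rewrite big_ord0.
have p1 := mulr_ge0 K10 S0; have p2 := mulr_ge0 K20 Q0.
move: lim top e1 p1 p2; rewrite /K.
clear; lra.
Qed.

End lower.

(** * Integrals near 0 *)

Section dyadic_integrals.
Context (R : realType).
Implicit Types (f g : R -> R) (b : nat -> R) (tau : R).

Notation mu := (@lebesgue_measure R).

Definition cont_pos f : Prop := forall t : R, 0 < t -> {for t, continuous f}.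

Definition integrable0 tau f : Prop := mu.-integrable `]0, tau] (EFin \o f).

Definition integral0 tau f : R := \int[mu]_(t in `]0, tau]) f t.

Lemma cont_pos_measurable f tau a : 0 <= a -> cont_pos f ->
  measurable_fun `]a, tau] f.
Proof.
move=> a0 cf; apply: measurable_realfun.subspace_continuous_measurable_fun; first exact: measurable_itv.
apply: continuous_in_subspaceT => t; rewrite inE/= in_itv/= => /andP[ta _].
by apply: cf; exact: le_lt_trans ta.
Qed.

(** These intervals tile []0, tau]]. The k-th has length [dy tau k.+1], hence the shifted weights in
    the comparisons below. *)
Definition dyI tau (k : nat) : set R := `]dy tau k.+1, dy tau k]%classic.

Lemma dy_lt tau k : 0 < tau -> dy tau k.+1 < dy tau k.
Proof. by move=> t0; rewrite (dyS tau k) ltr_pMl ?dy_gt0// ltr1n. Qed.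

Lemma dy_small tau (e : R) : 0 < tau -> 0 < e -> exists n, dy tau n < e.
Proof.
move=> t0 e0.
have [n nd] : exists n : nat, tau / e < n.+1%:R.
  by exists (Num.truncn (tau / e)); rewrite truncnS_gt.
exists n.+1; rewrite ltr_pdivrMr ?exprn_gt0// -ltr_pdivrMl//.
by rewrite mulrC; apply: lt_trans nd _; rewrite -natrX ltr_nat; exact: ltn_expl.
Qed.

Lemma dy_mono tau m n : 0 < tau -> (m <= n)%N -> dy tau n <= dy tau m.
Proof.
move=> t0; elim: n => [|n ih]; first by rewrite leqn0 => /eqP->.
rewrite leq_eqVlt => /orP[/eqP->//|]; rewrite ltnS => /ih; apply: le_trans.
exact/ltW/dy_lt.
Qed.

Lemma bigcup_dyI tau : 0 < tau -> \bigcup_k dyI tau k = `]0, tau]%classic.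
Proof.
move=> t0; apply/seteqP; split => [t [k _]|t] /=; rewrite /dyI /= !in_itv/= => /andP[t1 t2].
  by rewrite (lt_trans (dy_gt0 k.+1 t0) t1) (le_trans t2 (dy_le k t0)).
have ex : exists n, dy tau n < t by exact: dy_small.
have t0' : ~~ (dy tau 0 < t) by rewrite dy0 -leNgt.
case: (ex_minnP ex) => -[|n] nt nmin; first by rewrite nt in t0'.
exists n => //=; rewrite in_itv/= nt/= leNgt; apply/negP => h.
by have := nmin _ h; rewrite ltnn.
Qed.

Lemma trivIset_dyI tau : 0 < tau -> trivIset setT (dyI tau).
Proof.
move=> t0; apply/trivIsetP => i j _ _.
wlog : i j / (i < j)%N.
  move=> hw ij; have [h|h|h] := ltngtP i j; [exact: hw| |by rewrite h eqxx in ij].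
  by rewrite setIC; apply: hw => //; rewrite eq_sym.
move=> ij _; apply/seteqP; split=> // t [] /=; rewrite /dyI /= !in_itv/= => /andP[t1 _] /andP[_ t2].
have := lt_le_trans t1 t2; rewrite ltNge => /negP; apply; exact: dy_mono.
Qed.

Lemma measure_dyI tau k : 0 < tau -> mu (dyI tau k) = (dy tau k.+1)%:E.
Proof.
move=> t0; rewrite /dyI lebesgue_measure_itv/= lte_fin dy_lt//.
by rewrite -EFinD (dyS tau k); congr (_%:E); ring.
Qed.

Lemma measurable_dyI tau k : measurable (dyI tau k).
Proof. exact: measurable_itv. Qed.

Lemma ge0_integral_dyI tau f : 0 < tau -> cont_pos f ->
  (forall t, 0 < t -> 0 <= f t) ->
  (\int[mu]_(t in `]0%R, tau]) (f t)%:E = \sum_(k <oo) \int[mu]_(t in dyI tau k) (f t)%:E)%E.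
Proof.
move=> t0 cf f0; rewrite -bigcup_dyI//; apply: ge0_integral_bigcup.
- by move=> k; exact: measurable_dyI.
- by rewrite bigcup_dyI//; apply/measurable_EFinP; exact: cont_pos_measurable.
- by rewrite bigcup_dyI// => t /=; rewrite in_itv/= => /andP[tt _]; rewrite lee_fin f0.
- exact: trivIset_dyI.
Qed.

Lemma cont_pos_norm f : cont_pos f -> cont_pos (fun t => `|f t|).
Proof. by move=> cf t t0; apply: continuous_comp; [exact: cf|exact: norm_continuous]. Qed.

Lemma dyI_gt0 tau k t : 0 < tau -> dyI tau k t -> 0 < t.
Proof.
by move=> t0; rewrite /dyI/= in_itv/= => /andP[h _]; apply: lt_trans h; exact: dy_gt0.
Qed.

Lemma measurable_fun_dyI tau k f : 0 < tau -> cont_pos f ->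
  measurable_fun (dyI tau k) (EFin \o f).
Proof.
by move=> t0 cf; apply/measurable_EFinP; apply: cont_pos_measurable => //; exact/ltW/dy_gt0.
Qed.

Lemma dyadic_integrable tau f b (B : R) : 0 < tau -> cont_pos f ->
  (forall k t, dy tau k.+1 < t <= dy tau k -> `|f t| <= b k) ->
  (forall n, \sum_(k < n) dy tau k.+1 * b k <= B) ->
  integrable0 tau f /\ `|integral0 tau f| <= B.
Proof.
move=> t0 cf fb bB.
have b0 k : 0 <= b k.
  apply: le_trans (fb k (dy tau k) _); first exact: normr_ge0.
  by rewrite dy_lt//=.
have key : (\int[mu]_(t in `]0%R, tau]) `|f t|%:E <= B%:E)%E.
  rewrite ge0_integral_dyI//; last exact: cont_pos_norm.
  apply: lime_le.
    by apply: is_cvg_nneseries => k _ _; apply: integral_ge0 => t _; rewrite lee_fin.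
  apply: nearW => n; apply: (@le_trans _ _ (\sum_(0 <= k < n) (dy tau k.+1 * b k)%:E)%E).
    apply: lee_sum => k _; rewrite EFinM -measure_dyI// muleC -integral_cst; last exact: measurable_dyI.
    apply: ge0_le_integral => //.
    - exact: measurable_dyI.
    - by apply: measurable_fun_dyI => //; exact: cont_pos_norm.
    - move=> t; rewrite /dyI/= in_itv/= => /fb; by rewrite lee_fin.
  by rewrite sumEFin lee_fin big_mkord.
have fi : integrable0 tau f.
  apply/integrableP; split.
    by apply/measurable_EFinP; exact: cont_pos_measurable.
  by apply: le_lt_trans key _; exact: ltry.
split=> //; rewrite -lee_fin /integral0 EFin_normr_Rintegral//; apply: le_trans key.
apply: le_abse_integral => //.
by apply/measurable_EFinP; exact: cont_pos_measurable.
Qed.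

Lemma dyadic_integral_ge tau f b : 0 < tau -> cont_pos f -> integrable0 tau f ->
  (forall t, 0 < t -> 0 <= f t) -> (forall k, 0 <= b k) ->
  (forall k t, dy tau k.+1 < t <= dy tau k -> b k <= f t) ->
  forall n, \sum_(k < n) dy tau k.+1 * b k <= integral0 tau f.
Proof.
move=> t0 cf fi f0 b0 bf n.
have fin : (\int[mu]_(t in `]0%R, tau]) (f t)%:E \is a fin_num)%E.
  by apply: integrable_fin_num => //; exact: measurable_itv.
rewrite -lee_fin /integral0 /Rintegral fineK// ge0_integral_dyI//.
apply: (@le_trans _ _ (\sum_(0 <= k < n) \int[mu]_(t in dyI tau k) (f t)%:E)%E).
  rewrite -sumEFin big_mkord; apply: lee_sum => k _.
  rewrite EFinM -measure_dyI// muleC -integral_cst; last exact: measurable_dyI.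
  apply: ge0_le_integral => //.
  - exact: measurable_dyI.
  - by move=> t _; rewrite lee_fin.
  - exact: measurable_fun_dyI.
  - move=> t; rewrite /dyI/= in_itv/= => /bf; by rewrite lee_fin.
apply: nneseries_lim_ge => k _ _; apply: integral_ge0 => t tk.
by rewrite lee_fin f0// (dyI_gt0 t0 tk).
Qed.

Lemma integrable_itv_cc tau f : integrable0 tau f -> mu.-integrable `[0, tau] (EFin \o f).
Proof.
move=> /integrableP[mf fi]; apply/integrableP; split.
  by apply/emeasurable_fun_itv_obnd_cbndP.
rewrite -integral_itv_obnd_cbnd//; exact: measurableT_comp.
Qed.

(** The fundamental theorem on [[x, tau]] with [x] tending to 0; the boundary term at [x] is dropped
    by its sign, so no limit of [psi] at 0 has to be identified. *)
Lemma primitive_integral_le tau (psi h : R -> R) : 0 < tau -> cont_pos h ->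
  integrable0 tau h -> (forall t, 0 < t -> 0 <= psi t) ->
  (forall t : R, 0 < t -> is_derive t 1 psi (h t)) ->
  integral0 tau h <= psi tau.
Proof.
move=> t0 ch hi psi0 dpsi; apply/ler_addgt0Pr => e e0.
have hcc := integrable_itv_cc hi.
have /cvgrPdist_lt/(_ e e0)/nbhs_ballP[d /= d0 hd] := parameterized_integral_cvg_left t0 hcc.
pose m := Num.min d tau; have m0 : 0 < m by rewrite lt_min d0.
pose x := m / 2; have x0 : 0 < x by rewrite divr_gt0.
have : x < m by rewrite ltr_pdivrMr// ltr_pMr// ltr1n.
rewrite lt_min => /andP[xd xt].
have := hd x; rewrite /ball/= sub0r normrN gtr0_norm// => /(_ xd).
rewrite sub0r normrN /parameterized_integral => hx.
have cw : {within `[x, tau], continuous h}.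
  apply: continuous_in_subspaceT => t; rewrite inE/= in_itv/= => /andP[tx _].
  by apply: ch; exact: lt_le_trans tx.
have pc (t : R) : 0 < t -> {for t, continuous psi}.
  move=> tt; apply/differentiable_continuous/derivable1_diffP.
  by have [] := dpsi t tt.
have F : (\int[mu]_(t in `[x, tau]) (h t)%:E = (psi tau)%:E - (psi x)%:E)%E.
  apply: continuous_FTC2 => //.
    split => [t|//|//].
    - by rewrite in_itv/= => /andP[tx _]; have [] := dpsi t (lt_trans x0 tx).
    - exact/cvg_at_right_filter/pc.
    - exact/cvg_at_left_filter/pc.
  move=> t; rewrite in_itv/= => /andP[tx _]; rewrite derive1E.
  by have [_] := dpsi t (lt_trans x0 tx).
have eqA : integral0 tau h - integral0 x h = psi tau - psi x.
  have x0' := ltW x0; have xt' := ltW xt.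
  rewrite /integral0 Rintegral_itvB ?bnd_simp//.
  rewrite (Rintegral_itv_obnd_cbnd (r := x)); first by rewrite /Rintegral F -EFinB.
  apply: integrableS hi; [exact: measurable_itv|exact: measurable_itv|].
  by apply: subset_itvr; rewrite bnd_simp ltW.
have hx0 : integral0 x h = \int[mu]_(t in `[0, x]) h t.
  rewrite /integral0 Rintegral_itv_obnd_cbnd//.
  apply: integrableS hi; [exact: measurable_itv|exact: measurable_itv|].
  by apply: subset_itvl; rewrite bnd_simp ltW.
have := psi0 x x0; have := ler_norm (\int[mu]_(t in `[0, x]) h t).
move: hx eqA; rewrite hx0; clear; lra.
Qed.

Lemma integral0D tau f g : integrable0 tau f -> integrable0 tau g ->
  integral0 tau (fun t => f t + g t) = integral0 tau f + integral0 tau g.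
Proof. by move=> fi gi; apply: RintegralD => //; exact: measurable_itv. Qed.

Lemma integral0Z tau f (r : R) : integrable0 tau f ->
  integral0 tau (fun t => r * f t) = r * integral0 tau f.
Proof. by move=> fi; apply: RintegralZl => //; exact: measurable_itv. Qed.

Lemma integrable0D tau f g : integrable0 tau f -> integrable0 tau g ->
  integrable0 tau (fun t => f t + g t).
Proof.
move=> fi gi; rewrite /integrable0.
have -> : EFin \o (fun t => f t + g t) = ((EFin \o f) \+ (EFin \o g))%E by apply/funext.
by apply: integrableD => //; exact: measurable_itv.
Qed.

Lemma integrable0Z tau f (r : R) : integrable0 tau f -> integrable0 tau (fun t => r * f t).
Proof.
move=> fi; rewrite /integrable0.
have -> : EFin \o (fun t => r * f t) = (fun t => r%:E * (EFin \o f) t)%E by apply/funext.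
by apply: integrableZl => //; exact: measurable_itv.
Qed.

Lemma eq_integral0 tau f g : (forall t, 0 < t -> f t = g t) ->
  integral0 tau f = integral0 tau g.
Proof.
move=> fg; apply: eq_Rintegral => t; rewrite inE/= in_itv/= => /andP[tt _].
exact: fg.
Qed.

Lemma integral0_ge0 tau f : (forall t, 0 < t -> 0 <= f t) -> 0 <= integral0 tau f.
Proof.
by move=> f0; apply: Rintegral_ge0 => t; rewrite /= in_itv/= => /andP[tt _]; exact: f0.
Qed.

End dyadic_integrals.

(** * The energy, the scalar product and the form *)

Section real_forms.
Context (R : realType) (H : hilbertType R).
Implicit Types (x y z u v : H) (S G : R -> {linear H -> H}) (s t w tau : R).

Definition vcts (F : R -> H) t : Prop := forall e : R, 0 < e -> exists2 d : R, 0 < d &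
  forall h : R, `|h| < d -> rnorm (F (t + h) - F t) <= e.

Lemma vcts_rip (F K : R -> H) t : vcts F t -> vcts K t ->
  {for t, continuous (fun s => rip (F s) (K s))}.
Proof.
move=> cF cK; apply/cvgrPdist_le => /= e e0.
pose a := 2 * (rnorm (K t) + 1); pose b := 2 * (rnorm (F t) + 1).
have a0 : 0 < a by rewrite mulr_gt0// ltr_wpDl// rnorm_ge0.
have b0 : 0 < b by rewrite mulr_gt0// ltr_wpDl// rnorm_ge0.
have [d1 d10 h1] := cF _ (divr_gt0 e0 a0).
have eb : 0 < Num.min 1 (e / b) by rewrite lt_min ltr01 divr_gt0.
have [d2 d20 h2] := cK _ eb.
apply/nbhs_ballP; exists (Num.min d1 d2); first by rewrite /= lt_min d10.
move=> s; rewrite /ball/= lt_min distrC => /andP[sd1 sd2].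
have -> : s = t + (s - t) by rewrite addrC subrK.
set h := s - t in sd1 sd2 *; have {}h1 := h1 _ sd1; have := h2 _ sd2.
rewrite le_min => /andP[h3 h4].
rewrite distrC.
have -> : rip (F (t + h)) (K (t + h)) - rip (F t) (K t) =
    rip (F (t + h) - F t) (K (t + h)) + rip (F t) (K (t + h) - K t).
  by rewrite ripBl ripBr; ring.
apply: le_trans (ler_normD _ _) _.
have K1 : rnorm (K (t + h)) <= rnorm (K t) + 1.
  rewrite -[K (t + h)](subrK (K t)); apply: le_trans (rnormD _ _) _.
  by rewrite addrC lerD2l.
have e1 : `|rip (F (t + h) - F t) (K (t + h))| <= e / 2.
  apply: le_trans (rip_abs _ _) _.
  apply: (@le_trans _ _ (e / a * (rnorm (K t) + 1))).
    by apply: ler_pM => //; exact: rnorm_ge0.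
  apply: eq_ler; rewrite /a; field.
  by rewrite gt_eqF// ltr_wpDl// rnorm_ge0.
have e2 : `|rip (F t) (K (t + h) - K t)| <= e / 2.
  apply: le_trans (rip_abs _ _) _.
  apply: (@le_trans _ _ ((rnorm (F t) + 1) * (e / b))).
    by apply: ler_pM => //; [exact: rnorm_ge0|exact: rnorm_ge0|rewrite lerDl].
  apply: eq_ler; rewrite /b; field.
  by rewrite gt_eqF// ltr_wpDl// rnorm_ge0.
by move: e1 e2; clear; lra.
Qed.

Lemma vderive_vcts F t F' : vderive F t F' -> vcts F t.
Proof.
move=> FF e e0; have [d d0 hd] := FF 1 ltr01.
have q0 : 0 < 1 + rnorm F' by rewrite ltr_pwDl// rnorm_ge0.
exists (Num.min d (e / (1 + rnorm F'))); first by rewrite lt_min d0 divr_gt0.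
move=> h; rewrite lt_min ltr_pdivlMr// => /andP[h1 h2].
rewrite -[F (t + h) - F t](subrK (h%:C *: F')); apply: le_trans (rnormD _ _) _.
have := hd h h1; rewrite rnormZr => h3; move: h2 h3; clear; lra.
Qed.

Lemma vderive_rip2 (F K : R -> H) t (F' K' : H) : vderive F t F' -> vderive K t K' ->
  is_derive t 1 (fun s => rip (F s) (K s)) (rip F' (K t) + rip (F t) K').
Proof.
move=> FF KK; apply: approx_is_derive => e e0.
have a0 : 0 < 3 * (rnorm (K t) + 1) by rewrite mulr_gt0// ltr_wpDl// rnorm_ge0.
have b0 : 0 < 3 * (rnorm (F t) + 1) by rewrite mulr_gt0// ltr_wpDl// rnorm_ge0.
have c0 : 0 < 3 * (rnorm F' + 1) by rewrite mulr_gt0// ltr_wpDl// rnorm_ge0.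
have [d1 d10 h1] := FF _ (divr_gt0 e0 a0).
have [d2 d20 h2] := KK _ (divr_gt0 e0 b0).
have ec : 0 < Num.min 1 (e / (3 * (rnorm F' + 1))) by rewrite lt_min ltr01 divr_gt0.
have [d3 d30 h3] := vderive_vcts KK ec.
exists (Num.min d1 (Num.min d2 d3)); first by rewrite !lt_min d10 d20.
move=> h; rewrite !lt_min => /and3P[hd1 hd2 hd3].
have := h3 h hd3; rewrite le_min => /andP[k1 k2].
have -> : rip (F (t + h)) (K (t + h)) - rip (F t) (K t) - h * (rip F' (K t) + rip (F t) K') =
    rip (F (t + h) - F t - h%:C *: F') (K (t + h)) +
    rip (F t) (K (t + h) - K t - h%:C *: K') + h * rip F' (K (t + h) - K t).
  by rewrite !(ripBl, ripBr, ripZl, ripZr); ring.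
apply: le_trans (ler_normD _ _) _; rewrite normrM.
have := ler_normD (rip (F (t + h) - F t - h%:C *: F') (K (t + h))) (rip (F t) (K (t + h) - K t - h%:C *: K')).
have kt : rnorm (K (t + h)) <= rnorm (K t) + 1.
  rewrite -[K (t + h)](subrK (K t)); apply: le_trans (rnormD _ _) _.
  by rewrite addrC lerD2l.
have e1 : `|rip (F (t + h) - F t - h%:C *: F') (K (t + h))| <= e * `|h| / 3.
  apply: le_trans (rip_abs _ _) _.
  apply: le_trans (ler_pM (rnorm_ge0 _) (rnorm_ge0 _) (h1 h hd1) kt) _.
  apply: eq_ler; field.
  by rewrite gt_eqF// ltr_wpDl// rnorm_ge0.
have e2 : `|rip (F t) (K (t + h) - K t - h%:C *: K')| <= e * `|h| / 3.
  apply: le_trans (rip_abs _ _) _.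
  have f1 : rnorm (F t) <= rnorm (F t) + 1 by rewrite lerDl.
  apply: le_trans (ler_pM (rnorm_ge0 _) (rnorm_ge0 _) f1 (h2 h hd2)) _.
  apply: eq_ler; field.
  by rewrite gt_eqF// ltr_wpDl// rnorm_ge0.
have e3 : `|h| * `|rip F' (K (t + h) - K t)| <= e * `|h| / 3.
  have f1 : rnorm F' <= rnorm F' + 1 by rewrite lerDl.
  have := le_trans (rip_abs _ _) (ler_pM (rnorm_ge0 _) (rnorm_ge0 _) f1 k2).
  move=> /(ler_wpM2l (normr_ge0 h)) /le_trans; apply.
  apply: eq_ler; field.
  by rewrite gt_eqF// ltr_wpDl// rnorm_ge0.
by move: e1 e2 e3; clear; lra.
Qed.

(* [A^2 S t] *)
Definition G2 G t x : H := G (t / 2) (G (t / 2) x).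

Section fixed.
Variables (S G : R -> {linear H -> H}) (w tau : R).
Hypotheses (SG : analytic_semigroup S G w) (tau0 : 0 < tau).

Lemma as_comm a b x : 0 < a -> 0 <= b -> G a (S b x) = S b (G a x).
Proof. by move=> a0 b0; rewrite -(as_GDl SG)// -(as_GDr SG). Qed.

Lemma G_shift c t x : 0 < c -> c <= t -> G t x = S (t - c) (G c x).
Proof. by move=> c0 ct; rewrite -(as_GDl SG) ?subrK// subr_ge0. Qed.

Lemma G2_shift c t x : 0 < c -> c <= t -> G2 G t x = S (t - c) (G2 G c x).
Proof.
move=> c0 ct; rewrite /G2; have c20 : 0 < c / 2 by rewrite divr_gt0.
have ct2 : c / 2 <= t / 2 by rewrite ler_pM2r ?invr_gt0.
have d0 : 0 <= t / 2 - c / 2 by rewrite subr_ge0.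
rewrite (G_shift x c20 ct2) (G_shift _ c20 ct2) as_comm// -(as_D SG)//.
by congr (S _ _); rewrite -mulrBl -splitr.
Qed.

Lemma G_vcts t x : 0 < t -> vcts (fun s => G s x) t.
Proof. by move=> t0; exact: vderive_vcts (as_Gderive x SG t0). Qed.

Lemma G2_vcts t x : 0 < t -> vcts (fun s => G2 G s x) t.
Proof.
move=> t0 e e0; have t20 : 0 < t / 2 by rewrite divr_gt0.
have [d d0 hd] := vderive_vcts (as_vderive (G2 G (t / 2) x) SG t20) e0.
exists (Num.min d (t / 2)); first by rewrite lt_min d0.
move=> h; rewrite lt_min => /andP[h1 h2]; have := hd _ h1.
have th : t / 2 <= t + h.
  by move: h2; rewrite ltr_norml => /andP[h2 _]; move: h2; lra.
have tt : t / 2 <= t by rewrite ler_pdivrMr// ler_peMr// ?ler1n// ltW.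
rewrite (G2_shift x t20 th) (G2_shift x t20 tt).
have E1 : t + h - t / 2 = t / 2 + h by field.
have E2 : t - t / 2 = t / 2 by field.
by rewrite E1 E2.
Qed.

Lemma cont_pos_GG x y : cont_pos (fun t => rip (G t x) (G t y)).
Proof. by move=> t t0; apply: vcts_rip; exact: G_vcts. Qed.

Lemma cont_pos_tGG x y : cont_pos (fun t => t * rip (G t x) (G t y)).
Proof. by move=> t t0; apply: continuousM; [exact: cvg_id|exact: cont_pos_GG]. Qed.

Lemma cont_pos_tG2G x y : cont_pos (fun t => t * rip (G2 G t x) (G t y)).
Proof.
move=> t t0; apply: continuousM; first exact: cvg_id.
by apply: vcts_rip; [exact: G2_vcts|exact: G_vcts].
Qed.

Definition growth : R := expR (w * tau).

Lemma growth_ge1 : 1 <= growth.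
Proof.
by rewrite /growth -[leLHS]expR0 ler_expR mulr_ge0// ?(as_w SG)// ltW.
Qed.

Lemma growth_ge0 : 0 <= growth. Proof. exact: expR_ge0. Qed.

Lemma S_growth t x : 0 <= t -> t <= tau -> rnorm (S t x) <= growth * rnorm x.
Proof.
move=> t0 tt; apply: le_trans (as_le SG _ t0) _; apply: ler_wpM2r; first exact: rnorm_ge0.
by rewrite ler_expR; apply: ler_wpM2l => //; exact: as_w SG.
Qed.

(** Up to the factor [growth], [|G t x|] decreases in [t]. This is what makes values on a dyadic
    interval comparable with those at its endpoints. *)
Lemma G_growth c t x : 0 < c -> c <= t -> t <= tau -> rnorm (G t x) <= growth * rnorm (G c x).
Proof.
move=> c0 ct tt; rewrite (G_shift x c0 ct); apply: S_growth; first by rewrite subr_ge0.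
by rewrite (le_trans _ tt)// gerBl ltW.
Qed.

Lemma G_growth_sqr c t x : 0 < c -> c <= t -> t <= tau ->
  rnorm (G t x) ^+ 2 <= growth ^+ 2 * rnorm (G c x) ^+ 2.
Proof.
move=> c0 ct tt; rewrite -exprMn; apply: lerXn2r; last exact: G_growth.
  by rewrite nnegrE rnorm_ge0.
by rewrite nnegrE mulr_ge0 ?rnorm_ge0// growth_ge0.
Qed.

(** The weight [t] pays for one factor [G (t / 2)]. The other is bounded by its value at an earlier
    dyadic time; since [t / 2 > dy tau k.+2], the index moves by two. *)
Lemma G2_bound : exists2 C : R, 0 <= C & forall k t x,
  dy tau k.+1 < t <= dy tau k -> t * rnorm (G2 G t x) <= C * rnorm (G (dy tau k.+2) x).
Proof.
have [C C0 GC] := as_bound SG tau.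
exists (2 * C * growth); first by rewrite !mulr_ge0// growth_ge0.
move=> k t x /andP[tk1 tk2].
have t0 : 0 < t by apply: lt_trans tk1; exact: dy_gt0.
have t20 : 0 < t / 2 by rewrite divr_gt0.
have tt : t <= tau by apply: le_trans tk2 _; exact: dy_le.
have t2t : t / 2 <= tau by apply: le_trans tt; rewrite ler_pdivrMr// ler_peMr// ?ler1n// ltW.
have h1 : rnorm (G2 G t x) <= C / (t / 2) * rnorm (G (t / 2) x).
  by apply: GC; rewrite t20.
have h2 : rnorm (G (t / 2) x) <= growth * rnorm (G (dy tau k.+2) x).
  apply: G_growth => //; first exact: dy_gt0.
  by rewrite ler_pdivlMr// mulrC -(dyS tau k.+1) ltW.
apply: le_trans (ler_wpM2l (ltW t0) h1) _.
have -> : t * (C / (t / 2) * rnorm (G (t / 2) x)) = 2 * C * rnorm (G (t / 2) x).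
  by field; rewrite gt_eqF.
by rewrite -[leRHS]mulrA; apply: ler_wpM2l => //; rewrite mulr_ge0.
Qed.

Lemma rip_le_half x y : `|rip x y| <= 2^-1 * (rnorm x ^+ 2 + rnorm y ^+ 2).
Proof.
apply: le_trans (rip_abs _ _) _; have := sqr_ge0 (rnorm x - rnorm y).
by rewrite sqrrB; lra.
Qed.

Lemma sum_shift1 (a : nat -> R) (B : R) : (forall k, 0 <= a k) ->
  (forall n, \sum_(k < n) a k <= B) -> forall n, \sum_(k < n) a k.+1 <= B.
Proof.
move=> a0 aB n; apply: le_trans (aB n.+1).
by rewrite [leRHS]big_ord_recl lerDr.
Qed.

Lemma sumD_le (c : R) (a b : nat -> R) (A B : R) n : 0 <= c ->
  \sum_(k < n) a k <= A -> \sum_(k < n) b k <= B ->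
  \sum_(k < n) c * (a k + b k) <= c * (A + B).
Proof. by move=> c0 h1 h2; rewrite -big_distrr/= ler_wpM2l// big_split/= lerD. Qed.

Lemma tGG_integrable : exists2 C : R, 0 <= C & forall x y,
  integrable0 tau (fun t => t * rip (G t x) (G t y)) /\
  `|integral0 tau (fun t => t * rip (G t x) (G t y))| <= C * (rnorm x ^+ 2 + rnorm y ^+ 2).
Proof.
have [K K0 hK] := dyadic_upper SG tau0.
have M20 : 0 <= growth ^+ 2 by exact: sqr_ge0.
exists (growth ^+ 2 * K); first by rewrite mulr_ge0.
move=> x y.
pose b k := dy tau k * (2^-1 * (growth ^+ 2 * rnorm (G (dy tau k.+1) x) ^+ 2 +
  growth ^+ 2 * rnorm (G (dy tau k.+1) y) ^+ 2)).
apply: (@dyadic_integrable _ _ _ b) => //; first exact: cont_pos_tGG.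
  move=> k t /andP[tk1 tk2]; have d0 := dy_gt0 k.+1 tau0.
  have t0 : 0 < t by apply: lt_trans tk1.
  rewrite normrM gtr0_norm//; apply: ler_pM => //; first exact: ltW.
  apply: le_trans (rip_le_half _ _) _; rewrite ler_pM2l ?invr_gt0//.
  have tt : t <= tau by apply: le_trans tk2 _; exact: dy_le.
  by apply: lerD; apply: G_growth_sqr => //; exact: ltW.
move=> n; pose a z k := dy tau k ^+ 2 * rnorm (G (dy tau k) z) ^+ 2.
have a0 z k : 0 <= a z k by rewrite mulr_ge0 ?sqr_ge0.
have E k : dy tau k.+1 * b k = growth ^+ 2 * (a x k.+1 + a y k.+1).
  by rewrite /b /a (dyS tau k); field.
under eq_bigr do rewrite E.
rewrite -mulrA mulrDr; apply: (sumD_le (a := fun k => a x k.+1) (b := fun k => a y k.+1)) .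
- exact: M20.
- by apply: (sum_shift1 (a0 x)) => m; exact: (hK m x).
- by apply: (sum_shift1 (a0 y)) => m; exact: (hK m y).
Qed.

(** Finite energy in dyadic form, which presupposes no integrability; [engy_bound] and
    [dyadic_ge_engy] compare it with the integral. *)
Definition inV u : Prop := exists M : R, forall n,
  \sum_(k < n) dy tau k * rnorm (G (dy tau k) u) ^+ 2 <= M.

Definition engy u v : R := integral0 tau (fun t => rip (G t u) (G t v)).

Lemma GG_integrable u v (A B : R) :
  (forall n, \sum_(k < n) dy tau k * rnorm (G (dy tau k) u) ^+ 2 <= A) ->
  (forall n, \sum_(k < n) dy tau k * rnorm (G (dy tau k) v) ^+ 2 <= B) ->
  integrable0 tau (fun t => rip (G t u) (G t v)) /\
  `|engy u v| <= 2^-1 * growth ^+ 2 * (A + B).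
Proof.
move=> hA hB; have M20 : 0 <= growth ^+ 2 by exact: sqr_ge0.
pose b k := 2^-1 * (growth ^+ 2 * rnorm (G (dy tau k.+1) u) ^+ 2 +
  growth ^+ 2 * rnorm (G (dy tau k.+1) v) ^+ 2).
apply: (@dyadic_integrable _ _ _ b) => //; first exact: cont_pos_GG.
  move=> k t /andP[tk1 tk2]; have d0 := dy_gt0 k.+1 tau0.
  apply: le_trans (rip_le_half _ _) _; rewrite ler_pM2l ?invr_gt0//.
  have tt : t <= tau by apply: le_trans tk2 _; exact: dy_le.
  by apply: lerD; apply: G_growth_sqr => //; exact: ltW.
move=> n; pose a z k := dy tau k * rnorm (G (dy tau k) z) ^+ 2.
have a0 z k : 0 <= a z k by rewrite mulr_ge0 ?sqr_ge0// ltW// dy_gt0.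
have E k : dy tau k.+1 * b k = 2^-1 * growth ^+ 2 * (a u k.+1 + a v k.+1).
  by rewrite /b /a; field.
under eq_bigr do rewrite E.
apply: (sumD_le (a := fun k => a u k.+1) (b := fun k => a v k.+1)).
- by rewrite mulr_ge0// invr_ge0.
- exact: (sum_shift1 (a0 u) hA).
- exact: (sum_shift1 (a0 v) hB).
Qed.

Lemma inV_integrable u v : inV u -> inV v -> integrable0 tau (fun t => rip (G t u) (G t v)).
Proof. by move=> [A hA] [B hB]; have [] := GG_integrable hA hB. Qed.

Lemma engy_ge0 u : 0 <= engy u u.
Proof. by apply: integral0_ge0 => t _; rewrite rip_xx sqr_ge0. Qed.

Lemma dyadic_ge_integral u : integrable0 tau (fun t => rip (G t u) (G t u)) -> forall n,
  \sum_(k < n) dy tau k * rnorm (G (dy tau k) u) ^+ 2 <= 2 * growth ^+ 2 * engy u u.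
Proof.
move=> ui n; have g0 : 0 < growth ^+ 2 by rewrite exprn_gt0// (lt_le_trans _ growth_ge1).
have := @dyadic_integral_ge _ tau _ (fun k => growth ^- 2 * rnorm (G (dy tau k) u) ^+ 2)
  tau0 (@cont_pos_GG u u) ui _ _ _ n.
have h1 (t : R) : 0 < t -> 0 <= rip (G t u) (G t u) by rewrite rip_xx sqr_ge0.
have h2 k : 0 <= growth ^- 2 * rnorm (G (dy tau k) u) ^+ 2.
  by rewrite mulr_ge0 ?sqr_ge0// invr_ge0 ltW.
have h3 k t : dy tau k.+1 < t <= dy tau k ->
    growth ^- 2 * rnorm (G (dy tau k) u) ^+ 2 <= rip (G t u) (G t u).
  move=> /andP[tk1 tk2]; rewrite rip_xx ler_pdivrMl//; apply: G_growth_sqr => //.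
    by apply: lt_trans tk1; exact: dy_gt0.
  exact: dy_le.
move=> /(_ h1 h2 h3); rewrite -/(engy u u) => h.
have E k : dy tau k * rnorm (G (dy tau k) u) ^+ 2 =
   2 * growth ^+ 2 * (dy tau k.+1 * (growth ^- 2 * rnorm (G (dy tau k) u) ^+ 2)).
  by rewrite (dyS tau k); field; rewrite gt_eqF// (lt_le_trans _ growth_ge1).
under eq_bigr do rewrite E.
by rewrite -big_distrr/= ler_pM2l// mulr_gt0.
Qed.

Lemma dyadic_ge_engy u : inV u -> forall n,
  \sum_(k < n) dy tau k * rnorm (G (dy tau k) u) ^+ 2 <= 2 * growth ^+ 2 * engy u u.
Proof. by move=> uV; apply: dyadic_ge_integral; exact: inV_integrable. Qed.

Lemma engy_bound u (A : R) :
  (forall n, \sum_(k < n) dy tau k * rnorm (G (dy tau k) u) ^+ 2 <= A) ->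
  inV u /\ engy u u <= growth ^+ 2 * A.
Proof.
move=> hA; split; first by exists A.
have [_ h] := GG_integrable hA hA; apply: le_trans (ler_norm _) _; apply: le_trans h _.
by apply: eq_ler; field.
Qed.

(** By [G2_bound] the factor [t G2 t u] is no worse than [G] at a slightly earlier time, so the two
    energies dominate the integral: the form is continuous on [V]. *)
Lemma tG2G_integrable : exists2 C : R, 0 <= C & forall u v, inV u -> inV v ->
  integrable0 tau (fun t => t * rip (G2 G t u) (G t v)) /\
  `|integral0 tau (fun t => t * rip (G2 G t u) (G t v))| <= C * (engy u u + engy v v).
Proof.
have [C C0 hC] := G2_bound; have M0 := growth_ge0.
have M20 : 0 <= growth ^+ 2 by exact: sqr_ge0.
exists (C * growth * (2 * growth ^+ 2)); first by rewrite !mulr_ge0.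
move=> u v uV vV; have hu := dyadic_ge_engy uV; have hv := dyadic_ge_engy vV.
pose b k := C * growth * 2^-1 * (rnorm (G (dy tau k.+2) u) ^+ 2 + rnorm (G (dy tau k.+1) v) ^+ 2).
apply: (@dyadic_integrable _ _ _ b) => //; first exact: cont_pos_tG2G.
  move=> k t tk; have h1 := hC k t u tk; case/andP: tk => tk1 tk2.
  have d0 := dy_gt0 k.+1 tau0; have t0 : 0 < t by apply: lt_trans tk1.
  have tt : t <= tau by apply: le_trans tk2 _; exact: dy_le.
  rewrite normrM gtr0_norm//.
  have := ler_wpM2l (ltW t0) (rip_abs (G2 G t u) (G t v)) => /le_trans; apply.
  rewrite mulrA.
  have h2 := G_growth v d0 (ltW tk1) tt.
  have := ler_pM (mulr_ge0 (ltW t0) (rnorm_ge0 _)) (rnorm_ge0 _) h1 h2.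
  move=> /le_trans; apply; rewrite /b.
  have := sqr_ge0 (rnorm (G (dy tau k.+2) u) - rnorm (G (dy tau k.+1) v)).
  move=> /(mulr_ge0 (mulr_ge0 C0 M0)); lra.
move=> n; pose a z k := dy tau k * rnorm (G (dy tau k) z) ^+ 2.
have a0 z k : 0 <= a z k by rewrite mulr_ge0 ?sqr_ge0// ltW// dy_gt0.
have E k : dy tau k.+1 * b k <= C * growth * (a u k.+2 + a v k.+1).
  have -> : dy tau k.+1 * b k = C * growth * (a u k.+2 + 2^-1 * a v k.+1).
    by rewrite /b /a (dyS tau k.+1); field.
  apply: ler_wpM2l; first by rewrite mulr_ge0.
  by rewrite lerD2l ler_piMl// invf_le1// ler1n.
apply: (@le_trans _ _ (\sum_(k < n) C * growth * (a u k.+2 + a v k.+1))).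
  by apply: ler_sum => k _; exact: E.
rewrite -[leRHS]mulrA mulrDr; apply: (sumD_le (a := fun k => a u k.+2) (b := fun k => a v k.+1)).
- by rewrite mulr_ge0.
- exact: (sum_shift1 (fun k => a0 u k.+1) (sum_shift1 (a0 u) hu)).
- exact: (sum_shift1 (a0 v) hv).
Qed.

Definition ipR x y : R := integral0 tau (fun t => t * rip (G t x) (G t y)) + rip (S tau x) (S tau y).

Lemma ipR_equiv : exists c C : R, [/\ 0 < c, 0 < C & forall x,
  c * rnorm x ^+ 2 <= ipR x x <= C * rnorm x ^+ 2].
Proof.
have [C C0 hC] := tGG_integrable.
have [K K0 hK] := dyadic_lower SG tau0.
have g0 : 0 < growth ^+ 2 by rewrite exprn_gt0// (lt_le_trans _ growth_ge1).
pose L := K * (4 * growth ^+ 2) + K + 1.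
have L0 : 0 < L by rewrite ltr_wpDl// addr_ge0// !mulr_ge0// growth_ge0.
exists L^-1, (2 * C + growth ^+ 2); split => [||x].
- by rewrite invr_gt0.
- by rewrite ltr_wpDl// mulr_ge0.
have [fi fb] := hC x x.
pose I := integral0 tau (fun t => t * rip (G t x) (G t x)).
have I0 : 0 <= I.
  by apply: integral0_ge0 => t t0; rewrite rip_xx mulr_ge0 ?sqr_ge0// ltW.
have s0 := sqr_ge0 (rnorm (S tau x)).
apply/andP; split; last first.
  rewrite /ipR rip_xx mulrDl; apply: lerD.
    by apply: le_trans (ler_norm _) _; apply: le_trans fb _; lra.
  rewrite -exprMn; apply: lerXn2r; rewrite ?nnegrE ?mulr_ge0 ?rnorm_ge0 ?growth_ge0//.
  by apply: S_growth => //; exact: ltW.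
(* The 4 is the square of [dy tau k = 2 * dy tau k.+1]: one factor 2 for the length of the interval,
   one for the lower bound of the weight [t] on it. *)
have hQ n : \sum_(k < n) dy tau k ^+ 2 * rnorm (G (dy tau k) x) ^+ 2 <= 4 * growth ^+ 2 * I.
  pose b k := dy tau k.+1 * (growth ^- 2 * rnorm (G (dy tau k) x) ^+ 2).
  have b0 k : 0 <= growth ^- 2 * rnorm (G (dy tau k) x) ^+ 2.
    by rewrite mulr_ge0 ?sqr_ge0// invr_ge0 ltW.
  have h1 (t : R) : 0 < t -> 0 <= t * rip (G t x) (G t x).
    by move=> t0; rewrite rip_xx mulr_ge0 ?sqr_ge0// ltW.
  have h2 k : 0 <= b k by rewrite mulr_ge0// ltW// dy_gt0.
  have h3 k t : dy tau k.+1 < t <= dy tau k -> b k <= t * rip (G t x) (G t x).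
    move=> /andP[tk1 tk2]; rewrite /b; apply: ler_pM => //.
    - exact/ltW/dy_gt0.
    - exact: ltW.
    rewrite rip_xx ler_pdivrMl//; apply: G_growth_sqr => //.
      by apply: lt_trans tk1; exact: dy_gt0.
    exact: dy_le.
  have := dyadic_integral_ge tau0 (@cont_pos_tGG x x) fi h1 h2 h3 n.
  rewrite -/I => h.
  have E k : dy tau k ^+ 2 * rnorm (G (dy tau k) x) ^+ 2 =
     4 * growth ^+ 2 * (dy tau k.+1 * b k).
    by rewrite /b (dyS tau k); field; rewrite gt_eqF// (lt_le_trans _ growth_ge1).
  under eq_bigr do rewrite E.
  by rewrite -big_distrr/= ler_pM2l// mulr_gt0.
rewrite ler_pdivrMl//; apply: le_trans (hK x _ hQ) _.
rewrite /ipR rip_xx -/I /L.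
have := mulr_ge0 (mulr_ge0 K0 (ltW g0)) s0; have := mulr_ge0 K0 I0.
lra.
Qed.

Definition formR u v : R := integral0 tau (fun t => t * rip (G2 G t u) (G t v)) + rip (G tau u) (S tau v).

(* Integrate [d/dt (t |G t u|^2) = |G t u|^2 - 2 t rip (G2 t u) (G t u)]. *)
Lemma formR_ge u : inV u ->
  2^-1 * engy u u - 2^-1 * tau * rnorm (G tau u) ^+ 2 + rip (G tau u) (S tau u) <= formR u u.
Proof.
move=> uV; rewrite /formR lerD2r.
have [C _ hC] := tG2G_integrable; have [fi _] := hC u u uV uV.
have gi := inV_integrable uV uV.
pose h t := rip (G t u) (G t u) + (-2) * (t * rip (G2 G t u) (G t u)).
have hi : integrable0 tau h by apply: integrable0D => //; exact: integrable0Z.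
have dpsi (t : R) : 0 < t -> is_derive t 1 (fun t => t * rip (G t u) (G t u)) (h t).
  move=> t0; have du := as_Gderive u SG t0; have d1 := vderive_rip2 du du.
  apply: (is_derive_eq (is_deriveM (is_derive_id t 1) d1)).
  rewrite /h /G2 /GRing.scale /= ripNl ripNr (ripC (G t u)).
  by ring.
have hc : cont_pos h.
  move=> t t0; apply: cvgD; first exact: cont_pos_GG.
  by apply: cvgM; [exact: cvg_cst|exact: cont_pos_tG2G].
have p0 (t : R) : 0 < t -> 0 <= t * rip (G t u) (G t u).
  by move=> t0; rewrite rip_xx mulr_ge0 ?sqr_ge0// ltW.
have := primitive_integral_le tau0 hc hi p0 dpsi.
rewrite /h integral0D//; last exact: integrable0Z.
by rewrite integral0Z// rip_xx -/(engy u u); lra.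
Qed.

End fixed.
End real_forms.

(** * Hilbert spaces from real bilinear forms *)

Section real_bilinear.
Context (R : realType) (E : lmodType R[i]).
Implicit Types (b : E -> E -> R) (x y z : E).

(** The real parts of sesquilinear forms. Invariance under ['i] gives
    [b ('i *: x) y = - b x ('i *: y)], from which [complexify] restores the imaginary part. *)
Record real_sesqui b : Prop := {
  rs_Dl : forall x y z, b (x + y) z = b x z + b y z;
  rs_Zl : forall a x y, b (a%:C *: x) y = a * b x y;
  rs_Dr : forall x y z, b x (y + z) = b x y + b x z;
  rs_Zr : forall a x y, b x (a%:C *: y) = a * b x y;
  rs_ii : forall x y, b ('i *: x) ('i *: y) = b x y
}.

Definition complexify b x y : R[i] := b x y +i* b x ('i *: y).

Lemma scale_complex (c : R[i]) x :
  c *: x = (complex.Re c)%:C *: x + (complex.Im c)%:C *: ('i *: x).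
Proof. by rewrite scalerA -scalerDl [c in LHS]complexE [_ * 'i]mulrC. Qed.

Lemma scale_ii x : 'i *: ('i *: x) = (-1 : R)%:C *: x.
Proof.
by rewrite scalerA; congr (_ *: _); apply/eqP; rewrite eq_complex/=; apply/andP; split; apply/eqP; ring.
Qed.

Lemma scale_iC (p : R) x : 'i *: (p%:C *: x) = p%:C *: ('i *: x).
Proof. by rewrite !scalerA mulrC. Qed.

Lemma rs_il b x y : real_sesqui b -> b ('i *: x) y = - b x ('i *: y).
Proof.
move=> B; rewrite -[in RHS](rs_ii B) scale_ii (rs_Zr B).
by rewrite mulN1r opprK.
Qed.

Lemma complexify_bilinear b : real_sesqui b ->
  bilinear_for *%R (@Num.conj R[i] \; *%R) (complexify b).
Proof.
move=> B; split=> [y c x1 x2|x c y1 y2].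
  rewrite /complexify (scale_complex c) !(rs_Dl B) !(rs_Zl B) !(rs_il _ _ B) scale_ii (rs_Zr B).
  by case: c => p q; apply/eqP; rewrite eq_complex/=; apply/andP; split; apply/eqP; ring.
rewrite /complexify (scale_complex c) !scalerDr !(rs_Dr B).
rewrite !scale_iC scale_ii !(rs_Zr B).
by case: c => p q; apply/eqP; rewrite eq_complex/=; apply/andP; split; apply/eqP; ring.
Qed.

Lemma complexify_form b : real_sesqui b ->
  exists a : {bilinear E -> E -> R[i] | *%R & (@Num.conj R[i] \; *%R)},
    forall x y, a x y = complexify b x y.
Proof.
move=> B.
pose m := bilinear_isBilinear.Build R[i] E E R[i] *%R (@Num.conj R[i] \; *%R) _ (complexify_bilinear B).
pose a : {bilinear E -> E -> R[i] | *%R & (@Num.conj R[i] \; *%R)} := HB.pack (complexify b) m.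
by exists a.
Qed.

Lemma complexify_dot b : real_sesqui b -> (forall x y, b x y = b y x) ->
  (forall x, x != 0 -> 0 < b x x) ->
  exists a : {dot E for (@Num.conj R[i])}, forall x y, a x y = complexify b x y.
Proof.
move=> B bC b0.
pose m := bilinear_isBilinear.Build R[i] E E R[i] *%R (@Num.conj R[i] \; *%R) _ (complexify_bilinear B).
have h x y : complexify b x y = (-1) ^+ false * Num.conj (complexify b y x).
  rewrite expr0 mul1r /complexify (bC x y) (bC x) (rs_il _ _ B).
  by apply/eqP; rewrite eq_complex/= !eqxx.
pose mh := isHermitianSesquilinear.Build R[i] E false (@Num.conj R[i]) (complexify b) h.
have p x : x != 0 -> 0 < complexify b x x.
  move=> /b0 x0; rewrite ltcE/= x0 andbT; apply/eqP.
  by have := rs_il x x B; rewrite bC; lra.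
pose md := isDotProduct.Build R[i] E (complexify b) p.
pose a : {dot E for (@Num.conj R[i])} := HB.pack (complexify b) m mh md.
by exists a.
Qed.

Lemma real_sesquiD b1 b2 : real_sesqui b1 -> real_sesqui b2 ->
  real_sesqui (fun x y => b1 x y + b2 x y).
Proof.
move=> B1 B2; split=> *.
- by rewrite (rs_Dl B1) (rs_Dl B2); ring.
- by rewrite (rs_Zl B1) (rs_Zl B2); ring.
- by rewrite (rs_Dr B1) (rs_Dr B2); ring.
- by rewrite (rs_Zr B1) (rs_Zr B2); ring.
- by rewrite (rs_ii B1) (rs_ii B2).
Qed.

Lemma real_sesquiZ (r : R) b : real_sesqui b -> real_sesqui (fun x y => r * b x y).
Proof.
move=> B; split=> *.
- by rewrite (rs_Dl B); ring.
- by rewrite (rs_Zl B); ring.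
- by rewrite (rs_Dr B); ring.
- by rewrite (rs_Zr B); ring.
- by rewrite (rs_ii B).
Qed.

Lemma real_sesqui_integral tau (k : R -> E -> E -> R) :
  (forall t, 0 < t -> real_sesqui (k t)) ->
  (forall x y, integrable0 tau (fun t => k t x y)) ->
  real_sesqui (fun x y => integral0 tau (fun t => k t x y)).
Proof.
move=> K I; split=> *.
- rewrite -integral0D//; apply: eq_integral0 => t t0; exact: (rs_Dl (K t t0)).
- rewrite -integral0Z//; apply: eq_integral0 => t t0; exact: (rs_Zl (K t t0)).
- rewrite -integral0D//; apply: eq_integral0 => t t0; exact: (rs_Dr (K t t0)).
- rewrite -integral0Z//; apply: eq_integral0 => t t0; exact: (rs_Zr (K t t0)).
- by apply: eq_integral0 => t t0; exact: (rs_ii (K t t0)).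
Qed.

Lemma real_sesqui_rip (H : hilbertType R) (T1 T2 : {linear E -> H}) :
  real_sesqui (fun x y => rip (T1 x) (T2 y)).
Proof.
split=> *.
- by rewrite linearD ripDl.
- by rewrite (linearZ_LR T1) ripZl.
- by rewrite linearD ripDr.
- by rewrite (linearZ_LR T2) ripZr.
- by rewrite (linearZ_LR T1) (linearZ_LR T2) rip_ii.
Qed.

Lemma real_sesqui_CS b x y : real_sesqui b -> (forall x y, b x y = b y x) ->
  (forall x, 0 <= b x x) -> b x y ^+ 2 <= b x x * b y y.
Proof.
move=> B bC b0.
have h (r : R) : 0 <= b x x + 2 * r * b x y + r ^+ 2 * b y y.
  have := b0 (x + r%:C *: y).
  by rewrite !(rs_Dl B, rs_Dr B, rs_Zl B, rs_Zr B) (bC y x); lra.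
have [yy|yy] := eqVneq (b y y) 0.
  suff -> : b x y = 0 by rewrite expr0n/= mulr_ge0.
  (* For [b y y = 0] the expression in [h] is affine in [r], and this [r] would give it the value
     -1. *)
  apply/eqP/negPn/negP => xy; have := h (- (b x x + 1) / (2 * b x y)).
  rewrite yy; have -> : 2 * (- (b x x + 1) / (2 * b x y)) * b x y = - (b x x + 1) by field.
  lra.
have y0 : 0 < b y y by rewrite lt_neqAle eq_sym yy b0.
have := h (- b x y / b y y).
have -> : b x x + 2 * (- b x y / b y y) * b x y + (- b x y / b y y) ^+ 2 * b y y =
  (b x x * b y y - b x y ^+ 2) / b y y by field.
by rewrite pmulr_lge0 ?invr_gt0// subr_ge0.
Qed.

End real_bilinear.

(** * The Hilbert space of a complete real scalar product *)

Section hilbert_of_form.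
Context (R : realType) (E : lmodType R[i]).

Record scalar_product := {
  sp :> E -> E -> R;
  sp_sesqui : real_sesqui sp;
  sp_C : forall x y, sp x y = sp y x;
  sp_gt0 : forall x, x != 0 -> 0 < sp x x;
  sp_complete : forall u : nat -> E,
    (forall e : R, 0 < e -> exists N, forall n m, (N <= n)%N -> (N <= m)%N ->
       sp (u n - u m) (u n - u m) < e) ->
    exists l, forall e : R, 0 < e -> exists N, forall n, (N <= n)%N ->
       sp (u n - l) (u n - l) < e
}.

(** A copy of [E] that remembers [b], so that the norm and the inner product given by [b] can be
    attached to it as canonical structures. *)
Definition prehilbert (b : scalar_product) : Type := E.

Variable b : scalar_product.
Notation V := (prehilbert b).
HB.instance Definition _ := GRing.Lmodule.copy V E.

Let B := sp_sesqui b.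

Lemma sp_ge0 x : 0 <= b x x.
Proof.
have [->|x0] := eqVneq x 0; last exact/ltW/sp_gt0.
by have := rs_Zl B 0 0 0; rewrite scaler0 mul0r => ->.
Qed.

Definition sp_norm (x : V) : R[i] := (Num.sqrt (b x x))%:C.

Lemma sp_normD (x y : V) : sp_norm (x + y) <= sp_norm x + sp_norm y.
Proof.
rewrite /sp_norm -rmorphD/= lecR.
rewrite -(@ler_pXn2r _ 2)// ?nnegrE ?addr_ge0 ?sqrtr_ge0// sqrrD !sqr_sqrtr ?sp_ge0//.
rewrite (rs_Dl B) !(rs_Dr B) (sp_C b y x).
have : b x y <= Num.sqrt (b x x) * Num.sqrt (b y y).
  rewrite -sqrtrM ?sp_ge0//; apply: le_trans (ler_norm _) _.
  rewrite -sqrtr_sqr ler_wsqrtr//; apply: (@real_sesqui_CS _ E b x y B (@sp_C b)). exact: sp_ge0.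
lra.
Qed.

Lemma sp_normZ (l : R[i]) (x : V) : sp_norm (l *: x) = `|l| * sp_norm x.
Proof.
rewrite /sp_norm [l *: x in LHS]scale_complex !(rs_Dl B, rs_Dr B, rs_Zl B, rs_Zr B) (rs_ii B).
rewrite (rs_il _ _ B); case: l => p q; rewrite normc_def/= -rmorphM/=; congr (_%:C).
rewrite -sqrtrM ?addr_ge0 ?sqr_ge0//; congr (Num.sqrt _); ring.
Qed.

Lemma sp_norm0_eq0 (x : V) : sp_norm x = 0 -> x = 0.
Proof.
move=> [] /eqP; rewrite sqrtr_eq0 => x0; apply/eqP/negPn/negP => /(@sp_gt0 b).
by rewrite ltNge x0.
Qed.

HB.instance Definition _ := Lmodule_isNormed.Build R[i] V sp_normD sp_normZ sp_norm0_eq0.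

Lemma sp_normE (x : V) : `|x| = (Num.sqrt (b x x))%:C. Proof. by []. Qed.

(** Reduces filters to sequences: [u n] is the centre of a ball of radius [1 / (n + 1)] that belongs
    to [F]. Two such balls meet, so [u] is Cauchy, and its limit is a limit of [F]. *)
Lemma prehilbert_complete : forall F : set_system V, ProperFilter F -> cauchy F -> cvg F.
Proof.
move=> F FF /cauchyP Fc.
pose nb (x : V) : R := Num.sqrt (b x x).
have nbD (x y z : V) : nb (x - z) <= nb (x - y) + nb (y - z).
  by have := sp_normD (x - y) (y - z); rewrite addrA subrK /sp_norm -rmorphD lecR.
have nbN (x y : V) : nb (x - y) = nb (y - x).
  by rewrite /nb -(opprB y x) -scaleN1r; have := sp_normZ (-1) (y - x); rewrite normrN1 mul1r => -[].
have nb_lt (x : V) (e : R) : 0 < e -> (nb x < e) = (b x x < e ^+ 2).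
  by move=> e0; rewrite -(@ltr_pXn2r _ 2)// ?nnegrE ?sqrtr_ge0 ?ltW// sqr_sqrtr ?sp_ge0.
have hx n : exists x : V, F [set y | nb (x - y) < n.+1%:R^-1].
  have n0 : 0 < (n.+1%:R^-1 : R)%:C by rewrite ltcR invr_gt0.
  have [x Fx] := Fc _ n0; exists x; apply: filterS Fx => y.
  by rewrite -ball_normE /ball_/= sp_normE ltcR.
have /choice[u uP] := hx.
have small (e : R) : 0 < e -> exists N, forall n, (N <= n)%N -> n.+1%:R^-1 < e.
  move=> e0; exists (Num.truncn e^-1) => n Nn; rewrite invf_plt ?posrE//.
  by apply: lt_le_trans (truncnS_gt _) _; rewrite ler_nat ltnS.
have uC n m : nb (u n - u m) < n.+1%:R^-1 + m.+1%:R^-1.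
  have [y [/= h1 h2]] := filter_ex (filterI (uP n) (uP m)).
  apply: le_lt_trans (nbD _ y _) _; rewrite (nbN y); exact: ltrD.
have uCE (e : R) : 0 < e -> exists N, forall n m, (N <= n)%N -> (N <= m)%N ->
    b (u n - u m) (u n - u m) < e.
  move=> e0; have e20 : 0 < Num.sqrt e / 2 by rewrite divr_gt0 ?sqrtr_gt0.
  have [N hN] := small _ e20; exists N => n m Nn Nm.
  rewrite -[ltRHS]sqr_sqrtr ?ltW// -nb_lt ?sqrtr_gt0//.
  by apply: lt_trans (uC n m) _; rewrite [ltRHS]splitr; apply: ltrD; exact: hN.
have [l hl] := sp_complete uCE.
apply/cvg_ex; exists (l : V); apply/cvgrPdist_lt => e.
rewrite ltcE/= => /andP[/eqP ei er].
have e20 : 0 < complex.Re e / 2 by rewrite divr_gt0.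
have [N1 h1] := small _ e20.
have e220 : 0 < (complex.Re e / 2) ^+ 2 by rewrite exprn_gt0.
have [N2 h2] := hl _ e220.
have := uP (maxn N1 N2); apply: filterS => y /= hy.
have -> : e = (complex.Re e)%:C by apply/eqP; rewrite eq_complex/= ei !eqxx.
rewrite sp_normE ltcR -/(nb _).
apply: le_lt_trans (nbD _ (u (maxn N1 N2)) _) _.
have := h2 _ (leq_maxr N1 N2); rewrite -nb_lt// nbN => h3.
by rewrite [ltRHS]splitr; apply: ltrD => //; apply: lt_trans hy _; exact: h1 _ (leq_maxl _ _).
Qed.

HB.instance Definition _ := Uniform_isComplete.Build V prehilbert_complete.

Lemma prehilbert_sesqui : @real_sesqui R V b.
Proof.
by split; [exact: (rs_Dl B)|exact: (rs_Zl B)|exact: (rs_Dr B)|exact: (rs_Zr B)|exact: (rs_ii B)].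
Qed.

Lemma prehilbert_inner : exists a : {dot V for (@Num.conj R[i])},
  (forall x, a x x = `|x| ^+ 2) /\ forall x y, complex.Re (a x y) = b x y.
Proof.
have [a aE] := @complexify_dot R V b prehilbert_sesqui (@sp_C b) (@sp_gt0 b).
exists a; split=> x; last by move=> y; rewrite aE.
rewrite aE sp_normE -rmorphXn/= sqr_sqrtr ?sp_ge0// /complexify.
apply/eqP; rewrite eq_complex/= eqxx/=; apply/eqP.
by have := rs_il x x prehilbert_sesqui; rewrite (sp_C b ('i *: x)); lra.
Qed.

HB.instance Definition _ := isHilbert.Build R V (projT2 (cid prehilbert_inner)).1.

Lemma rip_prehilbert (x y : V) : rip x y = b x y.
Proof. exact: (projT2 (cid prehilbert_inner)).2. Qed.

End hilbert_of_form.

Section subspace.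
Context (K : nzRingType) (H : lmodType K) (P : submodClosed H).

Record subspace := Subspace { subspace_val : H; _ : subspace_val \in P }.
HB.instance Definition _ := [isSub for subspace_val].
HB.instance Definition _ := [Choice of subspace by <:].
HB.instance Definition _ := [SubChoice_isSubLmodule of subspace by <:].

End subspace.

(** * The form domain *)

Section form_domain.
Context (R : realType) (H : hilbertType R).
Implicit Types (x y z u v : H).
Variables (S G : R -> {linear H -> H}) (w tau : R).
Hypotheses (SG : analytic_semigroup S G w) (tau0 : 0 < tau).

Lemma sum_GD x y n : \sum_(k < n) dy tau k * rnorm (G (dy tau k) (x + y)) ^+ 2 <=
  2 * (\sum_(k < n) dy tau k * rnorm (G (dy tau k) x) ^+ 2 +
       \sum_(k < n) dy tau k * rnorm (G (dy tau k) y) ^+ 2).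
Proof.
rewrite -big_split/= big_distrr/=; apply: ler_sum => k _; rewrite -mulrDr [leRHS]mulrCA.
have d0 := dy_gt0 k tau0; rewrite ler_pM2l//.
rewrite linearD rnorm_sqrD; have := rnorm_sqrB (G (dy tau k) x) (G (dy tau k) y).
by have := sqr_ge0 (rnorm (G (dy tau k) x - G (dy tau k) y)); lra.
Qed.

Lemma inV_submod : submod_closed (fun u => `[< inV G tau u >] : bool).
Proof.
split=> [|c u v].
  by apply/asboolP; exists 0 => n; rewrite big1// => k _; rewrite linear0 rnorm0 expr0n/= mulr0.
rewrite !unfold_in => /asboolP[A hA] /asboolP[B hB]; apply/asboolP.
exists (2 * (complex.Re `|c| ^+ 2 * A + B)) => n.
apply: le_trans (sum_GD _ _ _) _; rewrite ler_pM2l//; apply: lerD; last exact: hB.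
have E k : dy tau k * rnorm (G (dy tau k) (c *: u)) ^+ 2 =
    complex.Re `|c| ^+ 2 * (dy tau k * rnorm (G (dy tau k) u) ^+ 2).
  by rewrite (linearZ_LR (G _)) rnormZ exprMn mulrCA.
under eq_bigr do rewrite E.
by rewrite -big_distrr/=; apply: ler_wpM2l; [exact: sqr_ge0|exact: hA].
Qed.

Definition form_domain : submodClosed H :=
  HB.pack (fun u => `[< inV G tau u >] : bool)
    (GRing.isSubmodClosed.Build _ _ _ inV_submod).

Lemma in_form_domain u : u \in form_domain <-> inV G tau u.
Proof. by rewrite unfold_in/=; split=> /asboolP. Qed.

Notation E := (subspace form_domain).

Let valD (u v : E) : val (u + v) = val u + val v. Proof. exact: raddfD. Qed.
Let valB (u v : E) : val (u - v) = val u - val v. Proof. exact: raddfB. Qed.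
Let valZ (c : R[i]) (u : E) : val (c *: u) = c *: val u. Proof. by []. Qed.

Lemma form_domainP (u : E) : inV G tau (val u).
Proof. by apply/in_form_domain; exact: valP. Qed.

Lemma real_sesqui_on_domain (T1 T2 : {linear H -> H}) :
  real_sesqui (fun u v : E => rip (T1 (val u)) (T2 (val v))).
Proof.
split=> *.
- by rewrite valD linearD ripDl.
- by rewrite valZ (linearZ_LR T1) ripZl.
- by rewrite valD linearD ripDr.
- by rewrite valZ (linearZ_LR T2) ripZr.
- by rewrite !valZ (linearZ_LR T1) (linearZ_LR T2) rip_ii.
Qed.

Lemma engy_sesqui : real_sesqui (fun u v : E => engy G tau (val u) (val v)).
Proof.
apply: real_sesqui_integral => [t t0|x y]; first exact: real_sesqui_on_domain.
by apply: (inV_integrable SG tau0); exact: form_domainP.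
Qed.

Definition energy_product (u v : E) : R := engy G tau (val u) (val v) + rip (val u) (val v).

Lemma energy_product_sesqui : real_sesqui energy_product.
Proof.
by apply: real_sesquiD; [exact: engy_sesqui|exact: (real_sesqui_on_domain idfun idfun)].
Qed.

Lemma energy_product_C (u v : E) : energy_product u v = energy_product v u.
Proof.
by rewrite /energy_product ripC; congr (_ + _); apply: eq_integral0 => t _; rewrite ripC.
Qed.

Lemma energy_product_ge (u : E) : rnorm (val u) ^+ 2 <= energy_product u u.
Proof. by rewrite /energy_product rip_xx lerDr; exact: engy_ge0. Qed.

Lemma energy_product_gt0 (u : E) : u != 0 -> 0 < energy_product u u.
Proof.
by move=> u0; apply: lt_le_trans (energy_product_ge u); rewrite exprn_gt0// rnorm_gt0.
Qed.

(** Fatou's argument with dyadic sums: a Cauchy sequence converges in [H], each finite partial sum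
    is continuous on [H], and the resulting bound does not depend on the number of terms. *)
Lemma energy_product_complete (u : nat -> E) :
  (forall e : R, 0 < e -> exists N, forall n m, (N <= n)%N -> (N <= m)%N ->
     energy_product (u n - u m) (u n - u m) < e) ->
  exists l, forall e : R, 0 < e -> exists N, forall n, (N <= n)%N ->
     energy_product (u n - l) (u n - l) < e.
Proof.
move=> uC; have [l hl] : exists l : H, val (u n) @[n --> \oo] --> l.
  apply: rnorm_complete => e e0; have [|N hN] := uC (e ^+ 2); first by rewrite exprn_gt0.
  exists N => n m Nn Nm; rewrite -(@ltr_pXn2r _ 2)// ?nnegrE ?rnorm_ge0 ?(ltW e0)//.
  by apply: le_lt_trans (hN n m Nn Nm); rewrite -valB; exact: energy_product_ge.
have {}hl (e : R) : 0 < e -> exists N, forall n, (N <= n)%N -> rnorm (val (u n) - l) ^+ 2 < e.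
  move=> e0; have /cvg_rnormP := hl => /(_ (Num.sqrt e)); rewrite sqrtr_gt0 => /(_ e0).
  case=> N _ hN; exists N => n Nn; have := hN n Nn.
  by rewrite -(@ltr_pXn2r _ 2)// ?nnegrE ?rnorm_ge0 ?sqrtr_ge0// sqr_sqrtr ?(ltW e0).
have [C C0 hC] := as_bound SG tau.
pose g := growth w tau; have g1 : 1 <= g by exact: (growth_ge1 SG tau0).
have g0 : 0 < g ^+ 2 by rewrite exprn_gt0// (lt_le_trans _ g1).
have key (e : R) : 0 < e -> exists N, forall n, (N <= n)%N -> forall K,
    \sum_(k < K) dy tau k * rnorm (G (dy tau k) (val (u n) - l)) ^+ 2 <= 4 * g ^+ 2 * e + e.
  move=> e0; have [N hN] := uC e e0; exists N => n Nn K.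
  (* Bounds the first [K] terms by a multiple of the squared norm of [H]. It depends on [K], so the
     index [m], which disappears from the conclusion, is chosen after [K]. *)
  pose M := \sum_(k < K) dy tau k * (C / dy tau k) ^+ 2.
  have M0 : 0 <= M.
    by apply: sumr_ge0 => k _; rewrite mulr_ge0 ?sqr_ge0// ltW// dy_gt0.
  have e10 : 0 < e / (2 * (M + 1)) by rewrite divr_gt0// mulr_gt0// ltr_wpDl.
  have [N1 hN1] := hl _ e10.
  have h1 := hN1 _ (leq_maxr N N1); have h2 := hN _ _ Nn (leq_maxl N N1).
  set m := maxn N N1 in h1 h2.
  rewrite -[X in X - l](subrK (val (u m))) -addrA -valB.
  apply: le_trans (sum_GD _ _ _) _; rewrite mulrDr; apply: lerD.
    rewrite (_ : 4 * g ^+ 2 * e = 2 * (2 * g ^+ 2 * e)); last by ring.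
    rewrite ler_pM2l//; apply: le_trans (dyadic_ge_engy SG tau0 (form_domainP _) K) _.
    rewrite -/g ler_pM2l; last exact: mulr_gt0.
    apply: le_trans (ltW h2).
    by rewrite /energy_product lerDl rip_xx sqr_ge0.
  apply: (@le_trans _ _ (2 * (M * rnorm (val (u m) - l) ^+ 2))).
    rewrite ler_pM2l// /M big_distrl/=; apply: ler_sum => k _; rewrite -mulrA ler_pM2l ?dy_gt0//.
    rewrite -exprMn; apply: lerXn2r; rewrite ?nnegrE ?mulr_ge0 ?rnorm_ge0 ?invr_ge0//.
      exact/ltW/dy_gt0.
    by apply: hC; rewrite dy_gt0//= dy_le.
  rewrite -ler_pdivlMl//; apply: (@le_trans _ _ ((M + 1) * (e / (2 * (M + 1))))).
    by apply: ler_pM; [exact: M0|exact: sqr_ge0|rewrite lerDl|exact: ltW h1].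
  by apply: eq_ler; field; rewrite gt_eqF// ltr_wpDl.
have lV : inV G tau l.
  have [N /(_ N (leqnn N)) hN] := key 1 ltr01.
  have : inV G tau (val (u N) - l) by eexists; exact: hN.
  have [_ hlin] := inV_submod; have hu := form_domainP (u N).
  move=> h; have /asboolP := hlin (-1) _ _ (asboolT h) (asboolT hu).
  by rewrite scaleN1r opprB subrK.
exists (Subspace (iffRL (in_form_domain l) lV)) => e e0.
pose q := g ^+ 2 * (4 * g ^+ 2 + 1); pose e1 := e / (2 * q).
have q0 : 0 < q by rewrite mulr_gt0// ltr_wpDl// mulr_ge0// ltW.
have e10 : 0 < e1 by rewrite divr_gt0// mulr_gt0.
have e20 : 0 < e / 2 by rewrite divr_gt0.
have [N1 h1] := key _ e10; have [N2 h2] := hl _ e20.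
exists (maxn N1 N2) => n; rewrite geq_max => /andP[n1 n2].
rewrite /energy_product valB/= rip_xx [ltRHS]splitr; apply: ler_ltD; last exact: h2.
have [_ h] := engy_bound SG tau0 (h1 n n1); apply: le_trans h _.
rewrite -/g (_ : _ * _ = q * e1); last by rewrite /q; ring.
apply: eq_ler; rewrite /e1; field.
by rewrite gt_eqF.
Qed.

Definition energy_scalar_product : scalar_product E :=
  Build_scalar_product energy_product_sesqui energy_product_C energy_product_gt0
    energy_product_complete.

End form_domain.

(** * Continuity of complexified forms *)

Section continuity.
Context (R : realType) (V : hilbertType R).
Implicit Types (b : V -> V -> R) (u v : V).

Lemma rs_0l b v : real_sesqui b -> b 0 v = 0.
Proof. by move=> B; have := rs_Zl B 0 0 v; rewrite scaler0 mul0r. Qed.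

Lemma rs_0r b u : real_sesqui b -> b u 0 = 0.
Proof. by move=> B; have := rs_Zr B 0 u 0; rewrite scaler0 mul0r. Qed.

Lemma rs_Nl b u v : real_sesqui b -> b (- u) v = - b u v.
Proof. by move=> B; rewrite -scaleRN1 (rs_Zl B) mulN1r. Qed.

Lemma rs_Nr b u v : real_sesqui b -> b u (- v) = - b u v.
Proof. by move=> B; rewrite -scaleRN1 (rs_Zr B) mulN1r. Qed.

(** Normalising both arguments turns a bound by a sum of squares into a bound by a product. *)
Lemma rs_bounded b (C : R) : real_sesqui b ->
  (forall u v, `|b u v| <= C * (rnorm u ^+ 2 + rnorm v ^+ 2)) ->
  forall u v, `|b u v| <= 2 * C * (rnorm u * rnorm v).
Proof.
move=> B bC u v; have [->|u0] := eqVneq u 0.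
  by rewrite (rs_0l _ B) normr0 rnorm0 mul0r mulr0.
have [->|v0] := eqVneq v 0; first by rewrite (rs_0r _ B) normr0 rnorm0 !mulr0.
have nu := rnorm_gt0 u0; have nv := rnorm_gt0 v0.
have := bC ((rnorm u)^-1%:C *: u) ((rnorm v)^-1%:C *: v).
have nE (r : R) : 0 < r -> `|r^-1| = r^-1 by move=> r0; rewrite gtr0_norm// invr_gt0.
rewrite (rs_Zl B) (rs_Zr B) !rnormZr !normrM !nE// !mulVf ?gt_eqF//.
rewrite -(ler_pM2l (mulr_gt0 nu nv)).
rewrite (_ : _ * (_ * (_ * `|b u v|)) = `|b u v|); last by field; rewrite !gt_eqF.
by move=> /le_trans; apply; apply: eq_ler; ring.
Qed.

Lemma complexify_continuous b (C : R) : real_sesqui b -> 0 <= C ->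
  (forall u v, `|b u v| <= C * (rnorm u ^+ 2 + rnorm v ^+ 2)) ->
  continuous (fun p : V * V => complexify b p.1 p.2 : R[i]^o).
Proof.
move=> B C0 bC [u v]; have bd := rs_bounded B bC.
have rnormi (x : V) : rnorm ('i *: x) = rnorm x.
  by apply/eqP; rewrite -(@eqrXn2 _ 2)// ?rnorm_ge0// -!rip_xx rip_ii.
have bB u1 v1 v2 : `|b u1 v1 - b u v2| <= 2 * C * (rnorm (u1 - u) * rnorm v1) + 2 * C * (rnorm u * rnorm (v1 - v2)).
  have -> : b u1 v1 - b u v2 = b (u1 - u) v1 + b u (v1 - v2).
    by rewrite (rs_Dl B) (rs_Dr B) (rs_Nl _ _ B) (rs_Nr _ _ B); ring.
  by apply: le_trans (ler_normD _ _) _; apply: lerD; exact: bd.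
have key u1 v1 : cn (complexify b u1 v1 - complexify b u v) <=
    4 * C * (rnorm (u1 - u) * rnorm v1 + rnorm u * rnorm (v1 - v)).
  apply: le_trans (cn_le _) _; rewrite ReB ImB /complexify/=.
  have := bB u1 v1 v; have := bB u1 ('i *: v1) ('i *: v).
  by rewrite -scalerBr !rnormi; lra.
pose q := 4 * C * (rnorm v + 1 + rnorm u) + 1.
have q0 : 0 < q by rewrite ltr_wpDl// !mulr_ge0// !addr_ge0// rnorm_ge0.
apply/cvgrPdist_lt => /= e; rewrite ltcE/= => /andP[/eqP ei er].
have d0 : 0 < Num.min 1 (complex.Re e / q) by rewrite lt_min ltr01 divr_gt0.
have h1 : fst @ (u, v) --> u by exact: cvg_fst.
have h2 : snd @ (u, v) --> v by exact: cvg_snd.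
have n1 := (cvg_rnormP fst u).1 h1 _ d0.
have n2 := (cvg_rnormP snd v).1 h2 _ d0.
near=> p.
have : rnorm (p.1 - u) < Num.min 1 (complex.Re e / q) by near: p; exact: n1.
have : rnorm (p.2 - v) < Num.min 1 (complex.Re e / q) by near: p; exact: n2.
rewrite !lt_min => /andP[p21 p22] /andP[p11 p12].
have -> : e = (complex.Re e)%:C by apply/eqP; rewrite eq_complex/= ei !eqxx.
rewrite distrC normcn ltcR; apply: le_lt_trans (key _ _) _.
have p2 : rnorm p.2 <= rnorm v + 1.
  by rewrite -(subrK v p.2); apply: le_trans (rnormD _ _) _; rewrite addrC lerD2l ltW.
set d := complex.Re e / q in p22 p12.
have dE : d * q = complex.Re e by rewrite divfK// gt_eqF.
rewrite -dE /q; have d0' : 0 < d by rewrite divr_gt0.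
have h3 : rnorm (p.1 - u) * rnorm p.2 <= d * (rnorm v + 1).
  by apply: ler_pM; rewrite ?rnorm_ge0// ltW.
have h4 : rnorm u * rnorm (p.2 - v) <= d * rnorm u.
  by rewrite mulrC; apply: ler_wpM2r; [exact: rnorm_ge0|exact: ltW].
apply: (@le_lt_trans _ _ (4 * C * (d * (rnorm v + 1) + d * rnorm u))).
  by apply: ler_wpM2l; [rewrite mulr_ge0|exact: lerD].
have -> : d * (4 * C * (rnorm v + 1 + rnorm u) + 1) =
    4 * C * (d * (rnorm v + 1) + d * rnorm u) + d by ring.
by rewrite ltrDl.
Unshelve. all: by end_near. Qed.

End continuity.

(** * The equivalent product, the form on [V] and the embedding *)

Section spaces.
Context (R : realType) (H : hilbertType R).
Variables (S G : R -> {linear H -> H}) (w tau : R).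
Hypotheses (SG : analytic_semigroup S G w) (tau0 : 0 < tau).

Notation V := (prehilbert (energy_scalar_product SG tau0)).

Lemma ipR_sesqui : real_sesqui (ipR S G tau).
Proof.
apply: real_sesquiD; last exact: real_sesqui_rip.
apply: real_sesqui_integral => [t t0|x y].
  by apply: real_sesquiZ; exact: real_sesqui_rip.
by have [C _ /(_ x y)[]] := tGG_integrable SG tau0.
Qed.

Lemma exists_equivalent_product : exists2 ip : {dot H for (@Num.conj R[i])},
  equivalent_scalar_product ip & forall x y, ip x y = complexify (ipR S G tau) x y.
Proof.
have [c [C [c0 C0 hC]]] := ipR_equiv SG tau0.
have ipC x y : ipR S G tau x y = ipR S G tau y x.
  by rewrite /ipR ripC; congr (_ + _); apply: eq_integral0 => t _; rewrite ripC.
have ip0 x : x != 0 -> 0 < ipR S G tau x x.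
  move=> x0; have /andP[h _] := hC x; apply: lt_le_trans h.
  by rewrite mulr_gt0// exprn_gt0// rnorm_gt0.
have [ip ipE] := complexify_dot ipR_sesqui ipC ip0.
exists ip => //; exists (Num.sqrt c), (Num.sqrt C); rewrite !sqrtr_gt0; split=> // x.
have /andP[h1 h2] := hC x; rewrite ipE/=.
have E (r : R) : 0 < r -> Num.sqrt r * rnorm x = Num.sqrt (r * rnorm x ^+ 2).
  by move=> r0; rewrite sqrtrM ?(ltW r0)// sqrtr_sqr ger0_norm// rnorm_ge0.
by rewrite !E// !ler_wsqrtr.
Qed.

Lemma formR_sesqui : @real_sesqui R V (fun u v : V => formR S G tau (val u) (val v)).
Proof.
have Q : real_sesqui (fun u v : subspace (form_domain G tau0) => formR S G tau (val u) (val v)).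
  apply: real_sesquiD; last exact: real_sesqui_on_domain.
  apply: real_sesqui_integral => [t t0|x y].
    apply: real_sesquiZ.
    exact: (real_sesqui_on_domain _ _ (G (t / 2) \o G (t / 2))%FUN (G t)).
  have [C _ h] := tG2G_integrable SG tau0.
  by have [] := h (val x) (val y) (form_domainP x) (form_domainP y).
by split; [exact: (rs_Dl Q)|exact: (rs_Zl Q)|exact: (rs_Dr Q)|exact: (rs_Zr Q)|exact: (rs_ii Q)].
Qed.

Let rnormV (u : V) : rnorm u ^+ 2 = engy G tau (val u) (val u) + rnorm (val u) ^+ 2.
Proof. by rewrite -rip_xx rip_prehilbert -rip_xx. Qed.

Lemma exists_form : exists2 a : sesquilinear_form R V, continuous_form a &
  forall u v, a u v = complexify (fun u v : V => formR S G tau (val u) (val v)) u v.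
Proof.
have [a aE] := complexify_form formR_sesqui.
exists a => //; rewrite /continuous_form; under eq_fun do rewrite aE.
have [C C0 hC] := tG2G_integrable SG tau0.
have [D D0 hD] := as_bound SG tau.
have g0 := growth_ge0 w tau.
have K0 : 0 <= D / tau * growth w tau by rewrite !mulr_ge0// invr_ge0 ltW.
apply: (@complexify_continuous _ _ _ (C + D / tau * growth w tau) formR_sesqui) => [|u v].
  exact: addr_ge0.
have [_ h] := hC (val u) (val v) (form_domainP u) (form_domainP v).
rewrite !rnormV; apply: le_trans (ler_normD _ _) _; rewrite mulrDl; apply: lerD.
  apply: le_trans h _; apply: ler_wpM2l => //.
  by apply: lerD; rewrite lerDl sqr_ge0.
apply: le_trans (rip_abs _ _) _.
have h1 : rnorm (G tau (val u)) <= D / tau * rnorm (val u) by apply: hD; rewrite tau0/=.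
have h2 : rnorm (S tau (val v)) <= growth w tau * rnorm (val v).
  by apply: (S_growth SG) => //; exact: ltW.
apply: le_trans (ler_pM (rnorm_ge0 _) (rnorm_ge0 _) h1 h2) _; rewrite mulrACA.
apply: ler_wpM2l => //.
have := engy_ge0 G tau (val u); have := engy_ge0 G tau (val v).
have := sqr_ge0 (rnorm (val u) - rnorm (val v)).
have := sqr_ge0 (rnorm (val u) + rnorm (val v)).
move: (rnorm (val u)) (rnorm (val v)) (engy _ _ _ _) (engy _ _ _ _) => m n e1 e2; lra.
Qed.

Lemma sum_dy n : \sum_(k < n) dy tau k <= 2 * tau.
Proof.
suff -> : \sum_(k < n) dy tau k = 2 * tau - 2 * dy tau n by rewrite gerBl mulr_ge0// ltW// dy_gt0.
elim: n => [|n IH]; first by rewrite big_ord0 dy0 subrr.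
by rewrite big_ord_recr/= IH (dyS tau n); ring.
Qed.

Lemma inV_of_bound u (M : R) : (forall t, 0 < t <= tau -> rnorm (G t u) <= M) -> inV G tau u.
Proof.
move=> hM; exists (2 * tau * M ^+ 2) => n.
apply: (@le_trans _ _ (\sum_(k < n) dy tau k * M ^+ 2)).
  apply: ler_sum => k _; rewrite ler_pM2l ?dy_gt0//.
  have h : rnorm (G (dy tau k) u) <= M by apply: hM; rewrite dy_gt0//= dy_le.
  by rewrite lerXn2r// nnegrE ?rnorm_ge0// (le_trans _ h)// rnorm_ge0.
by rewrite -big_distrl/=; apply: ler_wpM2r; [exact: sqr_ge0|exact: sum_dy].
Qed.

Lemma inV_S s x : 0 < s -> inV G tau (S s x).
Proof.
move=> s0; apply: (@inV_of_bound _ (growth w tau * rnorm (G s x))) => t /andP[t0 tt].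
rewrite -(as_GDr SG) ?(ltW s0)// addrC (as_GDl SG) ?(ltW t0)//.
by apply: (S_growth SG) => //; exact: ltW.
Qed.

Lemma exists_embedding : exists2 j : {linear V -> H}, dense_embedding j & forall u, j u = val u.
Proof.
have jlin : linear (val : V -> H) by move=> c u v; exact: linearP.
pose j : {linear V -> H} := HB.pack (val : V -> H) (GRing.isLinear.Build _ _ _ _ _ jlin).
exists j => //; split.
- exact: val_inj.
- apply: (@bounded_continuousH _ _ _ j 1) => u; rewrite mul1r.
  rewrite -(@ler_pXn2r _ 2)// ?nnegrE ?rnorm_ge0// rnormV lerDr; exact: engy_ge0.
(* Density: [S s x] belongs to [V] for every [s > 0] and tends to [x]. *)
move=> O [x Ox] oO.
have hx : S t x @[t --> 0^'+] --> x by exact: (@as_cvg0 _ _ _ _ _ SG).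
have : nbhs x O by exact: open_nbhs_nbhs.
move=> /hx h; have [s [Os s0]] : exists s, O (S s x) /\ 0 < s.
  near (0 : R)^'+ => s; exists s; split; last by near: s; exact: nbhs_right_gt.
  by near: s.
exists (S s x); split => //.
by exists (Subspace (iffRL (in_form_domain G tau0 (S s x)) (inV_S x s0))).
Unshelve. all: by end_near. Qed.

End spaces.

(** * The resolvent *)

Section resolvent.
Context (R : realType) (H : hilbertType R).
Implicit Types (x y z u f g : H).
Variables (S G : R -> {linear H -> H}) (w lam : R).
Hypotheses (SG : analytic_semigroup S G w) (wlam : w < lam).

Lemma is_derive_expN (s : R) : is_derive s 1 (fun s => expR (- (lam * s))) (- lam * expR (- (lam * s))).
Proof.
have -> : (fun s => expR (- (lam * s))) = expR \o (fun s => (- lam) * s).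
  by apply/funext => r /=; rewrite mulNr.
have d : is_derive s 1 (fun s : R => (- lam) * s) (- lam).
  have -> : (fun s : R => (- lam) * s) = (- lam) \*: id by apply/funext.
  by apply: is_derive_eq; rewrite -[_ *: _]/(_ * _) mulr1.
by apply: is_derive_eq; rewrite [LHS]mulrC (mulNr lam s).
Qed.

(** Times are clamped at 0 so that the Laplace kernel is continuous on all of R. For continuity from
    both sides the smaller time [a] is factored out: [S a x - S b x = S a (x - S (b - a) x)]. *)
Lemma S_orbit_continuous x : forall s0 e : R, 0 < e -> exists2 d : R, 0 < d &
  forall s, `|s - s0| < d -> rnorm (S (Num.max s 0) x - S (Num.max s0 0) x) <= e.
Proof.
move=> s0 e e0; pose M := expR (w * (`|s0| + 1)); have M0 : 0 < M by exact: expR_gt0.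
have [d d0 hd] := as_S_small x SG (divr_gt0 e0 M0).
have key (a b : R) : 0 <= a -> a <= b -> b - a < d -> a <= `|s0| + 1 ->
    rnorm (S a x - S b x) <= e.
  move=> a0; rewrite le_eqVlt => /predU1P[<-|ab] bd aM; first by rewrite subrr rnorm0 ltW.
  have -> : S a x - S b x = S a (x - S (b - a) x).
    by rewrite linearB -(as_D SG) ?subr_ge0 ?(ltW ab)// (addrC a) subrK.
  apply: le_trans (as_le SG _ a0) _; rewrite rnormB.
  have h := hd (b - a); rewrite subr_gt0 in h; have {}h := h ab bd.
  have ew : expR (w * a) <= M.
    by rewrite /M ler_expR; apply: ler_wpM2l => //; exact: as_w SG.
  apply: le_trans (ler_pM (expR_ge0 _) (rnorm_ge0 _) ew h) _.
  by rewrite mulrC divfK// gt_eqF.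
exists (Num.min d 1); first by rewrite lt_min d0 ltr01.
move=> s; rewrite lt_min => /andP[sd s1].
have s0n := ler_norm s0; have s0p := normr_ge0 s0.
have : s - s0 < d /\ s0 - s < d /\ s - s0 < 1.
  by move: sd s1; rewrite !ltr_norml => /andP[? ?] /andP[? ?]; split; [|split]; lra.
move=> [h1 [h2 h3]].
have a0 : 0 <= Num.max s 0 by rewrite le_max lexx orbT.
have b0 : 0 <= Num.max s0 0 by rewrite le_max lexx orbT.
have as0 : Num.max s 0 <= `|s0| + 1.
  by rewrite ge_max; apply/andP; split; lra.
have bs0 : Num.max s0 0 <= `|s0| + 1.
  by rewrite ge_max; apply/andP; split; lra.
have hd1 : Num.max s 0 - Num.max s0 0 < d by case: (lerP s 0); case: (lerP s0 0); lra.
have hd2 : Num.max s0 0 - Num.max s 0 < d by case: (lerP s 0); case: (lerP s0 0); lra.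
have [ab|ba] := leP (Num.max s 0) (Num.max s0 0); first exact: key.
by rewrite rnormB; apply: key => //; exact: ltW.
Qed.

Definition laplace_kernel g y (s : R) : R := expR (- (lam * s)) * rip (S (Num.max s 0) g) y.

Lemma laplace_kernel_continuous g y : continuous (laplace_kernel g y).
Proof.
move=> s; apply: cvgM.
  have := @is_derive_expN s; case=> /derivable1_diffP/differentiable_continuous h _; exact: h.
apply/cvgrPdist_le => /= e e0.
have y0 : 0 < rnorm y + 1 by rewrite ltr_wpDl// rnorm_ge0.
have [d d0 hd] := S_orbit_continuous g s (divr_gt0 e0 y0).
apply/nbhs_ballP; exists d => // r; rewrite /ball/= distrC => /hd h.
rewrite distrC -ripBl; apply: le_trans (rip_abs _ _) _.
apply: (@le_trans _ _ (e / (rnorm y + 1) * (rnorm y + 1))); last by rewrite divfK// gt_eqF.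
by apply: ler_pM; rewrite ?rnorm_ge0// lerDl.
Qed.

(** Primitives are chosen separately for each test vector; uniqueness of their increments makes the
    weak integral linear in that vector. *)
Lemma primitive_unique (F K f : R -> R) : (forall s : R, 0 <= s <= 1 -> is_derive s 1 F (f s)) ->
  (forall s : R, 0 <= s <= 1 -> is_derive s 1 K (f s)) -> F 1 - F 0 = K 1 - K 0.
Proof.
move=> hF hK; have d (s : R) : 0 <= s <= 1 -> is_derive s 1 (F - K) 0.
  move=> s01; have h1 := hF s s01; have h2 := hK s s01.
  by apply: is_derive_eq; rewrite subrr.
have [c _] := MVT_le ler01 d; rewrite mul0r -[(F - K) 1]/(F 1 - K 1) -[(F - K) 0]/(F 0 - K 0).
lra.
Qed.

(* [u] is the integral of [expR (- lam * s) *: S s g] over [0, 1], defined weakly. *)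
Lemma partial_resolvent g : exists u, forall t, 0 < t ->
  G t u = S t (g - (expR (- lam))%:C *: S 1 g - lam%:C *: u).
Proof.
have /choice[F hF] : forall y, exists F : R -> R, forall s : R, 0 <= s <= 1 ->
    is_derive s 1 F (laplace_kernel g y s).
  move=> y; have [F hF] := exists_primitive (-1) (@laplace_kernel_continuous g y).
  by exists F => s /andP[s0 _]; apply: hF; rewrite (lt_le_trans _ s0)// oppr_lt0.
pose l y := F y 1 - F y 0.
have lD y z : l (y + z) = l y + l z.
  have d (s : R) : 0 <= s <= 1 -> is_derive s 1 (F y + F z) (laplace_kernel g (y + z) s).
    move=> s01; have h1 := hF y s s01; have h2 := hF z s s01.
    by apply: is_derive_eq; rewrite /laplace_kernel ripDr; ring.
  rewrite /l (primitive_unique (hF (y + z)) d) -[(_ + _) 1]/(F y 1 + F z 1) -[(_ + _) 0]/(F y 0 + F z 0).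
  by ring.
have lZ a y : l (a%:C *: y) = a * l y.
  have d (s : R) : 0 <= s <= 1 -> is_derive s 1 (a \*: F y) (laplace_kernel g (a%:C *: y) s).
    move=> s01; have h1 := hF y s s01.
    by apply: is_derive_eq; rewrite /laplace_kernel ripZr -[_ *: _]/(_ * _); ring.
  rewrite /l (primitive_unique (hF (a%:C *: y)) d) /= -![_ *: _]/(_ * _).
  by ring.
have lb y : `|l y| <= rnorm g * rnorm y.
  have [c /andP[c0 c1] E] := MVT_le ler01 (hF y).
  rewrite /l E subr0 mulr1 /laplace_kernel normrM (gtr0_norm (expR_gt0 _)) (max_idPl c0).
  apply: (@le_trans _ _ (expR (- (lam * c)) * (expR (w * c) * rnorm g * rnorm y))).
    apply: ler_wpM2l; first exact: expR_ge0.
    apply: le_trans (rip_abs _ _) _; apply: ler_wpM2r; first exact: rnorm_ge0.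
    exact: (as_le SG g c0).
  rewrite mulrA (mulrA (expR _)) -expRD; apply: ler_wpM2r; first exact: rnorm_ge0.
  rewrite -[leRHS]mul1r; apply: ler_wpM2r; first exact: rnorm_ge0.
  rewrite -[leRHS]expR0 ler_expR -mulNr -mulrDl; apply: mulr_le0_ge0 => //.
  by move: wlam; lra.
have [u hu] := riesz lD lZ lb; exists u => t t0; apply: rip_inj => y.
have [C C0 hC] := as_bound SG t.
have Gc : continuous (G t).
  by apply: (@bounded_continuousH _ _ _ _ (C / t)) => x; apply: hC; rewrite t0/=.
have [G' [G'E _]] := adjoint Gc.
have [S' [S'E _]] := adjoint (as_S_continuous SG (ltW t0)).
(* Its derivative combines the kernels tested against [S' y] and [G' y]: the adjoints move [S t] and
   [G t] out of the weakly defined integral. Its increment over [[0, 1]] gives the right-hand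
   side. *)
pose psi (s : R) := expR (- (lam * s)) * rip (S (t + s) g) y.
have dpsi (s : R) : 0 <= s <= 1 -> is_derive s 1 psi
    (- (lam * laplace_kernel g (S' y) s + laplace_kernel g (G' y) s)).
  move=> /andP[s0 _]; have ts : 0 < t + s by rewrite ltr_pwDl.
  have d1 := is_derive_expN s.
  have d2 : is_derive s 1 (fun s => rip (S (t + s) g) y) (rip (- G (t + s) g) y).
    apply: vderive_rip => e e0; have [d d0 hd] := as_vderive g SG ts e0.
    by exists d => // h /hd; rewrite addrA.
  apply: (is_derive_eq (is_deriveM d1 d2)).
  rewrite /laplace_kernel (max_idPl s0) -G'E -S'E -(as_D SG) ?(ltW t0)//.
  rewrite -(as_GDr SG)// (addrC s t) ripNl -![_ *: _]/(_ * _).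
  by ring.
have d (s : R) : 0 <= s <= 1 -> is_derive s 1 (- (lam \*: F (S' y)) - F (G' y))
    (- (lam * laplace_kernel g (S' y) s + laplace_kernel g (G' y) s)).
  move=> s01; have h1 := hF (S' y) s s01; have h2 := hF (G' y) s s01.
  by apply: is_derive_eq; rewrite -[_ *: _]/(_ * _); ring.
have := primitive_unique dpsi d.
rewrite -[(_ - _) 1]/(- (lam * F (S' y) 1) - F (G' y) 1).
rewrite -[(_ - _) 0]/(- (lam * F (S' y) 0) - F (G' y) 0).
have lS : l (S' y) = rip (S t u) y by rewrite hu ripC -S'E.
have lG : l (G' y) = rip (G t u) y by rewrite hu ripC -G'E.
rewrite /psi mulr0 oppr0 expR0 mul1r addr0 mulr1 => E.
rewrite !linearB !ripBl (linearZ_LR (S t)) ripZl (linearZ_LR (S t)) ripZl.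
rewrite -(as_D SG) ?(ltW t0)// -lS -lG /l; lra.
Qed.

(** The integral over [[0, 1]] solves the equation with right-hand side [(1 - exp(- lam) S 1) h]. As
    [w < lam], a Neumann series finds [h] making this equal to [g], so no improper integral is
    needed. *)
Lemma resolvent g : exists u f, (forall t, 0 < t -> G t u = S t f) /\ f + lam%:C *: u = g.
Proof.
pose C x : H := (expR (- lam))%:C *: S 1 x.
have [h hh] : exists h, h - C h = g.
  apply: (@contraction_solve _ _ C (expR (w - lam))) => [x y|x|].
  - by rewrite /C linearB scalerBr.
  - rewrite /C rnormZr gtr0_norm ?expR_gt0// addrC expRD -mulrA.
    apply: ler_wpM2l; first exact: expR_ge0.
    by have := as_le SG x ler01; rewrite mulr1.
  - by rewrite expR_ge0/= -[ltRHS]expR0 ltr_expR subr_lt0.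
have [u hu] := partial_resolvent h.
exists u, (g - lam%:C *: u); split; last by rewrite subrK.
by move=> t t0; rewrite (hu t t0) -/(C h) hh.
Qed.

End resolvent.

(** * Essential coercivity *)

Section compact_operators.
Context (R : realType) (H : hilbertType R).
Implicit Types (x y z u : H) (K T : {linear H -> H}).

Lemma nbhs_rnorm x (d : R) : 0 < d -> nbhs x [set z | rnorm (z - x) < d].
Proof. by move=> d0; exact: ((cvg_rnormP id x).1 cvg_id _ d0). Qed.

Lemma compact_operator_bounded K : compact_operator K -> exists2 C : R, 0 <= C &
  forall x, rnorm (K x) <= C * rnorm x.
Proof.
rewrite /compact_operator precompactE => /compact_near_coveringP cK.
have [|N _ hN] := cK nat \oo (fun n z => rnorm z <= n%:R) _.
  move=> x _; pose N := (Num.truncn (rnorm x + 1)).+1.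
  exists ([set z | rnorm (z - x) < 1], [set n | (N <= n)%N]) => /=.
    by split; [exact: nbhs_rnorm|exists N].
  move=> [z n] /= [zx Nn]; rewrite -(subrK x z); apply: le_trans (rnormD _ _) _.
  apply: (@le_trans _ _ N%:R); last by rewrite ler_nat.
  by apply: le_trans (ltW (truncnS_gt _)); rewrite addrC lerD2l ltW.
exists N%:R => // x; have [->|x0] := eqVneq x 0; first by rewrite linear0 rnorm0 mulr0.
have px := rnorm_gt0 x0; have := hN N (leqnn N) ((rnorm x)^-1%:C *: K x).
rewrite rnormZr gtr0_norm ?invr_gt0// ler_pdivrMl// mulrC; apply.
apply: subset_closure; exists ((rnorm x)^-1%:C *: x); last by rewrite (linearZ_LR K).
by rewrite /= rnormZr gtr0_norm ?invr_gt0// mulVf// gt_eqF.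
Qed.

(** For every [z], [rip (K (u n)) z] tends to 0, and compactness makes this uniform for [z] in the
    closure of the image of the unit ball. Since [z = M1^-1 K (u n)] lies in it,
    [|K (u n)|^2 <= M1 d = e^2] eventually. *)
Lemma compact_operator_weak K (u : nat -> H) (M : R) : compact_operator K ->
  (forall n, rnorm (u n) <= M) ->
  (forall y (e : R), 0 < e -> exists N, forall n, (N <= n)%N -> `|rip (u n) y| <= e) ->
  forall e : R, 0 < e -> exists N, forall n, (N <= n)%N -> rnorm (K (u n)) <= e.
Proof.
move=> cK uM u0; have [C C0 KC] := compact_operator_bounded cK.
have [K' [K'E _]] := adjoint (bounded_continuousH KC).
move: cK; rewrite /compact_operator precompactE => /compact_near_coveringP cK e e0.
have M0 : 0 <= M by apply: le_trans (uM 0%N); exact: rnorm_ge0.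
pose M1 := M + 1; have M10 : 0 < M1 by rewrite ltr_wpDl.
pose d := e ^+ 2 / M1; have d0 : 0 < d by rewrite divr_gt0// exprn_gt0.
have [|N _ hN] := cK nat \oo (fun n z => `|rip (K (u n)) z| <= d) _.
  move=> x _; have d20 : 0 < d / 2 by rewrite divr_gt0.
  have [N hN] := u0 (K' x) _ d20.
  have q0 : 0 < C * M + 1 by rewrite ltr_wpDl// mulr_ge0.
  have e10 : 0 < d / 2 / (C * M + 1) by rewrite divr_gt0.
  exists ([set z | rnorm (z - x) < d / 2 / (C * M + 1)], [set n | (N <= n)%N]) => /=.
    by split; [exact: nbhs_rnorm|exists N].
  move=> [z n] /= [zx Nn]; rewrite -(subrK x z) ripDr; apply: le_trans (ler_normD _ _) _.
  rewrite [leRHS]splitr; apply: lerD; last by rewrite K'E; exact: hN.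
  apply: le_trans (rip_abs _ _) _.
  apply: (@le_trans _ _ ((C * M + 1) * (d / 2 / (C * M + 1)))).
    apply: ler_pM; [exact: rnorm_ge0|exact: rnorm_ge0| |exact: ltW].
    by apply: le_trans (KC _) _; apply: ler_wpDr => //; apply: ler_wpM2l.
  by rewrite mulrC divfK// gt_eqF.
exists N => n Nn; have h := hN n Nn (M1^-1%:C *: K (u n)).
have : closure [set K x | x in [set x | rnorm x <= 1]] (M1^-1%:C *: K (u n)).
  apply: subset_closure; exists (M1^-1%:C *: u n); last by rewrite (linearZ_LR K).
  rewrite /= rnormZr gtr0_norm ?invr_gt0// ler_pdivrMl// mulr1.
  by apply: le_trans (uM n) _; rewrite lerDl.
move=> /h; rewrite ripZr rip_xx normrM !ger0_norm ?sqr_ge0 ?invr_ge0 ?(ltW M10)//.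
rewrite /d [leRHS]mulrC ler_pM2l ?invr_gt0// ler_pXn2r// nnegrE ?rnorm_ge0//.
exact: ltW.
Qed.

Lemma opnorm_ge0 (T : H -> H) : 0 <= opnorm T.
Proof.
rewrite /opnorm; have [h|h] := pselect (has_sup [set rnorm (T x) | x in [set x | rnorm x <= 1]]).
  apply: le_trans (rnorm_ge0 (T 0)) _; apply: sup_upper_bound => //.
  by exists 0 => //=; rewrite rnorm0.
by rewrite sup_out.
Qed.

(** Shows that the set in [essnorm] is nonempty, so that its [inf] is a genuine infimum. *)
Lemma compact_operator0 : exists2 K : {linear H -> H}, compact_operator K & forall x, K x = 0.
Proof.
have zl : linear (fun _ : H => 0 : H) by move=> c x y; rewrite scaler0 addr0.
pose K : {linear H -> H} := HB.pack (fun _ : H => 0 : H) (GRing.isLinear.Build _ _ _ _ _ zl).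
exists K => //; rewrite /compact_operator.
have -> : K @` [set x | rnorm x <= 1] = [set 0].
  by apply/seteqP; split=> [_ [x _ <-]//|_ ->]; exists 0 => //=; rewrite rnorm0.
rewrite precompact_closed; first exact: compact_set1.
exact: (accessible_closed_set1 (hausdorff_accessible (@norm_hausdorff _ _))).
Qed.

(** A compact [K] with [opnorm (T \- K) < b] is invisible on a weakly null sequence, up to the error
    [e]. *)
Lemma essnorm_weak T (b : R) (u : nat -> H) (M : R) : continuous T -> essnorm T < b ->
  (forall n, rnorm (u n) <= M) ->
  (forall y (e : R), 0 < e -> exists N, forall n, (N <= n)%N -> `|rip (u n) y| <= e) ->
  forall e : R, 0 < e -> exists N, forall n, (N <= n)%N -> rnorm (T (u n)) <= b * rnorm (u n) + e.
Proof.
move=> cT Tb uM u0 e e0; have eb : 0 < b - essnorm T by rewrite subr_gt0.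
have hinf : has_inf [set opnorm (T \- K) | K in @compact_operator R H].
  split; last by exists 0 => _ [K _ <-]; exact: opnorm_ge0.
  by have [K cK _] := compact_operator0; exists (opnorm (T \- K)), K.
have [_ [K cK <-]] := inf_adherent eb hinf; rewrite -/(essnorm T) addrC subrK => Kb.
have [N hN] := compact_operator_weak cK uM u0 e0; exists N => n Nn.
rewrite -(subrK (K (u n)) (T (u n))); apply: le_trans (rnormD _ _) _.
apply: lerD; last exact: hN.
have [C C0 KC] := compact_operator_bounded cK; have [D D0 TD] := continuous_bounded cT.
have TKZ (a : R) x : (T \- K) (a%:C *: x) = a%:C *: (T \- K) x.
  by rewrite /= (linearZ_LR T) (linearZ_LR K) scalerBr.
have TKb x : rnorm ((T \- K) x) <= (D + C) * rnorm x.
  by rewrite mulrDl; apply: le_trans (rnormBD _ _) _; exact: lerD.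
apply: le_trans (opnorm_ge TKZ TKb (u n)) _.
by apply: ler_wpM2r; [exact: rnorm_ge0|exact: ltW].
Qed.

End compact_operators.

(** * Choice of the time horizon *)

Section coercivity.
Context (R : realType) (H : hilbertType R).
Implicit Types (x y z u : H).

(** The crude bound [exp(- delta t) <= 1 / (delta t)] is enough: its square beats the linear factor,
    with [t + 1 <= 2 t]. The witness satisfies [q t >= 2 B], where [q = delta^2 eta]. *)
Lemma exp_decay (delta B eta : R) : 0 < delta -> 0 <= B -> 0 < eta ->
  exists2 t : R, 1 <= t & B * (t + 1) * expR (- delta * t) ^+ 2 <= eta.
Proof.
move=> d0 B0 e0; pose q := delta ^+ 2 * eta.
have q0 : 0 < q by rewrite mulr_gt0// exprn_gt0.
exists (1 + 2 * B / q); first by rewrite lerDl divr_ge0 ?mulr_ge0// ltW.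
set t := 1 + 2 * B / q; have t1 : 1 <= t by rewrite /t lerDl divr_ge0 ?mulr_ge0// ltW.
have t0 : 0 < t by exact: lt_le_trans t1.
have dt0 : 0 < delta * t by exact: mulr_gt0.
have h : expR (- delta * t) <= (delta * t)^-1.
  rewrite mulNr expRN lef_pV2 ?posrE ?expR_gt0//.
  by apply: le_trans (expR_ge1Dx _); rewrite lerDr.
have h2 : expR (- delta * t) ^+ 2 <= (delta * t)^-1 ^+ 2.
  by rewrite lerXn2r// nnegrE ?expR_ge0// invr_ge0 ltW.
apply: (@le_trans _ _ (B * (2 * t) * (delta * t)^-1 ^+ 2)).
  apply: ler_pM => //; [by rewrite mulr_ge0// addr_ge0// ltW|].
  by apply: ler_wpM2l => //; rewrite mulr2n mulrDl mul1r lerD2l.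
have -> : B * (2 * t) * (delta * t)^-1 ^+ 2 = 2 * B / (delta ^+ 2 * t).
  by field; rewrite !gt_eqF.
rewrite ler_pdivrMr; last by rewrite mulr_gt0// exprn_gt0.
have -> : eta * (delta ^+ 2 * t) = q * t by rewrite /q; ring.
have -> : q * t = q + 2 * B by rewrite /t mulrDr mulr1 mulrC divfK// gt_eqF.
by rewrite lerDr ltW.
Qed.

Variables (S G : R -> {linear H -> H}) (w : R).
Hypothesis SG : analytic_semigroup S G w.

Lemma engy_mono tau u : 1 <= tau -> inV G tau u ->
  integrable0 1 (fun t => rip (G t u) (G t u)) /\ engy G 1 u u <= engy G tau u u.
Proof.
move=> t1 uV; have tau0 : 0 < tau by exact: lt_le_trans t1.
have ui := inV_integrable SG tau0 uV uV.
have sub : [set` `]0, 1]] `<=` [set` `]0, tau]].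
  by move=> t /=; rewrite !in_itv/= => /andP[-> /le_trans]; apply.
have vi : integrable0 1 (fun t => rip (G t u) (G t u)).
  by move: ui; rewrite /integrable0; apply: integrableS => //; exact: measurable_itv.
split=> //; rewrite /engy /integral0 /Rintegral; apply: fine_le.
- exact: integrable_fin_num.
- exact: integrable_fin_num.
- apply: ge0_subset_integral => //.
  + by case/integrableP: ui.
  + by move=> t _; rewrite lee_fin rip_xx sqr_ge0.
Qed.

Lemma sqrD_le2 (a b : R) : (a + b) ^+ 2 <= 2 * a ^+ 2 + 2 * b ^+ 2.
Proof. by have := sqr_ge0 (a - b); rewrite sqrrB sqrrD; lra. Qed.

(** [K] must not depend on [tau], which is chosen later; so the lower estimate is used on []0, 1]].
    [S 1 u] is then traded for [S t u], whose essential norm can be made small, and the difference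
    is paid for by the energy. *)
Lemma rnorm_engy1 : exists2 K : R, 0 <= K & forall tau t u, 1 <= tau -> inV G tau u -> 1 <= t ->
  rnorm u ^+ 2 <= K * (2 * rnorm (S t u) ^+ 2 + (1 + 2 * (t * expR (w * t)) ^+ 2) * engy G tau u u).
Proof.
have [K K0 hK] := dyadic_lower SG ltr01; pose g := growth w 1.
have g1 : 1 <= g by exact: (growth_ge1 SG ltr01).
pose q := 2 * g ^+ 2; have q1 : 1 <= q.
  by rewrite -[leLHS]mul1r; apply: ler_pM => //; [rewrite ler1n|rewrite expr_ge1// (le_trans _ g1)].
exists (K * q) => [|tau t u t1 uV tt]; first by rewrite mulr_ge0// (le_trans _ q1).
have [ui E1] := engy_mono t1 uV; have hd := dyadic_ge_integral SG ltr01 ui.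
set E0 := engy G 1 u u in E1 hd; rewrite -/g -/q in hd.
have E00 : 0 <= E0 by exact: engy_ge0.
have h1 : rnorm (G 1 u) ^+ 2 <= q * E0.
  by have := hd 1%N; rewrite big_ord_recl big_ord0/= addr0 dy0 mul1r.
have h2 n : \sum_(k < n) dy 1 k ^+ 2 * rnorm (G (dy 1 k) u) ^+ 2 <= q * E0.
  apply: le_trans (hd n); apply: ler_sum => k _; apply: ler_wpM2r; first exact: sqr_ge0.
  by rewrite expr2 ler_piMl ?dy_le// ltW// dy_gt0.
have t0 : 0 < t by exact: lt_le_trans tt.
have h3 : rnorm (S t u - S 1 u) <= expR (w * t) * rnorm (G 1 u) * (t - 1).
  apply: (@vderive_MVT _ _ (fun s => S s u) (fun s => - G s u)) => // s /andP[s1 st].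
    by apply: as_vderive SG _; exact: lt_le_trans s1.
  by rewrite rnormN; exact: (G_growth SG u ltr01 s1 st).
have h4 : rnorm (S 1 u) <= rnorm (S t u) + t * expR (w * t) * rnorm (G 1 u).
  rewrite -[S 1 u](subrK (S t u)) addrC; apply: le_trans (rnormD _ _) _.
  rewrite lerD2l rnormB; apply: le_trans h3 _.
  rewrite mulrC -[leRHS]mulrA; apply: ler_wpM2r.
    by rewrite mulr_ge0 ?rnorm_ge0// expR_ge0.
  by rewrite gerBl.
have h5 : rnorm (S 1 u) ^+ 2 <= 2 * rnorm (S t u) ^+ 2 + 2 * (t * expR (w * t)) ^+ 2 * (q * E0).
  apply: (@le_trans _ _ ((rnorm (S t u) + t * expR (w * t) * rnorm (G 1 u)) ^+ 2)).
    by rewrite lerXn2r// nnegrE ?rnorm_ge0// (le_trans _ h4)// rnorm_ge0.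
  apply: le_trans (sqrD_le2 _ _) _; rewrite lerD2l -[leRHS]mulrA ler_pM2l// [leLHS]exprMn.
  by apply: ler_wpM2l => //; exact: sqr_ge0.
apply: le_trans (hK u _ h2) _; rewrite -mulrA; apply: ler_wpM2l => //.
set T := (t * expR (w * t)) ^+ 2 in h5 *; have T0 : 0 <= T by exact: sqr_ge0.
set Et := engy G tau u u in E1 *; set n1 := rnorm (S t u) ^+ 2 in h5 *.
have n10 : 0 <= n1 by exact: sqr_ge0.
apply: (@le_trans _ _ (2 * n1 + (1 + 2 * T) * (q * E0))); first by move: h5; clear; lra.
rewrite mulrDr; apply: lerD; first by rewrite ler_peMl// mulr_ge0.
rewrite mulrCA; apply: ler_wpM2l; first exact: le_trans q1.
by apply: ler_wpM2l => //; rewrite addr_ge0// mulr_ge0.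
Qed.

End coercivity.

Section coercivity_estimates.
Context (R : realType).

(** To be read with [X = |u|^2], [A = |S t0 u|^2], [E] the energy, [eps] the squared essential bound
    at [t0] and [r] a small error. *)
Lemma absorb_norm (K p eps X A E r : R) : 0 <= K -> 4 * K * eps <= 2^-1 -> 0 <= X ->
  X <= K * (2 * A + p * E) -> A <= 2 * eps * X + 2 * r -> X <= 8 * K * r + 2 * K * p * E.
Proof.
move=> K0 h1 X0 h2 h3; have := ler_wpM2l K0 h3; have := ler_wpM2r X0 h1.
by move: h2; clear; lra.
Qed.

(** Here [B = |S t1 u|^2], [eps] belongs to [t1], and [tau Q B] bounds the boundary terms of the
    form. The smallness condition leaves a quarter of [E] on the left. *)
Lemma absorb_energy (K P Q tau eps X B E r q : R) : 0 <= Q -> 0 <= tau -> 0 <= eps -> 0 <= E ->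
  2 * Q * P * tau * eps <= 4^-1 -> X <= 8 * K * q + P * E -> B <= 2 * eps * X + 2 * q ->
  2^-1 * E - tau * Q * B <= r -> E <= 4 * (r + (16 * K * tau * Q * eps + 2 * tau * Q) * q).
Proof.
move=> Q0 t0 e0 E0 h1 h2 h3 h4.
have tQ : 0 <= tau * Q by exact: mulr_ge0.
have tQe : 0 <= tau * Q * eps by exact: mulr_ge0.
have := ler_wpM2l tQ h3; have := ler_wpM2l tQe h2; have := ler_wpM2r E0 h1.
by move: h4; clear; lra.
Qed.

End coercivity_estimates.

Section coercive_time.
Context (R : realType) (H : hilbertType R).
Implicit Types (x y z u : H).
Variables (S G : R -> {linear H -> H}) (w : R).
Hypothesis SG : analytic_semigroup S G w.

Definition weakly_null (u : nat -> H) : Prop :=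
  forall y (e : R), 0 < e -> exists N, forall n, (N <= n)%N -> `|rip (u n) y| <= e.

Lemma weakly_null_bounded (u : nat -> H) : weakly_null u -> exists M : R, forall n, rnorm (u n) <= M.
Proof.
move=> u0; apply: uniform_boundedness => y; have [N hN] := u0 y 1 ltr01.
exists (1 + \sum_(i < N) `|rip (u i) y|) => n.
have s0 : 0 <= \sum_(i < N) `|rip (u i) y| by apply: sumr_ge0.
have [nN|Nn] := ltnP n N; last by apply: le_trans (hN n Nn) _; rewrite lerDl.
rewrite (bigD1 (Ordinal nN))//= addrCA lerDl addr_ge0//; exact: sumr_ge0.
Qed.

Lemma exists_coercive_time : asymptotically_compact S -> exists2 tau : R, 0 < tau &
  forall u : nat -> H, (forall n, inV G tau (u n)) -> weakly_null u ->
  (forall e : R, 0 < e -> exists N, forall n, (N <= n)%N -> formR S G tau (u n) (u n) <= e) ->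
  forall e : R, 0 < e -> exists N, forall n, (N <= n)%N ->
    engy G tau (u n) (u n) + rnorm (u n) ^+ 2 <= e.
Proof.
move=> [M [delta [M0 d0 hM]]]; have [K K0 hK] := rnorm_engy1 SG.
(* [M + 1] instead of [M] makes the bound on the essential norm strict. *)
pose eps (t : R) := (M + 1) * expR (- delta * t).
have epsE t : 0 <= t -> essnorm (S t) < eps t.
  move=> t0; apply: le_lt_trans (hM t t0) _; rewrite /eps mulrDl mul1r ltrDl.
  exact: expR_gt0.
have eps2 t : eps t ^+ 2 = (M + 1) ^+ 2 * expR (- delta * t) ^+ 2 by rewrite exprMn.
have M20 : 0 <= (M + 1) ^+ 2 by exact: sqr_ge0.
have B1 : 0 <= 4 * K * (M + 1) ^+ 2 by apply: mulr_ge0 => //; rewrite mulr_ge0.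
have h2 : 0 < (2^-1 : R) by rewrite invr_gt0.
(* This time only serves to bound [|u|^2] by the energy. It is fixed first, so that [P] is known
   before [tau] is chosen. *)
have [t0 t01 ht0] := exp_decay d0 B1 h2.
have t00 : 0 <= t0 by exact: le_trans t01.
have e0K : 4 * K * eps t0 ^+ 2 <= 2^-1.
  apply: le_trans ht0; rewrite eps2 mulrA; apply: ler_wpM2r; first exact: sqr_ge0.
  by rewrite ler_peMr// lerDr.
pose p := 1 + 2 * (t0 * expR (w * t0)) ^+ 2; pose P := 2 * K * p.
have p0 : 0 <= p by rewrite addr_ge0// mulr_ge0// sqr_ge0.
have P0 : 0 <= P by do 2!apply: mulr_ge0 => //.
have [C C0 hC] := as_bound SG 1.
have GC y : rnorm (G 1 y) <= C * rnorm y.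
  by have := hC 1 y; rewrite ltr01 lexx divr1; apply.
pose g := expR w; have g0 : 0 <= g by exact: expR_ge0.
have SC y : rnorm (S 1 y) <= g * rnorm y by have := as_le SG y ler01; rewrite mulr1.
(* [C^2] comes from the boundary term [|G tau u|^2], [C g] from [rip (G tau u) (S tau u)]. *)
pose Q := C ^+ 2 + C * g; have Q0 : 0 <= Q by rewrite addr_ge0 ?sqr_ge0// mulr_ge0.
have B2 : 0 <= 2 * Q * P * (M + 1) ^+ 2.
  by do 3!apply: mulr_ge0 => //.
have h4 : 0 < (4^-1 : R) by rewrite invr_gt0.
have [t1 t11 ht1] := exp_decay d0 B2 h4.
have t10 : 0 <= t1 by exact: le_trans t11.
(* The last unit of time is spent on [G 1] and [S 1], so that both boundary terms are bounded by
   [S t1 u] with constants independent of [tau]. The factor [t + 1] in [exp_decay] is this [tau]. *)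
pose tau := t1 + 1; have tau1 : 1 <= tau by rewrite lerDr.
have tau0 : 0 < tau by exact: lt_le_trans tau1.
exists tau => // u uV u0 uF e e0.
have [Mu hMu] := weakly_null_bounded u0.
pose L := 16 * K * tau * Q * eps t1 ^+ 2 + 2 * tau * Q.
have ep0 : 0 <= eps t1 ^+ 2 by exact: sqr_ge0.
have L0 : 0 <= L.
  have tq : 0 <= tau * Q by apply: mulr_ge0 => //; exact: ltW.
  have tqe : 0 <= K * (tau * Q * eps t1 ^+ 2) by do 2!apply: mulr_ge0 => //.
  by rewrite /L; lra.
(* Eventually [E <= 4 (1 + L) r] and [X <= 8 K r + P E], so [E + X <= Z r <= e]. *)
pose Z := (1 + P) * (4 * (1 + L)) + 8 * K + 1.
have Z0 : 0 < Z by rewrite ltr_wpDl// addr_ge0// ?mulr_ge0// addr_ge0.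
pose r := Num.min 1 (e / Z).
have r0 : 0 < r by rewrite lt_min ltr01 divr_gt0.
have r1 : r <= 1 by rewrite ge_min lexx.
have rZ : Z * r <= e.
  by rewrite -ler_pdivlMl// mulrC ge_min lexx orbT.
have rr : r ^+ 2 <= r by rewrite expr2 ler_piMl// ltW.
have [N0 hN0] := essnorm_weak (as_S_continuous SG t00) (epsE _ t00) hMu u0 r0.
have [N1 hN1] := essnorm_weak (as_S_continuous SG t10) (epsE _ t10) hMu u0 r0.
have [N2 hN2] := uF r r0.
exists (maxn N0 (maxn N1 N2)) => n; rewrite !geq_max => /and3P[n0 n1 n2].
have a1 := hN0 n n0; have b1 := hN1 n n1; have f1 := hN2 n n2; have x1 := hK tau t0 (u n) tau1 (uV n) t01.
have ge := formR_ge SG tau0 (uV n).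
set X := rnorm (u n) ^+ 2 in x1 *; set E := engy G tau (u n) (u n) in x1 ge *.
have X0 : 0 <= X by exact: sqr_ge0.
have E0 : 0 <= E by exact: engy_ge0.
have sq t (b : R) : 0 <= t -> rnorm (S t (u n)) <= b * rnorm (u n) + r ->
    rnorm (S t (u n)) ^+ 2 <= 2 * b ^+ 2 * X + 2 * r ^+ 2.
  move=> t_0 h; apply: (@le_trans _ _ ((b * rnorm (u n) + r) ^+ 2)).
    by rewrite lerXn2r// nnegrE ?rnorm_ge0// (le_trans _ h)// rnorm_ge0.
  by apply: le_trans (sqrD_le2 _ _) _; rewrite lerD2r exprMn mulrA.
have xx := absorb_norm K0 e0K X0 x1 (sq _ _ t00 a1).
rewrite -/p -/P in xx.
have bb := sq _ _ t10 b1; set b := rnorm (S t1 (u n)) in bb b1 *.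
have G1 : rnorm (G tau (u n)) <= C * b by rewrite /tau (as_GDr SG).
have S1 : rnorm (S tau (u n)) <= g * b by rewrite /tau addrC (as_D SG).
have b0 : 0 <= b by exact: rnorm_ge0.
have G2 : rnorm (G tau (u n)) ^+ 2 <= C ^+ 2 * b ^+ 2.
  by rewrite -exprMn lerXn2r// nnegrE ?rnorm_ge0// mulr_ge0.
have rp : - (C * g * b ^+ 2) <= rip (G tau (u n)) (S tau (u n)).
  have := rip_abs (G tau (u n)) (S tau (u n)); rewrite ler_norml => /andP[h _].
  apply: le_trans h; rewrite lerN2; apply: le_trans (ler_pM (rnorm_ge0 _) (rnorm_ge0 _) G1 S1) _.
  by apply: eq_ler; ring.
have fin : 2^-1 * E - tau * Q * b ^+ 2 <= r.
  apply: le_trans f1; apply: le_trans ge.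
  have q1 : 2^-1 * tau * rnorm (G tau (u n)) ^+ 2 <= tau * C ^+ 2 * b ^+ 2.
    rewrite -[leRHS]mulrA; apply: ler_pM => //; [by rewrite mulr_ge0// ltW|exact: sqr_ge0|].
    by rewrite ler_piMl// ?invf_le1// ?ler1n// ltW.
  have q2 : C * g * b ^+ 2 <= tau * (C * g) * b ^+ 2.
    by apply: ler_wpM2r; [exact: sqr_ge0|rewrite ler_peMl// mulr_ge0].
  by rewrite /Q; move: rp q1 q2; clear; lra.
have c1 : 2 * Q * P * tau * eps t1 ^+ 2 <= 4^-1.
  by apply: le_trans ht1; rewrite eps2 /tau; apply: eq_ler; ring.
have EE := absorb_energy Q0 (ltW tau0) ep0 E0 c1 xx bb fin; rewrite -/L in EE.
have E1 : E <= 4 * (1 + L) * r.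
  by apply: le_trans EE _; have := ler_wpM2l L0 rr; clear; lra.
apply: le_trans rZ; rewrite /Z.
have h1P : 0 <= 1 + P by exact: addr_ge0.
have K8 := ler_wpM2l K0 rr; have PE := ler_wpM2l h1P E1.
by move: K8 PE xx r0; clear; lra.
Qed.

End coercive_time.

(** * The associated operator *)

Section association.
Context (R : realType) (H : hilbertType R).
Implicit Types (x y z f : H).
Variables (S G : R -> {linear H -> H}) (w tau : R).
Hypotheses (SG : analytic_semigroup S G w) (tau0 : 0 < tau).

Notation V := (prehilbert (energy_scalar_product SG tau0)).

(** Form and product agree under the integral, because [G2 G t x = G (t / 2) (S (t / 2) f) = G t
    f]. *)
Lemma form_of_generator x f : (forall t, 0 < t -> G t x = S t f) ->
  inV G tau x /\ forall y, formR S G tau x y = ipR S G tau f y.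
Proof.
move=> xf; split.
  apply: (@inV_of_bound _ _ _ _ tau0 _ (growth w tau * rnorm f)) => t /andP[t0 tt].
  by rewrite xf//; apply: (S_growth SG) => //; exact: ltW.
move=> y; rewrite /formR /ipR xf//; congr (_ + _); apply: eq_integral0 => t t0.
have t20 : 0 < t / 2 by rewrite divr_gt0.
by rewrite /G2 xf// -(as_GDr SG)// ?(ltW t20)// -splitr.
Qed.

(** The boundary terms in [formR_ge] are at most [L |x|^2]; [lam] is taken so large that [lam] times
    the product exceeds this by [|x|^2]. *)
Lemma form_injective : exists2 lam : R, w < lam & forall x, inV G tau x ->
  formR S G tau x x + lam * ipR S G tau x x = 0 -> x = 0.
Proof.
have [c [C [c0 _ hc]]] := ipR_equiv SG tau0.
have [B B0 hB] := as_bound SG tau; pose K := B / tau.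
have K0 : 0 <= K by rewrite divr_ge0// ltW.
have GK x : rnorm (G tau x) <= K * rnorm x by apply: hB; rewrite tau0/=.
pose g := growth w tau; have g0 : 0 <= g by exact: growth_ge0.
have Sg x : rnorm (S tau x) <= g * rnorm x by apply: (S_growth SG) => //; exact: ltW.
pose L := tau * K ^+ 2 + K * g.
have L0 : 0 <= L by apply: addr_ge0; apply: mulr_ge0 => //; [exact: ltW|exact: sqr_ge0].
pose lam := Num.max (w + 1) ((L + 1) / c).
have lamc : L + 1 <= lam * c by rewrite -ler_pdivrMr// le_max lexx orbT.
exists lam => [|x xV E]; first by rewrite lt_max ltrDl ltr01.
apply: rnorm0_eq0; have ge := formR_ge SG tau0 xV; have e0 := engy_ge0 G tau x.
have n0 := rnorm_ge0 x; have gn0 := rnorm_ge0 (G tau x).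
set n := rnorm x in n0 *.
have h1 : rnorm (G tau x) ^+ 2 <= K ^+ 2 * n ^+ 2.
  by rewrite -exprMn lerXn2r// nnegrE// mulr_ge0.
have h2 : - (K * g * n ^+ 2) <= rip (G tau x) (S tau x).
  have := rip_abs (G tau x) (S tau x); rewrite ler_norml => /andP[h _].
  apply: le_trans h; rewrite lerN2.
  apply: le_trans (ler_pM (rnorm_ge0 _) (rnorm_ge0 _) (GK x) (Sg x)) _.
  by apply: eq_ler; rewrite -/n; ring.
have [/andP[h3 _] n20] := (hc x, sqr_ge0 n); rewrite -/n in h3.
have lam0 : 0 <= lam.
  by rewrite le_max; apply/orP; right; rewrite divr_ge0 ?(ltW c0)// addr_ge0.
have h4 := ler_wpM2l lam0 h3.
have h5 := ler_wpM2r n20 lamc.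
have h6 := ler_wpM2l (ltW tau0) h1.
have h7 : 0 <= tau * rnorm (G tau x) ^+ 2 by rewrite mulr_ge0 ?sqr_ge0// ltW.
apply/eqP; rewrite -sqrf_eq0 eq_le n20 andbT.
by move: ge E h2 h4 h5 h6 h7 e0; rewrite /L; lra.
Qed.

(** The resolvent provides [x] in the domain of [A] with [(A + lam) x = f + lam u]. The difference
    [d = u - x] annihilates [formR + lam ipR], so [d = 0] and [u] is in the domain too. *)
Lemma generator_of_form (u : V) f :
  (forall v : V, formR S G tau (val u) (val v) = ipR S G tau f (val v)) ->
  forall t, 0 < t -> G t (val u) = S t f.
Proof.
move=> uf; have [lam wlam inj] := form_injective.
have [x [h [xh hE]]] := resolvent SG wlam (f + lam%:C *: val u).
have [xV xf] := form_of_generator xh.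
pose x' : V := Subspace (iffRL (in_form_domain G tau0 x) xV).
have Q := formR_sesqui SG tau0; have P := ipR_sesqui SG tau0.
pose d : V := u - x'.
have dE : val d = val u - x by [].
have fE : f - h = - (lam%:C *: val d).
  rewrite dE scalerBr opprB; apply/eqP; rewrite subr_eq addrAC -subr_eq opprK.
  by rewrite -hE addrC.
have d0 : val d = 0.
  apply: inj; first exact: (form_domainP d).
  have -> : formR S G tau (val d) (val d) = ipR S G tau (f - h) (val d).
    rewrite (rs_Dl P) (rs_Nl _ _ P) -uf -xf.
    have := rs_Dl Q u (- x') d; rewrite (rs_Nl _ _ Q) /=. exact.
  by rewrite fE (rs_Nl _ _ P) (rs_Zl P) addNr.
have -> : val u = x by apply/eqP; rewrite -subr_eq0 -dE d0.
have -> : f = h by apply/eqP; rewrite -subr_eq0 fE d0 scaler0 oppr0.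
exact: xh.
Qed.

Variables (ip : {dot H for (@Num.conj R[i])}) (a : sesquilinear_form R V) (j : {linear V -> H}).
Hypotheses (ipE : forall x y, ip x y = complexify (ipR S G tau) x y)
  (aE : forall u v, a u v = complexify (fun u v : V => formR S G tau (val u) (val v)) u v)
  (jE : forall u, j u = val u).

(** Equality of real parts for all [v] includes that of imaginary parts, through ['i *: v]. *)
Lemma form_eqP u f : (forall v, a u v = ip f (j v)) <->
  forall v : V, formR S G tau (val u) (val v) = ipR S G tau f (val v).
Proof.
split=> h v; first by have := h v; rewrite aE ipE jE => -[].
rewrite aE ipE jE /complexify h; congr (_ +i* _).
exact: (h ('i *: v)).
Qed.

Lemma associated_generator (D : set H) (A : H -> H) :
  is_generator S D (fun x => - A x) -> associated_operator ip j a D A.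
Proof.
move=> DA; split.
  apply/seteqP; split=> [x Dx|_ [u [f /form_eqP uf] <-]].
    have /(generator_iff _ _ SG DA) xf : D x /\ A x = A x by [].
    have [xV xE] := form_of_generator xf.
    exists (Subspace (iffRL (in_form_domain G tau0 x) xV) : V); last by rewrite jE.
    by exists (A x); apply/form_eqP => v; exact: xE.
  have /(generator_iff _ _ SG DA)[] := generator_of_form uf.
  by rewrite jE.
move=> u Du; apply/form_eqP => v.
have /(generator_iff _ _ SG DA) xf : D (j u) /\ A (j u) = A (j u) by [].
by have [_ xE] := form_of_generator xf; rewrite -xE jE.
Qed.

Lemma form_coercive :
  (forall u : nat -> H, (forall n, inV G tau (u n)) -> weakly_null u ->
    (forall e : R, 0 < e -> exists N, forall n, (N <= n)%N -> formR S G tau (u n) (u n) <= e) ->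
    forall e : R, 0 < e -> exists N, forall n, (N <= n)%N ->
      engy G tau (u n) (u n) + rnorm (u n) ^+ 2 <= e) ->
  continuous j -> essentially_positive_coercive a.
Proof.
move=> hcoer jc u u0 ulim; have [C C0 jC] := continuous_bounded jc.
(* Functionals of [H] composed with [j] are functionals of [V], so weak convergence in [V] descends
   to [H]. *)
have wn : weakly_null (fun n => val (u n)).
  move=> y e e0.
  have plin : linear (fun v : V => inner (j v) y : R[i]^o).
    by move=> c v1 v2; rewrite linearP linearDl linearZl_LR.
  pose phi : {linear V -> R[i]^o} :=
    HB.pack (fun v : V => inner (j v) y : R[i]^o) (GRing.isLinear.Build _ _ _ _ _ plin).
  have pc : continuous phi.
    apply: (@bounded_continuous _ _ _ phi (C * rnorm y)) => v.
    rewrite normcn lecR; apply: le_trans (inner_abs _ _) _.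
    by rewrite mulrAC; apply: ler_wpM2r; [exact: rnorm_ge0|exact: jC].
  have e0' : 0 < e%:C by rewrite ltcR.
  have /cvgrPdist_lt/(_ _ e0')[N _ hN] := u0 phi pc.
  exists N => n Nn; have := hN n Nn; rewrite sub0r normrN normcn ltcR => /ltW.
  by apply: le_trans; rewrite -jE; exact: Re_cn.
have uF (e : R) : 0 < e -> exists N, forall n, (N <= n)%N -> formR S G tau (val (u n)) (val (u n)) <= e.
  (* The upper limit is an infimum of suprema over tails; being below [e], it yields a tail on which
     the form is at most [e]. *)
  move=> e0; have : (limn_esup (fun n => (complex.Re (a (u n) (u n)))%:E) < e%:E)%E.
    by apply: le_lt_trans ulim _; rewrite lte_fin.
  move=> /ereal_inf_lt[_ [W [N _ hN] <-] he].
  exists N => n Nn; rewrite -lee_fin.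
  have -> : formR S G tau (val (u n)) (val (u n)) = complex.Re (a (u n) (u n)) by rewrite aE.
  apply: le_trans (ltW he); apply: ereal_sup_ubound; exists n => //; exact: hN.
apply/cvgrPdist_lt => e e0.
have e20 : 0 < (e / 2) ^+ 2 by rewrite exprn_gt0// divr_gt0.
have [N hN] := hcoer _ (fun n => form_domainP (u n)) wn uF _ e20.
exists N => // n Nn /=; rewrite sub0r normrN ger0_norm ?rnorm_ge0//.
apply: (@le_lt_trans _ _ (e / 2)); last by rewrite ltr_pdivrMr// ltr_pMr// ltr1n.
rewrite -(@ler_pXn2r _ 2)// ?nnegrE ?rnorm_ge0// ?divr_ge0 ?(ltW e0)//.
by apply: le_trans (hN n Nn); rewrite -[X in X <= _]rip_xx rip_prehilbert -rip_xx.
Qed.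

End association.

Theorem theorem6p12 (R : realType) (H : hilbertType R)
    (S : R -> {linear H -> H}%R) (D : set H) (A : H -> H)
    (S_C0 : C0_semigroup S)
    (S_asym : asymptotically_compact S)
    (S_contr : quasi_contractive S)
    (S_hol : holomorphic_semigroup S)
    (S_gen : is_generator S D (fun x => - A x)%R) :
  exists (ip : {dot H for (@Num.conj (complex R))}%R) (V : hilbertType R)
         (j : {linear V -> H}%R) (a : sesquilinear_form R V),
    equivalent_scalar_product ip /\ dense_embedding j /\
    continuous_form a /\ essentially_positive_coercive a /\
    associated_operator ip j a D A.
Proof.
have [G [w SG]] := analytic_semigroup_exists S_C0 S_contr S_hol.
have [tau tau0 hcoer] := exists_coercive_time SG S_asym.
have [ip ipeq ipE] := exists_equivalent_product SG tau0.
have [j jd jE] := exists_embedding SG tau0.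
have [a ac aE] := exists_form SG tau0.
exists ip, (prehilbert (energy_scalar_product SG tau0)), j, a.
split=> //; split=> //; split=> //; split.
  by apply: (form_coercive aE jE hcoer); case: jd.
exact: (associated_generator ipE aE jE S_gen).
Qed.
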